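(* Let $\mathcal{J}\subset\mathcal{A}_d$ be a closed ideal with the property that $V(\mathcal{J})\cap\mathbb{S}_d$ is an $\mathcal{A}_d$-totally null set. If $T=(T_1,\ldots,T_d)$ is an absolutely continuous $\mathcal{J}$-constrained commuting row contraction on a separable Hilbert space, then $T$ is pure.
   Context: $d\ge 1$ is an integer, $\mathbb{B}_d\subset\mathbb{C}^d$ is the open unit ball and $\mathbb{S}_d$ its boundary sphere. The Drury-Arveson space $H^2_d$ is the reproducing kernel Hilbert space of holomorphic functions on $\mathbb{B}_d$ with kernel $k(z,w)=1/(1-\langle z,w\rangle)$. $\mathcal{M}_d$ is its multiplier algebra, identified with $\{M_\varphi\}\subset B(H^2_d)$ ($M_\varphi f=\varphi f$) and equipped with the multiplier norm $\|\varphi\|=\|M_\varphi\|_{B(H^2_d)}$. $\mathcal{M}_d$ is weak-$*$ closed in $B(H^2_d)$; its weak-$*$ topology is the one inherited from $B(H^2_d)$ as the dual of the trace class operators. $\mathcal{A}_d\subset\mathcal{M}_d$ is the norm closure of the polynomials in the multiplier norm; its elements extend continuously to $\overline{\mathbb{B}_d}$. A (complex) regular Borel measure $\eta$ on $\mathbb{S}_d$ is $\mathcal{A}_d$-Henkin if the functional $f\mapsto\int_{\mathbb{S}_d}f\,d\eta$ on $\mathcal{A}_d$ extends to a weak-$*$ continuous functional on $\mathcal{M}_d$. A closed subset $K\subset\mathbb{S}_d$ is $\mathcal{A}_d$-totally null if $|\eta|(K)=0$ for every $\mathcal{A}_d$-Henkin regular Borel measure $\eta$ on $\mathbb{S}_d$.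 For a closed ideal $\mathcal{J}\subset\mathcal{A}_d$, $V(\mathcal{J})=\{z\in\overline{\mathbb{B}_d}: f(z)=0\text{ for all }f\in\mathcal{J}\}$. A commuting row contraction on a Hilbert space $\mathcal{H}$ is a $d$-tuple $T=(T_1,\ldots,T_d)$ of commuting operators in $B(\mathcal{H})$ with $\sum_k T_kT_k^*\le I$. For such $T$ there is a unique unital completely contractive algebra homomorphism $\Phi_T:\mathcal{A}_d\to B(\mathcal{H})$, $f\mapsto f(T)$, with $\Phi_T(z_k)=T_k$. $T$ is absolutely continuous if $\Phi_T$ extends to a weak-$*$ continuous map $\mathcal{M}_d\to B(\mathcal{H})$; $T$ is $\mathcal{J}$-constrained if $f(T)=0$ for all $f\in\mathcal{J}$; $T$ is pure if $$\lim_{N\to\infty}\sum_{|\alpha|=N}\frac{N!}{\alpha_1!\cdots\alpha_d!}\|T^{\alpha*}\xi\|^2=0\quad\text{for all }\xi\in\mathcal{H},$$ where $\alpha$ ranges over multi-indices in $\mathbb{N}^d$ (with $0\in\mathbb{N}$), $T^\alpha=T_1^{\alpha_1}\cdots T_d^{\alpha_d}$ and $T^{\alpha*}=(T^\alpha)^*$. *)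

(* Defs.v *)
From HB Require Import structures.
From mathcomp Require Import all_boot all_order all_algebra.
From mathcomp Require Import all_classical all_reals all_analysis.
From mathcomp Require Import complex.
From mathcomp Require mpoly.

Set Implicit Arguments.
Unset Strict Implicit.
Unset Printing Implicit Defensive.

Import Order.TTheory GRing.Theory Num.Theory.
Import numFieldNormedType.Exports.

Local Open Scope classical_set_scope.
Local Open Scope ring_scope.

(** The numField instances do not fire on the concrete type R[i]. *)
HB.instance Definition _ (R : realType) := PseudoPointedMetric.copy R[i] R[i]^o.
HB.instance Definition _ (R : realType) := NormedModule.copy R[i] R[i]^o.

(** Inner products are linear in the first argument. *)
Record hilbertSpace (R : realType) := HilbertSpace {
  hcarrier :> lmodType R[i];
  hdot : {dot hcarrier for (@Num.conj R[i])};
  hcomplete : forall u : nat -> hcarrier,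
    (forall e : R, 0 < e -> exists N, forall m n, (N <= m)%N -> (N <= n)%N ->
       Num.sqrt (complex.Re (hdot (u m - u n) (u m - u n))) < e) ->
    exists l, forall e : R, 0 < e -> exists N, forall n, (N <= n)%N ->
       Num.sqrt (complex.Re (hdot (u n - l) (u n - l))) < e
}.

Section hilbert.
Context {R : realType} {H : hilbertSpace R}.

Definition hip (x y : H) : R[i] := @hdot R H x y.

Definition hnorm (x : H) : R := Num.sqrt (complex.Re (hip x x)).

Definition bounded_op (A : H -> H) : Prop :=
  linear A /\ exists c : R, forall x, hnorm (A x) <= c * hnorm x.

Definition opnorm (A : H -> H) : R :=
  inf [set c : R | 0 <= c /\ forall x, hnorm (A x) <= c * hnorm x].

(** Norm of an operator matrix acting on the Hilbert direct sum H^n. *)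
Definition mxopnorm n (A : 'I_n -> 'I_n -> H -> H) : R :=
  inf [set c : R | 0 <= c /\ forall x : 'I_n -> H,
    Num.sqrt (\sum_i hnorm (\sum_j A i j (x j)) ^+ 2) <=
    c * Num.sqrt (\sum_j hnorm (x j) ^+ 2)].

Definition adjoint (A : H -> H) : H -> H :=
  fun y => xget 0 [set z | forall x, hip (A x) y = hip x z].

(** An orthonormal basis, indexed by nat; a basis of a finite-dimensional space
    is padded with zero vectors.  Such an [e] exists iff H is separable. *)
Definition onb (e : nat -> H) : Prop :=
  [/\ forall i j, i != j -> hip (e i) (e j) = 0,
      forall i, e i = 0 \/ hip (e i) (e i) = 1
    & forall x, (forall i, hip x (e i) = 0) -> x = 0].

Definition hilbert_schmidt (A : H -> H) : Prop :=
  bounded_op A /\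
  exists2 e, onb e & cvgn (series (fun n => hnorm (A (e n)) ^+ 2)).

Definition trace_class (K : H -> H) : Prop :=
  exists A B, [/\ hilbert_schmidt A, hilbert_schmidt B & K = A \o B].

(** The trace computed along [e]; for [onb e] and [trace_class K] the value does
    not depend on [e]. *)
Definition trace (e : nat -> H) (K : H -> H) : R[i] :=
  limn (series (fun n => hip (K (e n)) (e n))).

Definition separable_hilbert : Prop :=
  exists u : nat -> H, forall x (e : R), 0 < e -> exists n, hnorm (x - u n) < e.

End hilbert.

Arguments separable_hilbert {R} H.
Arguments trace_class {R} H K.

(** The weak-* topology of B(H): the coarsest one for which all functionals
    A |-> tr(A K), K trace class, are continuous.  The carrier is H -> H; only the
    topology induced on bounded operators is meaningful. *)
Section weak_star.
Context {R : realType} (H : hilbertSpace R).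

Definition wstar_index : Type :=
  {Ke : (H -> H) * (nat -> H) | trace_class H Ke.1 /\ onb Ke.2}.

Definition wstar_eval (A : H -> H) : prod_topology (fun _ : wstar_index => R[i]) :=
  fun Ke => trace (sval Ke).2 (A \o (sval Ke).1).

Definition wstar : Type := initial_topology wstar_eval.

HB.instance Definition _ :=
  Topological.copy wstar (initial_topology wstar_eval).

End weak_star.

(** The elements are functions on X through the injection [rk_ev]; the space is
    determined by k up to a unitary that respects [rk_ev]. *)
Record rkhs (R : realType) (X : Type) (k : X -> X -> R[i]) := Rkhs {
  rk_space :> hilbertSpace R;
  rk_ev : rk_space -> X -> R[i];
  rk_ev_linear : forall (a : R[i]) (f g : rk_space) (z : X),
    rk_ev (a *: f + g) z = a * rk_ev f z + rk_ev g z;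
  rk_ev_inj : injective rk_ev;
  rk_kernel : X -> rk_space;
  rk_kernelE : forall z w, rk_ev (rk_kernel w) z = k z w;
  rk_reproducing : forall (f : rk_space) (w : X),
    rk_ev f w = hip f (rk_kernel w)
}.

Definition cdot (R : realType) (d : nat) (z w : 'rV[R[i]]_d) : R[i] :=
  \sum_(i < d) z 0 i * Num.conj (w 0 i).

Definition oball (R : realType) (d : nat) : Type :=
  {z : 'rV[R[i]]_d | cdot z z < 1}.

Definition cball (R : realType) (d : nat) : set 'rV[R[i]]_d :=
  [set z | cdot z z <= 1].

Definition sphere (R : realType) (d : nat) : set 'rV[R[i]]_d :=
  [set z | cdot z z = 1].

Definition da_kernel (R : realType) (d : nat) (z w : oball R d) : R[i] :=
  1 / (1 - cdot (sval z) (sval w)).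

(** Functions in this space are holomorphic because the kernel is holomorphic in
    its first variable. *)
Definition druryArveson (R : realType) (d : nat) : Type :=
  rkhs (@da_kernel R d).

Section multipliers.
Context {R : realType} {d : nat} (H2 : druryArveson R d).

Definition Mop (f : oball R d -> R[i]) : H2 -> H2 :=
  fun g => xget 0 [set h | forall z, rk_ev h z = f z * rk_ev g z].

(** Boundedness of the multiplication operator is automatic by the closed graph
    theorem. *)
Definition Md : set (oball R d -> R[i]) :=
  [set f | exists2 A : H2 -> H2, bounded_op A &
             forall g z, rk_ev (A g) z = f z * rk_ev g z].

Definition mnorm (f : oball R d -> R[i]) : R := opnorm (Mop f).

(** The weak-* topology of M_d, inherited from B(H2) through f |-> M_f;
    meaningful on [Md] only. *)
Definition wstarM : Type :=
  initial_topology (fun f : oball R d -> R[i] => (Mop f : wstar H2)).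

HB.instance Definition _ := Topological.copy wstarM
  (initial_topology (fun f : oball R d -> R[i] => (Mop f : wstar H2))).

Definition polyfun : set (oball R d -> R[i]) :=
  [set p | exists P : mpoly.mpoly d R[i],
             p = fun z : oball R d => mpoly.meval (sval z 0) P].

Definition coordfun (i : 'I_d) : oball R d -> R[i] := fun z => sval z 0 i.

Definition Ad : set (oball R d -> R[i]) :=
  [set f | Md f /\ forall e : R, 0 < e ->
             exists2 p, polyfun p & mnorm (f \- p) < e].

(** The value at [z] of the continuous extension of [f] to the closed ball. *)
Definition bdext (f : oball R d -> R[i]) (z : 'rV[R[i]]_d) : R[i] :=
  lim ((fun w => if insub w is Some w' then f w' else 0)
        @ within [set w : 'rV[R[i]]_d | cdot w w < 1] (nbhs z)).

Definition closed_ideal (J : set (oball R d -> R[i])) : Prop :=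
  [/\ J `<=` Ad,
      J (cst 0),
      forall f g, J f -> J g -> J (f \+ g),
      forall f g, Ad f -> J g -> J (f \* g)
    & forall f, Ad f ->
        (forall e : R, 0 < e -> exists2 g, J g & mnorm (f \- g) < e) -> J f].

Definition zero_set (J : set (oball R d -> R[i])) : set 'rV[R[i]]_d :=
  [set z | cball z /\ forall f, J f -> bdext f z = 0].

End multipliers.

Arguments Mop {R d} H2 f.

Definition borelC (R : realType) (d : nat) :=
  g_sigma_algebraType (@open 'rV[R[i]]_d).

(** The complex measure re_pos - re_neg + i (im_pos - im_neg). *)
Record cmeasure (R : realType) (d : nat) := CMeasure {
  re_pos : {finite_measure set (borelC R d) -> \bar R};
  re_neg : {finite_measure set (borelC R d) -> \bar R};
  im_pos : {finite_measure set (borelC R d) -> \bar R};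
  im_neg : {finite_measure set (borelC R d) -> \bar R}
}.

Section measures.
Context {R : realType} {d : nat}.

Definition cmeas (eta : cmeasure R d) (E : set (borelC R d)) : R[i] :=
  Complex (fine (re_pos eta E) - fine (re_neg eta E))
          (fine (im_pos eta E) - fine (im_neg eta E)).

Definition tvar (eta : cmeasure R d) (E : set (borelC R d)) : \bar R :=
  ereal_sup [set (\sum_(0 <= n <oo) (ComplexField.Normc.normc (cmeas eta (F n)))%:E)%E
            | F in [set F : nat -> set (borelC R d) |
                     [/\ forall n, measurable (F n), trivIset setT F
                       & \bigcup_n F n = E]]].

(** Regular Borel measures on the sphere are identified with regular Borel
    measures on C^d carried by the sphere. *)
Definition regular_on_sphere (eta : cmeasure R d) : Prop :=
  tvar eta (~` @sphere R d) = 0%E /\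
  forall (E : set (borelC R d)) (e : R), measurable E -> 0 < e ->
    exists K U : set 'rV[R[i]]_d,
      [/\ compact K, open U, K `<=` E, E `<=` U & (tvar eta (U `\` K) < e%:E)%E].

Definition pint (mu : {finite_measure set (borelC R d) -> \bar R})
    (g : 'rV[R[i]]_d -> R[i]) : R[i] :=
  Complex (\int[mu]_(z in @sphere R d) complex.Re (g z))
          (\int[mu]_(z in @sphere R d) complex.Im (g z)).

Definition cint (eta : cmeasure R d) (g : 'rV[R[i]]_d -> R[i]) : R[i] :=
  (pint (re_pos eta) g - pint (re_neg eta) g) +
  Complex 0 1 * (pint (im_pos eta) g - pint (im_neg eta) g).

Context (H2 : druryArveson R d).

Definition henkin (eta : cmeasure R d) : Prop :=
  exists L : (oball R d -> R[i]) -> R[i],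
    [/\ forall (a : R[i]) f g, Md H2 f -> Md H2 g ->
          L (fun z => a * f z + g z) = a * L f + L g,
        {within (Md H2 : set (wstarM H2)), continuous (L : wstarM H2 -> R[i])}
      & forall f, Ad H2 f -> L f = cint eta (bdext f)].

Definition totally_null (K : set 'rV[R[i]]_d) : Prop :=
  [/\ closed K, K `<=` @sphere R d
    & forall eta : cmeasure R d,
        regular_on_sphere eta -> henkin eta -> tvar eta K = 0%E].

End measures.

Section row_contractions.
Context {R : realType} {d : nat} (H2 : druryArveson R d) {H : hilbertSpace R}.

Definition commuting_row_contraction (T : 'I_d -> H -> H) : Prop :=
  [/\ forall k, bounded_op (T k),
      forall j k, T j \o T k = T k \o T j
    & forall x, 0 <= hip (x - \sum_(k < d) T k (adjoint (T k) x)) x].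

(** [Phi] is the unital completely contractive homomorphism A_d -> B(H) with
    z_k |-> T_k; its restriction to [Ad] is unique.  Norms of matrices over A_d
    are those of the operator matrices [M_f_ij] on H2^n. *)
Definition is_calculus (T : 'I_d -> H -> H)
    (Phi : (oball R d -> R[i]) -> H -> H) : Prop :=
  [/\ (forall f, Ad H2 f -> bounded_op (Phi f)) /\
      (forall (a : R[i]) f g, Ad H2 f -> Ad H2 g ->
        forall x, Phi (fun z => a * f z + g z) x = a *: Phi f x + Phi g x),
      forall f g, Ad H2 f -> Ad H2 g -> Phi (f \* g) = Phi f \o Phi g,
      Phi (cst 1) = id,
      forall n (F : 'I_n -> 'I_n -> oball R d -> R[i]),
        (forall i j, Ad H2 (F i j)) ->
        mxopnorm (fun i j => Phi (F i j)) <=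
        mxopnorm (fun i j => Mop H2 (F i j))
    & forall k, Phi (coordfun k) = T k].

Definition absolutely_continuous (T : 'I_d -> H -> H) : Prop :=
  exists Phi Psi : (oball R d -> R[i]) -> H -> H,
    [/\ is_calculus T Phi,
        forall f, Ad H2 f -> Psi f = Phi f,
        forall f, Md H2 f -> bounded_op (Psi f)
      & {within (Md H2 : set (wstarM H2)),
           continuous (Psi : wstarM H2 -> wstar H)}].

Definition constrained (J : set (oball R d -> R[i])) (T : 'I_d -> H -> H) : Prop :=
  exists2 Phi, is_calculus T Phi & forall f, J f -> Phi f = (fun=> 0).

Definition mpow (T : 'I_d -> H -> H) (a : 'I_d -> nat) : H -> H :=
  \big[(fun A B : H -> H => A \o B)/id]_(i < d) iter (a i) (T i).

(** The entries of a multi-index of length N are at most N, so it is encoded as a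
    finite function into 'I_N.+1. *)
Definition pure (T : 'I_d -> H -> H) : Prop :=
  forall x : H,
    (fun N : nat => \sum_(a : {ffun 'I_d -> 'I_N.+1} | (\sum_i (a i : nat))%N == N)
        (N`!%:R / (\prod_i (a i)`!)%N%:R)
          * hnorm (adjoint (mpow T (fun i => (a i : nat))) x) ^+ 2)
      @ \oo --> (0 : R).

End row_contractions.

(* Main.v *)
From HB Require Import structures.
Require Import Defs.
From mathcomp Require Import all_boot all_order all_algebra.
From mathcomp Require Import all_classical all_reals all_analysis.
From mathcomp Require Import measurable_realfun.
From mathcomp Require Import complex ring lra.
From mathcomp Require mpoly.

(** Write [S_k = T_k^*].  Since [T] is a row contraction, the positive operators
    [Q_N], the sums of [T_w T_w^*] over the words [w] of length [N], decrease, and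
    converge strongly to some [Q] (Qn_cvg).  Purity says that [Q = 0]
    (pure_qform).  The form [q(x, y) = <Q x, y>] is positive, at most
    [<x, y>] on the diagonal, and satisfies [sum_k q(S_k x, S_k y) = q(x, y)]
    (qform_inv): the adjoints are a spherical isometry for [q].

    Such an isometry has a measure.  For each vector [y] there is a positive
    measure [mu] on the sphere whose moments, the integrals of
    [z_p conj(z_r)] for words [p] and [r], are [q(S_r y, S_p y)]
    (spherical_measure).  It is obtained without dilation theory.  A random walk,
    in which the vector [y] moves to [y + e S_k y] with [e^4 = 1] while a point of
    C^d moves by a multiple of [e] in the direction [k], has rescaled laws with
    asymptotically these moments (EN_bias, hmon_regular_rate).  A limit along an
    ultrafilter is a positive functional on all bounded functions
    (walk_functional).  It is turned into a measure by unrolling the corresponding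
    finitely additive mass on a segment: nested partitions of the polydisc into
    small cells become nested partitions of the segment, each abscissa determines
    a point of the polydisc, and [mu] is the image of Lebesgue measure
    (functional_measure).  The moments make the integral of [(1 - |z|^2)^2]
    vanish, so that [mu] is carried by the sphere.

    The measure is Henkin.  For a polynomial [f], hence by density for [f] in the
    ball algebra, the integral of [f] is [<f(T) Q y, y>] (integral_wpoly,
    functional_cint).  By absolute continuity this functional is bounded on a
    weak-* neighbourhood of zero, so it is a finite combination of traces and
    extends weak-* continuously to the multipliers (wstar_extension,
    moment_henkin).  Therefore [mu] does not charge the part of the zero set of the
    ideal that lies on the sphere.

    The rest of the sphere is null as well.  For a polynomial [p] the moments give
    that the integral of [|p|^2] is [q(v, v)] with [v = p(T)^* y], which is at most
    [|p(T)|^2 |y|^2] (integral_sqr_wpoly).  If [f] is in the ideal then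
    [f(T) = 0], so that this tends to zero as [p] tends to [f]; hence [mu] vanishes
    near every point where [f] does not (locally_null), and, by regularity and
    compactness, off the zero set (null_off_zero_set).  Altogether
    [q(y, y) = mu(sphere) = 0] for all [y], and [T] is pure. *)

Set Implicit Arguments.
Unset Strict Implicit.
Unset Printing Implicit Defensive.

Import Order.TTheory GRing.Theory Num.Theory.
Import numFieldNormedType.Exports.

Local Open Scope classical_set_scope.
Local Open Scope ring_scope.
Local Open Scope complex_scope.

Notation normc := ComplexField.Normc.normc.

(** * Hilbert spaces and positive forms *)

Section normc_lemmas.
Context {R : realType}.
Implicit Types x y : R[i].

Lemma normcE x : `|x| = (normc x)%:C.
Proof. by []. Qed.

Lemma ltr0c (k : R) : (0 < k%:C) = (0 < k).
Proof. exact: (ltcR 0). Qed.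

Lemma normc_ge0 x : 0 <= normc x.
Proof. by case: x => a b; exact: sqrtr_ge0. Qed.

Lemma normc0_eq0 x : normc x = 0 -> x = 0.
Proof. exact: ComplexField.Normc.eq0_normc. Qed.

Lemma normcM x y : normc (x * y) = normc x * normc y.
Proof. exact: ComplexField.Normc.normcM. Qed.

Lemma ler_normcD x y : normc (x + y) <= normc x + normc y.
Proof. by rewrite -lecR rmorphD /= -!normcE ler_normD. Qed.

Lemma normcN x : normc (- x) = normc x.
Proof. by apply: complexI; rewrite -!normcE normrN. Qed.

Lemma conjE x : Num.conj x = conjc x.
Proof. by []. Qed.

Lemma normcJ x : normc (Num.conj x) = normc x.
Proof. by apply: complexI; rewrite -!normcE norm_conjC. Qed.

Lemma normc_real (a : R) : normc a%:C = `|a|.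
Proof. by rewrite /= expr0n addr0 sqrtr_sqr. Qed.

Lemma sqr_normcE x : x * Num.conj x = (normc x ^+ 2)%:C.
Proof. by rewrite -normCK rmorphXn. Qed.

Lemma Re_le_normc x : `|complex.Re x| <= normc x.
Proof. by rewrite -lecR; exact: normc_ge_Re. Qed.

Lemma Im_le_normc x : `|complex.Im x| <= normc x.
Proof.
case: x => a b /=; rewrite -sqrtr_sqr ler_sqrt ?addr_ge0 ?sqr_ge0//.
by rewrite lerDr sqr_ge0.
Qed.

Lemma normc_le_ReIm x : normc x <= `|complex.Re x| + `|complex.Im x|.
Proof.
by rewrite {1}[x]complexE (le_trans (ler_normcD _ _))// normcM !normc_real /=
  expr0n add0r expr1n sqrtr1 mul1r.
Qed.

End normc_lemmas.

Section psd_forms.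
Context {R : realType} {V : lmodType R[i]}.

Definition psd_form (B : V -> V -> R[i]) : Prop :=
  [/\ forall a x y z, B (a *: x + y) z = a * B x z + B y z,
      forall x y, B y x = Num.conj (B x y)
    & forall x, 0 <= B x x].

Variables (B : V -> V -> R[i]) (Bpsd : psd_form B).

Lemma formC x y : B y x = Num.conj (B x y).
Proof. by case: Bpsd. Qed.

Lemma formP a x y z : B (a *: x + y) z = a * B x z + B y z.
Proof. by case: Bpsd. Qed.

Lemma form0l z : B 0 z = 0.
Proof.
have := formP 1 0 0 z; rewrite scale1r addr0 mul1r => /eqP.
by rewrite -subr_eq subrr => /eqP.
Qed.

Lemma formDl x y z : B (x + y) z = B x z + B y z.
Proof. by rewrite -[x in LHS]scale1r formP mul1r. Qed.

Lemma formZl a x z : B (a *: x) z = a * B x z.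
Proof. by rewrite -[a *: x]addr0 formP form0l addr0. Qed.

Lemma formDr x y z : B z (x + y) = B z x + B z y.
Proof. by rewrite formC formDl rmorphD [B z x]formC [B z y]formC. Qed.

Lemma formZr a x z : B z (a *: x) = Num.conj a * B z x.
Proof. by rewrite formC formZl rmorphM [B z x]formC. Qed.

Lemma form0r z : B z 0 = 0.
Proof. by rewrite formC form0l rmorph0. Qed.

Lemma formNl x z : B (- x) z = - B x z.
Proof. by rewrite -scaleN1r formZl mulN1r. Qed.

Lemma formNr x z : B z (- x) = - B z x.
Proof. by rewrite formC formNl rmorphN [B z x]formC. Qed.

Lemma form_suml I (r : seq I) (F : I -> V) z :
  B (\sum_(i <- r) F i) z = \sum_(i <- r) B (F i) z.
Proof.
by elim: r => [|i r IH]; rewrite ?big_nil ?form0l// !big_cons formDl IH.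
Qed.

Lemma form_sumr I (r : seq I) (F : I -> V) z :
  B z (\sum_(i <- r) F i) = \sum_(i <- r) B z (F i).
Proof.
by elim: r => [|i r IH]; rewrite ?big_nil ?form0r// !big_cons formDr IH.
Qed.

Lemma form_ge0 x : 0 <= B x x.
Proof. by case: Bpsd. Qed.

Lemma form_re x : B x x = (complex.Re (B x x))%:C.
Proof. by rewrite RRe_real// ger0_real// form_ge0. Qed.

Lemma Re_form_ge0 x : 0 <= complex.Re (B x x).
Proof. by rewrite -ler0c -form_re form_ge0. Qed.

(** The usual discriminant argument; when [B y y = 0] the form would become
    negative along the line through [x] in the direction [- B x y *: y]. *)
Lemma form_CauchySchwarz x y :
  normc (B x y) ^+ 2 <= complex.Re (B x x) * complex.Re (B y y).
Proof.
set a := complex.Re (B x x); set c := complex.Re (B y y).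
have ha : 0 <= a := Re_form_ge0 x.
have hc : 0 <= c := Re_form_ge0 y.
have h : B x y * conjc (B x y) = (normc (B x y) ^+ 2)%:C by exact: sqr_normcE.
have : 0 <= normc (B x y) ^+ 2 by rewrite exprn_ge0// normc_ge0.
move: (normc (B x y) ^+ 2) h => n2 h n2_ge0.
have key (s : R) : 0 <= a - 2 * s * n2 + s ^+ 2 * n2 * c.
  rewrite -ler0c.
  suff -> : (a - 2 * s * n2 + s ^+ 2 * n2 * c)%:C =
    B (x - (s%:C * B x y) *: y) (x - (s%:C * B x y) *: y) by exact: form_ge0.
  rewrite !(formDl, formDr, formNl, formNr, formZl, formZr) [B y x]formC.
  rewrite (form_re x) (form_re y) -/a -/c rmorphM /= !conjE conjc_real.
  rewrite !(rmorphD, rmorphN, rmorphM, rmorphXn, rmorph_nat) /= -h.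
  by ring.
have [c0|c_neq0] := eqVneq c 0.
  rewrite c0 mulr0 leNgt; apply/negP => n2_gt0.
  have := key ((a + 1) / n2); rewrite c0 mulr0 addr0.
  rewrite -mulrA -mulrA mulVf ?gt_eqF// mulr1; lra.
have c_gt0 : 0 < c by rewrite lt_neqAle eq_sym c_neq0.
have := key c^-1.
have -> : a - 2 * c^-1 * n2 + c^-1 ^+ 2 * n2 * c = a - n2 / c by field.
by rewrite subr_ge0 ler_pdivrMr.
Qed.

End psd_forms.

Section hilbert_basics.
Context {R : realType} {H : hilbertSpace R}.
Implicit Types x y z : H.

Lemma hip_psd : psd_form (@hip R H).
Proof.
split=> [a x y z|x y|x].
- by rewrite /hip linearPl.
- by rewrite /hip hermC expr0 mul1r.
- exact: dnorm_ge0.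
Qed.

Lemma hipC x y : hip y x = Num.conj (hip x y).
Proof. exact: (formC hip_psd). Qed.

Lemma hip0l z : hip 0 z = 0.
Proof. exact: (form0l hip_psd). Qed.

Lemma hip0r z : hip z 0 = 0.
Proof. exact: (form0r hip_psd). Qed.

Lemma hipDl x y z : hip (x + y) z = hip x z + hip y z.
Proof. exact: (formDl hip_psd). Qed.

Lemma hipDr x y z : hip z (x + y) = hip z x + hip z y.
Proof. exact: (formDr hip_psd). Qed.

Lemma hipNl x z : hip (- x) z = - hip x z.
Proof. exact: (formNl hip_psd). Qed.

Lemma hipNr x z : hip z (- x) = - hip z x.
Proof. exact: (formNr hip_psd). Qed.

Lemma hipBl x y z : hip (x - y) z = hip x z - hip y z.
Proof. by rewrite hipDl hipNl. Qed.

Lemma hipBr x y z : hip z (x - y) = hip z x - hip z y.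
Proof. by rewrite hipDr hipNr. Qed.

Lemma hipZl a x z : hip (a *: x) z = a * hip x z.
Proof. exact: (formZl hip_psd). Qed.

Lemma hipZr a x z : hip z (a *: x) = Num.conj a * hip z x.
Proof. exact: (formZr hip_psd). Qed.

Lemma hip_suml I (r : seq I) (F : I -> H) z :
  hip (\sum_(i <- r) F i) z = \sum_(i <- r) hip (F i) z.
Proof. exact: (form_suml hip_psd). Qed.

Lemma hip_sumr I (r : seq I) (F : I -> H) z :
  hip z (\sum_(i <- r) F i) = \sum_(i <- r) hip z (F i).
Proof. exact: (form_sumr hip_psd). Qed.

Lemma hipxx x : hip x x = (hnorm x ^+ 2)%:C.
Proof. by rewrite (form_re hip_psd) sqr_sqrtr// (Re_form_ge0 hip_psd). Qed.

Lemma Re_hipxx x : complex.Re (hip x x) = hnorm x ^+ 2.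
Proof. by rewrite hipxx. Qed.

Lemma hnorm_ge0 x : 0 <= hnorm x.
Proof. exact: sqrtr_ge0. Qed.

Lemma hnorm0 : hnorm (0 : H) = 0.
Proof. by rewrite /hnorm hip0l sqrtr0. Qed.

Lemma hip_eq0 x : hip x x = 0 -> x = 0.
Proof. by move=> h; apply/eqP; rewrite -(dnorm_eq0 (@hdot R H)); apply/eqP. Qed.

Lemma hnorm_eq0 x : hnorm x = 0 -> x = 0.
Proof. by move=> h; apply: hip_eq0; rewrite hipxx h expr0n. Qed.

Lemma hip_normc x y : normc (hip x y) <= hnorm x * hnorm y.
Proof.
rewrite -(@ler_pXn2r _ 2)// ?nnegrE ?mulr_ge0 ?hnorm_ge0 ?normc_ge0//.
by rewrite exprMn -!Re_hipxx (form_CauchySchwarz hip_psd).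
Qed.

Lemma hnormZ a x : hnorm (a *: x) = normc a * hnorm x.
Proof.
apply/eqP; rewrite -(@eqrXn2 _ 2)// ?mulr_ge0 ?hnorm_ge0 ?normc_ge0//.
rewrite exprMn -(inj_eq (@complexI R)) -hipxx hipZl hipZr.
by rewrite mulrA sqr_normcE hipxx -rmorphM.
Qed.

Lemma hnormN x : hnorm (- x) = hnorm x.
Proof. by rewrite -scaleN1r hnormZ normcN normc_real normr1 mul1r. Qed.

Lemma hnormB x y : hnorm (x - y) = hnorm (y - x).
Proof. by rewrite -hnormN opprB. Qed.

Lemma sqr_hnormD x y :
  hnorm (x + y) ^+ 2 = hnorm x ^+ 2 + hnorm y ^+ 2 + 2 * complex.Re (hip x y).
Proof.
rewrite -!Re_hipxx hipDl !hipDr [hip y x]hipC.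
by case: (hip x x) (hip y y) (hip x y) => ? ? [? ?] [? ?] /=; ring.
Qed.

Lemma ler_hnormD x y : hnorm (x + y) <= hnorm x + hnorm y.
Proof.
rewrite -(@ler_pXn2r _ 2)// ?nnegrE ?addr_ge0 ?hnorm_ge0// sqr_hnormD sqrrD.
rewrite addrAC lerD2r lerD2l -[leRHS]mulr_natl ler_pM2l//.
by rewrite (le_trans _ (hip_normc x y))// (le_trans (ler_norm _)) ?Re_le_normc.
Qed.

Lemma parallelogram x y :
  hnorm (x + y) ^+ 2 + hnorm (x - y) ^+ 2 = 2 * (hnorm x ^+ 2 + hnorm y ^+ 2).
Proof.
rewrite !sqr_hnormD hnormN hipNr.
by case: (hip x y) => a b /=; ring.
Qed.

Lemma hip_inj x y : (forall z, hip z x = hip z y) -> x = y.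
Proof.
move=> h; apply/eqP; rewrite -subr_eq0; apply/eqP/hip_eq0.
by rewrite hipDr hipNr h subrr.
Qed.

End hilbert_basics.

(** Limits in norm, with the space of vectors carrying no topology. *)
Definition hcvg {R : realType} {H : hilbertSpace R} (u : nat -> H) (l : H) : Prop :=
  forall e : R, 0 < e -> exists N, forall n, (N <= n)%N -> hnorm (u n - l) < e.

Section hilbert_limits.
Context {R : realType} {H : hilbertSpace R}.
Implicit Types (u : nat -> H) (x y l : H).

Lemma hcvg_complete u :
  (forall e : R, 0 < e -> exists N, forall m n, (N <= m)%N -> (N <= n)%N ->
     hnorm (u m - u n) < e) -> exists l, hcvg u l.
Proof. exact: hcomplete. Qed.

Lemma hcvg_norm u l : hcvg u l -> (fun n => hnorm (u n - l)) @ \oo --> (0 : R).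
Proof.
move=> ul; apply/cvgrPdist_lt => e /ul[N hN]; near=> n.
rewrite sub0r normrN ger0_norm ?hnorm_ge0// hN//.
by near: n; exists N.
Unshelve. all: by end_near. Qed.

Lemma hcvg_hip u l y : hcvg u l -> (fun n => normc (hip (u n) y - hip l y)) @ \oo --> (0 : R).
Proof.
move=> /hcvg_norm ul.
apply: (@squeeze_cvgr _ _ _ _ (cst 0) (fun n => hnorm (u n - l) * hnorm y)).
- near=> n; rewrite normc_ge0/=.
  by rewrite -hipNl -hipDl hip_normc.
- exact: cvg_cst.
- by rewrite -[X in _ --> X](mul0r (hnorm y)); apply: cvgM => //; exact: cvg_cst.
Unshelve. all: by end_near. Qed.

End hilbert_limits.

(** * Orthogonal projection and graphs *)

Lemma invS_lt {R : realType} (e : R) : 0 < e -> exists N : nat, N.+1%:R^-1 < e.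
Proof.
move=> e0; have [N _ hN] := near_infty_natSinv_lt (PosNum e0).
by exists N; apply: hN => /=.
Qed.

Section riesz.
Context {R : realType} {H : hilbertSpace R}.

(** The functional is given by its graph [G], so that its domain may be any
    subspace, and so that it need not be known in advance to be single-valued.
    The representing vector is the limit of a minimizing sequence of
    [|x|^2 - 2 Re c] over [G], which is Cauchy by the parallelogram law. *)
Lemma riesz_graph (G : H -> R[i] -> Prop) (K : R) :
  0 <= K -> G 0 0 ->
  (forall a x c y b, G x c -> G y b -> G (a *: x + y) (a * c + b)) ->
  (forall x c, G x c -> normc c <= K * hnorm x) ->
  exists2 h, hnorm h <= K & forall x c, G x c -> c = hip x h.
Proof.
move=> K0 G0 Glin Gbd.
pose f (x : H) (c : R[i]) : R := hnorm x ^+ 2 - 2 * complex.Re c.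
pose E := [set r | exists x c, G x c /\ r = f x c].
have E_inf : has_inf E.
  split; first by exists (f 0 0), 0, 0.
  exists (- K ^+ 2) => _ [x [c [/Gbd xc ->]]].
  have := le_trans (ler_norm _) (le_trans (Re_le_normc c) xc).
  rewrite /f; have := sqr_ge0 (hnorm x - K).
  by nra.
have [I [lbI infI]] : exists I : R, (forall x c, G x c -> I <= f x c) /\
    (forall e : R, 0 < e -> exists x c, G x c /\ f x c < I + e).
  exists (inf E); split=> [x c xc|e e0]; first by apply: ge_inf; [case: E_inf|exists x, c].
  by have [_ [x [c [xc ->]]] lt] := inf_adherent e0 E_inf; exists x, c.
have /choice[xc_ xcP] : forall n : nat, exists p : H * R[i],
    G p.1 p.2 /\ f p.1 p.2 < I + n.+1%:R^-1.
  move=> n; have [|x [c ?]] := infI n.+1%:R^-1; first by rewrite invr_gt0.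
  by exists (x, c).
(* The midpoint of two points of the graph is in the graph, where [f >= I]. *)
have mid x c y b : G x c -> G y b ->
    hnorm (x - y) ^+ 2 <= 2 * (f x c - I) + 2 * (f y b - I).
  move=> xc yb.
  have := lbI _ _ (Glin (2^-1)%:C _ _ _ _ (Glin 1 _ _ _ _ xc yb) G0).
  rewrite scale1r mul1r !addr0 /f hnormZ normc_real ger0_norm ?invr_ge0// exprMn.
  have -> : complex.Re ((2^-1)%:C * (c + b)) = 2^-1 * (complex.Re c + complex.Re b).
    by case: c {xc} => ? ?; case: b {yb} => ? ? /=; rewrite mul0r subr0.
  have -> : 2^-1 ^+ 2 = 4^-1 :> R by field.
  have := parallelogram x y; lra.
have [h hP] : exists h, hcvg (fun n => (xc_ n).1) h.
  apply: hcvg_complete => e e0.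
  have [N N_lt] : exists N : nat, N.+1%:R^-1 < e ^+ 2 / 4 :> R.
    by apply: invS_lt; rewrite divr_gt0 ?exprn_gt0.
  exists N => m n Nm Nn.
  have [Gm fm] := xcP m; have [Gn fn] := xcP n.
  have le_inv k : (N <= k)%N -> k.+1%:R^-1 <= N.+1%:R^-1 :> R.
    by move=> Nk; rewrite lef_pV2 ?posrE// ler_nat.
  have := mid _ _ _ _ Gm Gn; have := le_inv _ Nm; have := le_inv _ Nn.
  rewrite -(@ltr_pXn2r _ 2)// ?nnegrE ?hnorm_ge0 ?(ltW e0)//.
  move: fm fn N_lt; move: (m.+1%:R^-1) (n.+1%:R^-1) (N.+1%:R^-1) (f _ _) (f _ _) => *; lra.
have hE x c : G x c -> c = hip x h; last first.
  exists h => //.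
  have [-> //|h_neq0] := eqVneq (hnorm h) 0.
  have h_gt0 : 0 < hnorm h by rewrite lt_neqAle eq_sym h_neq0 hnorm_ge0.
  rewrite -(ler_pM2r h_gt0); apply/ler_addgt0Pr => e e0.
  have [N hN] := hP (e / (hnorm h + K)) (divr_gt0 e0 (ltr_wpDr K0 h_gt0)).
  have := hN N (leqnn _); set xn := (xc_ N).1 => dn.
  have [Gn _] := xcP N.
  have : complex.Re (hip xn h) <= K * (hnorm h + hnorm (xn - h)).
    rewrite -(hE _ _ Gn) (le_trans (ler_norm _))// (le_trans (Re_le_normc _))//.
    rewrite (le_trans (Gbd _ _ Gn))// ler_wpM2l//.
    by have := ler_hnormD h (xn - h); rewrite addrC subrK.
  have : - complex.Re (hip (xn - h) h) <= hnorm (xn - h) * hnorm h.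
    rewrite (le_trans (ler_norm _))// normrN (le_trans (Re_le_normc _))//.
    exact: hip_normc.
  have : hnorm (xn - h) * (hnorm h + K) <= e.
    by rewrite -ler_pdivlMr ?ltr_wpDr// ltW.
  have -> : complex.Re (hip (xn - h) h) = complex.Re (hip xn h) - hnorm h ^+ 2.
    by rewrite hipBl raddfB /= Re_hipxx.
  by rewrite expr2; lra.
move=> xc; apply/eqP; rewrite -subr_eq0; apply/eqP/normc0_eq0.
set w := c - hip x h.
(* First variation: compare [f] at a late term with its value at that term plus
   [t *: x], and let the term tend to [h]. *)
have var (t : R[i]) : 2 * complex.Re (t * w) <= normc t ^+ 2 * hnorm x ^+ 2.
  apply/ler_addgt0Pr => e e0.
  pose B := 2 * normc t * hnorm x.
  have B0 : 0 <= B by rewrite !mulr_ge0 ?normc_ge0 ?hnorm_ge0.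
  have [N1 hN1] := hP (e / 2 / (B + 1)) (divr_gt0 (divr_gt0 e0 (ltr0n _ 2)) (ltr_pwDr ltr01 B0)).
  have [N2 hN2] : exists N : nat, N.+1%:R^-1 < e / 2 by apply: invS_lt; lra.
  pose n := maxn N1 N2.
  have ln : n.+1%:R^-1 < e / 2.
    by rewrite (le_lt_trans _ hN2)// lef_pV2 ?posrE// ler_nat ltnS leq_maxr.
  have [Gn fn] := xcP n; have := hN1 n (leq_maxl _ _).
  have := lbI _ _ (Glin t _ _ _ _ xc Gn).
  set xn := (xc_ n).1 in Gn fn *; set cn := (xc_ n).2 in Gn fn *.
  move=> lbn dn.
  have cross : complex.Re (t * (hip x xn - hip x h)) <= normc t * (hnorm x * hnorm (xn - h)).
    rewrite -hipNr -hipDr.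
    rewrite (le_trans (ler_norm _))// (le_trans (Re_le_normc _))// normcM.
    by rewrite ler_wpM2l ?normc_ge0// hip_normc.
  have small : B * hnorm (xn - h) <= e / 2.
    rewrite (@le_trans _ _ (B * (e / 2 / (B + 1))))//; first by rewrite ler_wpM2l// ltW.
    rewrite mulrCA ger_pMr ?divr_gt0// ler_pdivrMr ?mul1r; last by lra.
    by lra.
  move: lbn fn cross small; rewrite /f /B sqr_hnormD hnormZ exprMn hipZl /w.
  rewrite ![t * (_ - _)]mulrBr !raddfB !raddfD /=.
  move: ln; move: (n.+1%:R^-1) => ?; lra.
have n2_ge0 : 0 <= normc w ^+ 2 by rewrite exprn_ge0 ?normc_ge0.
have X_ge0 : 0 <= hnorm x ^+ 2 by rewrite exprn_ge0 ?hnorm_ge0.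
apply/eqP; rewrite -sqrf_eq0 eq_le n2_ge0 andbT leNgt; apply/negP => n2_gt0.
(* A small multiple of the conjugate of [w] makes the left side of [var] win. *)
pose s := (hnorm x ^+ 2 + 1)^-1.
have s0 : 0 < s by rewrite invr_gt0; lra.
have := var (s%:C * Num.conj w).
rewrite -mulrA [Num.conj w * w]mulrC sqr_normcE -rmorphM /= normcM normcJ.
rewrite normc_real gtr0_norm// exprMn.
have sX : s * hnorm x ^+ 2 <= 1.
  by rewrite mulrC ler_pdivrMr ?mul1r; lra.
suff : 0 < s * normc w ^+ 2 by nra.
by rewrite mulr_gt0.
Qed.

End riesz.

(** * Adjoints and orthonormal bases *)

Section operators.
Context {R : realType} {H : hilbertSpace R}.
Implicit Types (A B : H -> H) (x y : H).

Lemma op0 A : linear A -> A 0 = 0.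
Proof.
move=> /(_ 1 0 0); rewrite !scale1r addr0 => /eqP.
by rewrite -subr_eq subrr => /eqP.
Qed.

Lemma opD A x y : linear A -> A (x + y) = A x + A y.
Proof. by move=> lA; rewrite -[x in LHS]scale1r lA scale1r. Qed.

Lemma opZ A a x : linear A -> A (a *: x) = a *: A x.
Proof. by move=> lA; rewrite -[a *: x in LHS]addr0 lA op0// addr0. Qed.

Lemma bounded_op_ge0 A : bounded_op A ->
  exists2 c : R, 0 <= c & forall x, hnorm (A x) <= c * hnorm x.
Proof.
move=> [_ [c hc]]; exists (Num.max c 0); first by rewrite le_max lexx orbT.
by move=> x; rewrite (le_trans (hc x))// ler_wpM2r ?hnorm_ge0// le_max lexx.
Qed.

Lemma bounded_comp A B : bounded_op A -> bounded_op B -> bounded_op (A \o B).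
Proof.
move=> bA bB; split; first by move=> a x y /=; rewrite bB.1 bA.1.
have [a a0 ha] := bounded_op_ge0 bA; have [b b0 hb] := bounded_op_ge0 bB.
exists (a * b) => x /=; rewrite (le_trans (ha _))// -mulrA ler_wpM2l//.
Qed.

Lemma bounded_id : bounded_op (@idfun H).
Proof. by split=> [//|]; exists 1 => x; rewrite mul1r. Qed.

Lemma adjoint_eq A y z : (forall x, hip (A x) y = hip x z) -> adjoint A y = z.
Proof.
move=> h; apply: hip_inj => x; rewrite -h.
by rewrite (@xgetPex _ 0 [set z | forall x, hip (A x) y = hip x z] _ x)//; exists z.
Qed.

Lemma adjointP A x y : bounded_op A -> hip (A x) y = hip x (adjoint A y).
Proof.
move=> bA; have [c c0 hc] := bounded_op_ge0 bA.
have [h _ hP] : exists2 h, hnorm h <= c * hnorm y &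
    forall x a, a = hip (A x) y -> a = hip x h.
  apply: riesz_graph => [||a u b v d -> ->|u _ ->].
  - by rewrite mulr_ge0 ?hnorm_ge0.
  - by rewrite op0 ?hip0l//; case: bA.
  - by rewrite bA.1 hipDl hipZl.
  - rewrite mulrAC (le_trans (hip_normc _ _))// ler_wpM2r ?hnorm_ge0//.
have -> : adjoint A y = h by apply: adjoint_eq => u; exact: hP.
exact: hP.
Qed.

Lemma adjoint_linear A : bounded_op A -> linear (adjoint A).
Proof.
move=> bA a x y; apply: adjoint_eq => z.
by rewrite !hipDr !hipZr !adjointP.
Qed.

Lemma adjoint_comp A B : bounded_op A -> bounded_op B ->
  adjoint (A \o B) = adjoint B \o adjoint A.
Proof.
by move=> bA bB; apply/funext => y; apply: adjoint_eq => x /=; rewrite !adjointP.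
Qed.

End operators.

Section orthonormal.
Context {R : realType} {H : hilbertSpace R}.
Implicit Types (x y : H) (u e : nat -> H).

Definition normalize x : H := ((hnorm x)^-1)%:C *: x.

Lemma normalize_unit x : normalize x = 0 \/ hip (normalize x) (normalize x) = 1.
Proof.
have [x0|x_neq0] := eqVneq (hnorm x) 0.
  by left; rewrite /normalize (hnorm_eq0 x0) scaler0.
right; rewrite hipxx hnormZ normc_real ger0_norm ?invr_ge0 ?hnorm_ge0//.
by rewrite mulVf// expr1n.
Qed.

Lemma normalizeK x : (hnorm x)%:C *: normalize x = x.
Proof.
rewrite /normalize scalerA -rmorphM /=.
have [x0|x_neq0] := eqVneq (hnorm x) 0; first by rewrite (hnorm_eq0 x0) scaler0.
by rewrite mulfV// scale1r.
Qed.

Lemma hip_normalizel x y : hip (normalize x) y = ((hnorm x)^-1)%:C * hip x y.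
Proof. exact: hipZl. Qed.

(** [gs_stage u n] lists the first [n] Gram-Schmidt vectors, padded by zeros;
    the recursion needs all earlier vectors, hence the function-valued stages. *)
Fixpoint gs_stage u (n : nat) : nat -> H :=
  if n is m.+1 then
    fun i => if i == m
      then normalize (u m - \sum_(j < m) hip (u m) (gs_stage u m j) *: gs_stage u m j)
      else gs_stage u m i
  else fun=> 0.

Definition gram_schmidt u n : H := gs_stage u n.+1 n.

Lemma gs_stageE u m i : (i < m)%N -> gs_stage u m i = gram_schmidt u i.
Proof.
elim: m => // m IH; rewrite ltnS leq_eqVlt /= => /orP[/eqP <-|im].
  by rewrite /gram_schmidt /= eqxx.
by rewrite ltn_eqF// IH.
Qed.

Lemma gram_schmidtE u n : gram_schmidt u n =
  normalize (u n - \sum_(j < n) hip (u n) (gram_schmidt u j) *: gram_schmidt u j).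
Proof.
rewrite {1}/gram_schmidt /= eqxx; congr (normalize (_ - _)).
by apply: eq_bigr => j _; rewrite gs_stageE.
Qed.

Lemma gram_schmidt_unit u n :
  gram_schmidt u n = 0 \/ hip (gram_schmidt u n) (gram_schmidt u n) = 1.
Proof. by rewrite gram_schmidtE; exact: normalize_unit. Qed.

(** Lets the projections on zero vectors and on unit vectors be treated alike. *)
Lemma hip_unit x y : y = 0 \/ hip y y = 1 -> hip x y * hip y y = hip x y.
Proof. by move=> [->|->]; rewrite ?mulr1// hip0r mul0r. Qed.

Lemma gram_schmidt_ortho u n i : (i < n)%N ->
  hip (gram_schmidt u n) (gram_schmidt u i) = 0.
Proof.
elim/ltn_ind: n i => n IH i i_lt_n.
rewrite [gram_schmidt u n]gram_schmidtE hip_normalizel.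
apply/eqP; rewrite mulf_eq0; apply/orP; right; apply/eqP.
rewrite hipBl hip_suml (bigD1 (Ordinal i_lt_n))//= hipZl hip_unit; last exact: gram_schmidt_unit.
rewrite big1 ?addr0 ?subrr// => j; rewrite -val_eqE /= => j_neq_i.
rewrite hipZl; case: (ltngtP j i) j_neq_i => // [ji|ij] _.
  by rewrite [hip (gram_schmidt u j) _]hipC IH// rmorph0 mulr0.
by rewrite IH// mulr0.
Qed.

Lemma separable_onb : separable_hilbert H -> exists e : nat -> H, onb e.
Proof.
move=> [u u_dense]; exists (gram_schmidt u); split.
- move=> i j; case: ltngtP => // [ij|ji] _; last exact: gram_schmidt_ortho.
  by rewrite hipC gram_schmidt_ortho// rmorph0.
- exact: gram_schmidt_unit.
move=> x x_ortho.
have xu n : hip x (u n) = 0.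
  rewrite -[u n](subrK (\sum_(j < n) hip (u n) (gram_schmidt u j) *: gram_schmidt u j)).
  rewrite hipDr hip_sumr -[X in hip x X + _]normalizeK.
  rewrite -gram_schmidtE hipZr x_ortho mulr0 add0r big1// => j _.
  by rewrite hipZr x_ortho mulr0.
apply/hnorm_eq0/eqP; rewrite eq_le hnorm_ge0 andbT leNgt; apply/negP => x0.
have [n] := u_dense x _ x0; apply/negP; rewrite -leNgt -(ler_pM2l x0).
have -> : hnorm x * hnorm x = complex.Re (hip x (x - u n)).
  by rewrite hipBr xu subr0 Re_hipxx expr2.
by rewrite (le_trans (ler_norm _))// (le_trans (Re_le_normc _))// hip_normc.
Qed.

Variables (e : nat -> H) (e_onb : onb e).

Lemma onb_unit n : e n = 0 \/ hip (e n) (e n) = 1.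
Proof. by case: e_onb. Qed.

Definition onb_proj x N : H := \sum_(0 <= i < N) hip x (e i) *: e i.

Definition onb_sq x N : R := \sum_(0 <= i < N) normc (hip x (e i)) ^+ 2.

Lemma hip_onb_proj x N j : hip (onb_proj x N) (e j) = if (j < N)%N then hip x (e j) else 0.
Proof.
rewrite /onb_proj hip_suml; case: ifPn => jN.
  rewrite (bigD1_seq j) ?mem_index_iota ?iota_uniq//= hipZl.
  rewrite hip_unit; last exact: onb_unit.
  rewrite big1 ?addr0// => i ij; rewrite hipZl.
  by case: e_onb => -> //; rewrite mulr0.
rewrite big_nat big1// => i /= iN; rewrite hipZl.
case: e_onb => -> //; first by rewrite mulr0.
by apply: contraNneq jN => <-.
Qed.

Lemma hip_onb_projr x y N :
  hip y (onb_proj x N) = \sum_(0 <= i < N) Num.conj (hip x (e i)) * hip y (e i).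
Proof.
by rewrite /onb_proj hip_sumr; apply: eq_bigr => i _; rewrite hipZr.
Qed.

Lemma hip_onb_proj_le x M N : (M <= N)%N ->
  hip (onb_proj x N) (onb_proj x M) = (onb_sq x M)%:C.
Proof.
move=> MN; rewrite hip_onb_projr /onb_sq rmorph_sum /=; apply: eq_big_nat => i /= iM.
by rewrite hip_onb_proj (leq_trans iM MN) mulrC sqr_normcE.
Qed.

Lemma hip_self_onb_proj x N : hip x (onb_proj x N) = (onb_sq x N)%:C.
Proof.
rewrite hip_onb_projr /onb_sq rmorph_sum /=; apply: eq_big_nat => i /= iM.
by rewrite mulrC sqr_normcE.
Qed.

Lemma sqr_hnorm_onb_proj x N : hnorm (onb_proj x N) ^+ 2 = onb_sq x N.
Proof. by rewrite -Re_hipxx hip_onb_proj_le. Qed.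

Lemma bessel x N : onb_sq x N <= hnorm x ^+ 2.
Proof.
have := sqr_ge0 (hnorm (x - onb_proj x N)).
rewrite sqr_hnormD hnormN hipNr hip_self_onb_proj sqr_hnorm_onb_proj /=.
lra.
Qed.

Lemma onb_sq_ndecr x : nondecreasing_seq (onb_sq x).
Proof.
apply/nondecreasing_seqP => n; rewrite /onb_sq big_nat_recr//= lerDl.
by rewrite exprn_ge0 ?normc_ge0.
Qed.

Lemma cvg_onb_sq x : cvgn (onb_sq x).
Proof.
apply: nondecreasing_is_cvgn; first exact: onb_sq_ndecr.
by exists (hnorm x ^+ 2) => _ [N _ <-]; exact: bessel.
Qed.

Lemma sqr_hnorm_onb_projB x M N : (M <= N)%N ->
  hnorm (onb_proj x N - onb_proj x M) ^+ 2 = onb_sq x N - onb_sq x M.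
Proof.
move=> MN; rewrite sqr_hnormD hnormN hipNr hip_onb_proj_le//.
by rewrite !sqr_hnorm_onb_proj /=; lra.
Qed.

(** The partial sums are Cauchy by Bessel's inequality; the difference between
    [x] and their limit is orthogonal to every [e n], hence zero. *)
Lemma onb_proj_cvg x : hcvg (onb_proj x) x.
Proof.
have [s sP] : exists s, hcvg (onb_proj x) s.
  apply: hcvg_complete => eps eps0.
  have /cvgrPdist_lt h := @cvg_onb_sq x.
  have [N _ hN] := h _ (exprn_gt0 2 eps0).
  have le_lim n : onb_sq x n <= limn (onb_sq x).
    by apply: nondecreasing_cvgn_le; [exact: onb_sq_ndecr|exact: cvg_onb_sq].
  have near_lim n : (N <= n)%N -> limn (onb_sq x) - onb_sq x n < eps ^+ 2.
    by move=> Nn; have := hN n Nn; rewrite /= ger0_norm// subr_ge0.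
  have close m n : (N <= m <= n)%N -> hnorm (onb_proj x n - onb_proj x m) < eps.
    move=> /andP[Nm mn]; rewrite -(@ltr_pXn2r _ 2)// ?nnegrE ?hnorm_ge0 ?(ltW eps0)//.
    rewrite sqr_hnorm_onb_projB//; have := near_lim _ Nm; have := le_lim n; lra.
  exists N => m n Nm Nn; have [mn|nm] := leqP m n.
    by rewrite hnormB close// Nm.
  by rewrite close// Nn ltnW.
suff sx : s = x by rewrite -{2}sx.
apply/eqP; rewrite -subr_eq0; apply/eqP.
case: e_onb => _ _; apply=> j; rewrite hipDl hipNl.
apply/normc0_eq0.
have /cvgrPdist_lt h := hcvg_hip (e j) sP.
apply/eqP; rewrite eq_le normc_ge0 andbT; apply/ler_addgt0Pr => eps eps0.
have [N _ hN] := h _ eps0.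
have := hN (maxn N j.+1) (leq_maxl _ _).
rewrite /= sub0r normrN ger0_norm ?normc_ge0// hip_onb_proj leq_maxr.
by rewrite -normcN opprB add0r => /ltW.
Qed.

End orthonormal.

(** * Traces *)

Section complex_limits.
Context {R : realType}.

Lemma cvgn_ReIm (u : nat -> R[i]) (l : R[i]) :
  (fun n => complex.Re (u n)) @ \oo --> complex.Re l ->
  (fun n => complex.Im (u n)) @ \oo --> complex.Im l ->
  u @ \oo --> l.
Proof.
move=> /cvgrPdist_lt hr /cvgrPdist_lt hi; apply/cvgrPdist_lt => e e0.
have e_real : e = (complex.Re e)%:C by rewrite RRe_real// ger0_real// ltW.
move: e0; rewrite e_real ltr0c => e0.
have e2 : 0 < complex.Re e / 2 by rewrite divr_gt0.
near=> n; rewrite normcE ltcR (le_lt_trans (normc_le_ReIm _))//.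
rewrite [ltRHS]splitr !raddfB ltrD//.
  by near: n; exact: hr.
by near: n; exact: hi.
Unshelve. all: by end_near. Qed.

Lemma cvgn_Re (u : nat -> R[i]) (l : R[i]) : u @ \oo --> l ->
  (fun n => complex.Re (u n)) @ \oo --> complex.Re l.
Proof.
move=> /cvgrPdist_lt h; apply/cvgrPdist_lt => e e0.
have e0' : (0 : R[i]) < e%:C by rewrite ltr0c.
near=> n; rewrite -raddfB (le_lt_trans (Re_le_normc _))// -ltcR -normcE.
by near: n; exact: h.
Unshelve. all: by end_near. Qed.

Lemma cvgn_normc (u : nat -> R[i]) (l : R[i]) :
  (fun n => normc (u n - l)) @ \oo --> (0 : R) -> u @ \oo --> l.
Proof.
move=> /cvgrPdist_lt h; apply/cvgrPdist_lt => e e0.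
have e_real : e = (complex.Re e)%:C by rewrite RRe_real// ger0_real// ltW.
move: e0; rewrite e_real ltr0c => e0.
near=> n; rewrite normcE ltcR -normcN opprB.
rewrite (le_lt_trans (ler_norm _))//.
have : `|0 - normc (u n - l)| < complex.Re e by near: n; exact: h.
by rewrite sub0r normrN.
Unshelve. all: by end_near. Qed.

Lemma cvgn_series_normc (u : nat -> R[i]) (b : nat -> R) :
  (forall n, normc (u n) <= b n) -> cvgn (series b) -> cvgn (series u).
Proof.
move=> ub cb.
have cv (v : nat -> R) : (forall n, `|v n| <= b n) -> cvgn (series v).
  move=> vb; apply: normed_cvg; apply: series_le_cvg cb => // n.
  - exact: normr_ge0.
  - exact: le_trans (normr_ge0 _) (vb n).
have hr := cv _ (fun n => le_trans (Re_le_normc _) (ub n)).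
have hi := cv _ (fun n => le_trans (Im_le_normc _) (ub n)).
apply/cvg_ex; exists (limn (series (fun n => complex.Re (u n))) +i* limn (series (fun n => complex.Im (u n)))).
apply: cvgn_ReIm => /=.
- rewrite (_ : (fun n => _) = series (fun n => complex.Re (u n)))//.
  by apply/funext => n; rewrite /series /= raddf_sum.
- rewrite (_ : (fun n => _) = series (fun n => complex.Im (u n)))//.
  by apply/funext => n; rewrite /series /= raddf_sum.
Qed.

End complex_limits.

Section trace_class_theory.
Context {R : realType} {H : hilbertSpace R}.
Implicit Types (A B C K : H -> H) (e f : nat -> H).

Lemma parseval e x : onb e ->
  (\sum_(0 <= n <oo) (normc (hip x (e n)) ^+ 2)%:E = (hnorm x ^+ 2)%:E)%E.
Proof.
move=> e_onb; apply/cvg_lim => //.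
rewrite (_ : (fun n => _) = EFin \o onb_sq e x); last first.
  by apply/funext => n /=; rewrite sumEFin.
apply: cvg_EFin; first by apply: nearW.
rewrite (_ : _ \o _ = onb_sq e x)//.
apply: (@squeeze_cvgr _ _ _ _ (fun n => hnorm x ^+ 2 - hnorm (onb_proj e x n - x) ^+ 2)
          (cst (hnorm x ^+ 2))).
- near=> n; rewrite bessel// andbT lerBlDr -lerBlDl.
  rewrite hnormB sqr_hnormD hnormN hipNr hip_self_onb_proj sqr_hnorm_onb_proj//=.
  by lra.
- rewrite -[X in _ --> X]subr0; apply: cvgB; first exact: cvg_cst.
  rewrite -[X in _ --> X](mulr0 0) -[X in X @ _]/(fun n => _).
  under eq_fun do rewrite expr2.
  by apply: cvgM; apply: hcvg_norm; exact: onb_proj_cvg.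
- exact: cvg_cst.
Unshelve. all: by end_near. Qed.

Definition hs_sq A e : \bar R := (\sum_(0 <= n <oo) (hnorm (A (e n)) ^+ 2)%:E)%E.

(** By Parseval both sides are the sum of [|<A e_n, f_m>|^2] over [n] and [m].
    The identity for [A] and for its adjoint gives the independence of the basis. *)
Lemma hs_sq_adjoint A e f : bounded_op A -> onb e -> onb f ->
  hs_sq A e = hs_sq (adjoint A) f.
Proof.
move=> bA e_onb f_onb; rewrite /hs_sq.
under eq_eseriesr do rewrite -(parseval _ f_onb).
under [RHS]eq_eseriesr do rewrite -(parseval _ e_onb).
rewrite nneseries_interchange; last by move=> i j; rewrite lee_fin exprn_ge0 ?normc_ge0.
apply: eq_eseriesr => j _; apply: eq_eseriesr => i _.
by rewrite adjointP// hipC normcJ.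
Qed.

Lemma hs_sq_indep A e f : bounded_op A -> onb e -> onb f -> hs_sq A e = hs_sq A f.
Proof. by move=> bA oe of_; rewrite (hs_sq_adjoint bA oe oe) -(hs_sq_adjoint bA of_ oe). Qed.

Lemma hs_sq_fin A e : (hs_sq A e < +oo)%E <-> cvgn (series (fun n => hnorm (A (e n)) ^+ 2)).
Proof.
have u_ge0 n : 0 <= hnorm (A (e n)) ^+ 2 by rewrite exprn_ge0 ?hnorm_ge0.
split=> [hfin|hcv].
  apply: nondecreasing_is_cvgn.
    by apply/nondecreasing_seqP => n; rewrite /series /= big_nat_recr//= lerDl.
  exists (fine (hs_sq A e)) => _ [n _ <-].
  have tot_ge0 : (0 <= hs_sq A e)%E by apply: nneseries_ge0 => k _ _; rewrite lee_fin.
  rewrite -lee_fin fineK; last by rewrite ge0_fin_numE.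
  rewrite /series /= -sumEFin; apply: nneseries_lim_ge => k _ _.
  by rewrite lee_fin.
rewrite /hs_sq (_ : (fun n => _) = EFin \o series (fun n => hnorm (A (e n)) ^+ 2)).
  by rewrite EFin_lim// ltry.
by apply/funext => n /=; rewrite sumEFin.
Qed.

Lemma hilbert_schmidtP A e : onb e -> hilbert_schmidt A ->
  cvgn (series (fun n => hnorm (A (e n)) ^+ 2)).
Proof.
move=> oe [bA [f of_ /hs_sq_fin hf]]; apply/hs_sq_fin.
by rewrite (hs_sq_indep bA oe of_).
Qed.

Lemma hs_adjoint A e : onb e -> hilbert_schmidt A ->
  cvgn (series (fun n => hnorm (adjoint A (e n)) ^+ 2)).
Proof.
move=> oe [bA [f of_ /hs_sq_fin hf]]; apply/hs_sq_fin.
by rewrite -(hs_sq_adjoint bA of_ oe).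
Qed.

Lemma hs_compl A C : bounded_op C -> hilbert_schmidt A -> hilbert_schmidt (C \o A).
Proof.
move=> bC [bA [f of_ hf]]; split; first exact: bounded_comp.
exists f => //; have [c c0 hc] := bounded_op_ge0 bC.
have : cvgn (series (fun n => c ^+ 2 * hnorm (A (f n)) ^+ 2)).
  rewrite (_ : (fun n => _) = (c ^+ 2) *: (fun n => hnorm (A (f n)) ^+ 2))//.
  exact: is_cvg_seriesZ.
apply: series_le_cvg => n.
- by rewrite exprn_ge0 ?hnorm_ge0.
- by apply: mulr_ge0; rewrite exprn_ge0 ?hnorm_ge0.
- by rewrite -exprMn ler_pXn2r ?nnegrE ?mulr_ge0 ?hnorm_ge0//= hc.
Qed.

(** With [K = A \o B] the terms are [<B e_n, (C A)^* e_n>], a product of two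
    square-summable sequences. *)
Lemma trace_cvg C K e : bounded_op C -> trace_class H K -> onb e ->
  cvgn (series (fun n => hip (C (K (e n))) (e n))).
Proof.
move=> bC [A [B [hA hB ->]]] oe.
have hCA := hs_compl bC hA; have bCA := hCA.1.
apply: (@cvgn_series_normc _ _
  (fun n => hnorm (B (e n)) ^+ 2 + hnorm (adjoint (C \o A) (e n)) ^+ 2)).
  move=> n; rewrite -[C _]/((C \o A) (B (e n))) adjointP// (le_trans (hip_normc _ _))//.
  have := sqr_ge0 (hnorm (B (e n)) - hnorm (adjoint (C \o A) (e n))).
  have := hnorm_ge0 (B (e n)); have := hnorm_ge0 (adjoint (C \o A) (e n)).
  by nra.
apply: is_cvg_seriesD; first exact: hilbert_schmidtP.
exact: hs_adjoint.
Qed.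

Lemma trace_linear C1 C2 K e (a : R[i]) : bounded_op C1 -> bounded_op C2 ->
  trace_class H K -> onb e ->
  trace e ((fun x => a *: C1 x + C2 x) \o K) =
  a * trace e (C1 \o K) + trace e (C2 \o K).
Proof.
move=> b1 b2 hK oe; rewrite /trace.
have h1 := trace_cvg b1 hK oe; have h2 := trace_cvg b2 hK oe.
apply/cvg_lim; first exact: norm_hausdorff.
rewrite (_ : series _ = (fun n => a * series (fun n => hip (C1 (K (e n))) (e n)) n +
  series (fun n => hip (C2 (K (e n))) (e n)) n)); last first.
  apply/funext => n; rewrite /series /= big_distrr -big_split /=.
  by apply: eq_bigr => i _; rewrite hipDl hipZl.
apply: cvgD; last exact: h2.
by apply: cvgM; [exact: cvg_cst|exact: h1].
Qed.

Definition rank_one (u v : H) : H -> H := fun x => hip x v *: u.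

Lemma bounded_rank_one u v : bounded_op (rank_one u v).
Proof.
split=> [a x y|]; first by rewrite /rank_one hipDl hipZl scalerDl scalerA.
exists (hnorm v * hnorm u) => x.
by rewrite hnormZ mulrAC ler_wpM2r ?hnorm_ge0// mulrC hip_normc.
Qed.

Lemma hs_rank_one e u v : onb e -> hilbert_schmidt (rank_one u v).
Proof.
move=> oe; split; first exact: bounded_rank_one.
exists e => //.
rewrite (_ : (fun n => _) = (hnorm u ^+ 2) *: (fun n => normc (hip v (e n)) ^+ 2)).
  by apply: is_cvg_seriesZ; exact: cvg_onb_sq.
by apply/funext => n; rewrite /rank_one hnormZ exprMn mulrC hipC normcJ.
Qed.

(** The trace class operator whose trace against [C] evaluates a matrix
    coefficient of [C]. *)
Lemma trace_rank_one C e u v : bounded_op C -> onb e ->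
  trace_class H (rank_one u v \o rank_one v v) /\
  trace e (C \o (rank_one u v \o rank_one v v)) = (hnorm v ^+ 2)%:C * hip (C u) v.
Proof.
move=> bC oe; split; first by exists (rank_one u v), (rank_one v v); split=> //; exact: hs_rank_one oe.
apply/cvg_lim; first exact: norm_hausdorff.
apply: cvgn_normc.
have cv : (fun n => (hnorm v ^+ 2 * hnorm (C u)) * hnorm (onb_proj e v n - v)) @ \oo --> (0 : R).
  rewrite -[X in _ --> X](mulr0 (hnorm v ^+ 2 * hnorm (C u))).
  by apply: cvgM; [exact: cvg_cst|apply: hcvg_norm; exact: onb_proj_cvg].
apply: (@squeeze_cvgr _ _ _ _ (cst 0) _ _ _ _ _ cv); last exact: cvg_cst.
near=> n; rewrite normc_ge0 /=.
have -> : series (fun n => hip (C (rank_one u v (rank_one v v (e n)))) (e n)) n =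
    (hnorm v ^+ 2)%:C * hip (C u) (onb_proj e v n).
  rewrite hip_onb_projr big_distrr /series /=; apply: eq_bigr => i _.
  rewrite /rank_one (hipZl _ v v) hipxx (opZ _ _ bC.1) hipZl -hipC; ring.
rewrite -mulrBr -hipBr normcM normc_real ger0_norm ?exprn_ge0 ?hnorm_ge0//.
by rewrite -mulrA ler_wpM2l ?exprn_ge0 ?hnorm_ge0// hip_normc.
Unshelve. all: by end_near. Qed.

End trace_class_theory.

(** * Multipliers *)

Section operator_norm.
Context {R : realType} {H : hilbertSpace R}.
Implicit Types A B : H -> H.

Lemma bounded_lin a A B : bounded_op A -> bounded_op B ->
  bounded_op (fun x => a *: A x + B x).
Proof.
move=> bA bB; split.
  by move=> b x y /=; rewrite bA.1 bB.1 !scalerDr !scalerA mulrC addrACA.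
have [c c0 hc] := bounded_op_ge0 bA; have [e e0 he] := bounded_op_ge0 bB.
exists (normc a * c + e) => x; rewrite (le_trans (ler_hnormD _ _))// mulrDl lerD//.
by rewrite hnormZ -mulrA ler_wpM2l ?normc_ge0.
Qed.

Lemma opnorm_le A (c : R) : 0 <= c -> (forall x, hnorm (A x) <= c * hnorm x) ->
  opnorm A <= c.
Proof. by move=> c0 hc; apply: ge_inf => //; exists 0 => b []. Qed.

Lemma opnorm_ge0 A : 0 <= opnorm A.
Proof.
rewrite /opnorm; set E := [set c : R | _]; have [->|/set0P ne] := eqVneq E set0.
  by rewrite inf0.
by apply: lb_le_inf => // c [].
Qed.

Lemma le_opnorm A x : bounded_op A -> hnorm (A x) <= opnorm A * hnorm x.
Proof.
move=> /bounded_op_ge0[c c0 hc].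
have [x0|x_neq0] := eqVneq (hnorm x) 0.
  by rewrite x0 mulr0 (le_trans (hc x))// x0 mulr0.
have x_gt0 : 0 < hnorm x by rewrite lt_neqAle eq_sym x_neq0 hnorm_ge0.
rewrite -ler_pdivrMr//; apply: lb_le_inf; first by exists c.
by move=> b [b0 hb]; rewrite ler_pdivrMr.
Qed.

End operator_norm.

Section multiplier_algebra.
Context {R : realType} {d : nat} (H2 : druryArveson R d).
Implicit Types (f g : oball R d -> R[i]) (w z : oball R d).

Lemma MopE f (A : H2 -> H2) :
  (forall h z, rk_ev (A h) z = f z * rk_ev h z) -> Mop H2 f = A.
Proof.
move=> hA; apply/funext => h; apply: rk_ev_inj; apply/funext => z.
rewrite hA; apply: (@xgetPex _ 0 [set k | forall z, rk_ev k z = f z * rk_ev h z]).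
by exists (A h).
Qed.

Lemma Mop_bounded f : Md H2 f -> bounded_op (Mop H2 f).
Proof. by move=> [A bA hA]; rewrite (MopE hA). Qed.

Lemma MopP f h z : Md H2 f -> rk_ev (Mop H2 f h) z = f z * rk_ev h z.
Proof. by move=> [A bA hA]; rewrite (MopE hA). Qed.

Lemma MdP f (A : H2 -> H2) : bounded_op A ->
  (forall h z, rk_ev (A h) z = f z * rk_ev h z) -> Md H2 f.
Proof. by exists A. Qed.

Lemma Mop_linE a f g h z : Md H2 f -> Md H2 g ->
  rk_ev (a *: Mop H2 f h + Mop H2 g h) z = (a * f z + g z) * rk_ev h z.
Proof. by move=> mf mg; rewrite rk_ev_linear !MopP// mulrA mulrDl. Qed.

Lemma Md_lin a f g : Md H2 f -> Md H2 g -> Md H2 (fun z => a * f z + g z).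
Proof.
move=> mf mg; apply: (MdP (bounded_lin a (Mop_bounded mf) (Mop_bounded mg))).
by move=> h z; apply: Mop_linE.
Qed.

Lemma Mop_lin a f g : Md H2 f -> Md H2 g ->
  Mop H2 (fun z => a * f z + g z) = (fun h => a *: Mop H2 f h + Mop H2 g h).
Proof. by move=> mf mg; apply: MopE => h z; apply: Mop_linE. Qed.

Lemma Md_mul f g : Md H2 f -> Md H2 g -> Md H2 (f \* g).
Proof.
move=> mf mg; apply: (MdP (bounded_comp (Mop_bounded mf) (Mop_bounded mg))).
by move=> h z /=; rewrite !MopP// mulrA.
Qed.

Lemma Md_cst c : Md H2 (cst c).
Proof.
apply: (@MdP _ (fun h => c *: h)); last first.
  move=> h z; rewrite -[c *: h]addr0 rk_ev_linear.
  by rewrite [rk_ev 0 z]rk_reproducing hip0l addr0.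
split=> [a x y|]; first by rewrite scalerDr !scalerA mulrC.
by exists (normc c) => x; rewrite hnormZ.
Qed.

Lemma Md_sub f g : Md H2 f -> Md H2 g -> Md H2 (f \- g).
Proof.
move=> mf mg; have := Md_lin (-1) mg mf; congr (Md H2 _).
by apply/funext => z /=; rewrite mulN1r addrC.
Qed.

Lemma le_mnorm f h : Md H2 f -> hnorm (Mop H2 f h) <= mnorm H2 f * hnorm h.
Proof. by move=> mf; apply: le_opnorm; exact: Mop_bounded. Qed.

Lemma hip_kernel w z : hip (rk_kernel H2 w) (rk_kernel H2 z) =
  1 / (1 - cdot (sval z) (sval w)).
Proof. by rewrite -rk_reproducing rk_kernelE. Qed.

Lemma cdot_psd : psd_form (@cdot R d).
Proof.
split=> [a x y z|x y|x].
- rewrite /cdot big_distrr -big_split /=; apply: eq_bigr => i _.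
  by rewrite !mxE mulrDl mulrA.
- rewrite /cdot rmorph_sum; apply: eq_bigr => i _.
  by rewrite rmorphM /= conjCK mulrC.
- by apply: sumr_ge0 => i _; rewrite mul_conjC_ge0.
Qed.

(** By Cauchy-Schwarz, so that the kernel has no pole inside the ball. *)
Lemma cdot_neq1 w z : cdot (sval z) (sval w) != 1.
Proof.
have lt1 (x : oball R d) : complex.Re (cdot (sval x) (sval x)) < 1.
  by rewrite -ltcR -(form_re cdot_psd); case: x.
apply/eqP => c1; have := form_CauchySchwarz cdot_psd (sval z) (sval w).
rewrite c1 normc_real normr1 expr1n.
have := lt1 z; have := lt1 w.
have := Re_form_ge0 cdot_psd (sval z); have := Re_form_ge0 cdot_psd (sval w).
by nra.
Qed.

Lemma kernel_gt0 w : 0 < hnorm (rk_kernel H2 w).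
Proof.
rewrite lt_neqAle hnorm_ge0 andbT eq_sym; apply/eqP => /hnorm_eq0 k0.
have := hip_kernel w w; rewrite k0 hip0l => /esym/eqP.
rewrite mulf_eq0 oner_eq0 invr_eq0 subr_eq0 eq_sym.
by rewrite (negbTE (cdot_neq1 w w)).
Qed.

(** A multiplier is bounded by its norm: the reproducing kernels are
    eigenvectors of the adjoint of the multiplication operator. *)
Lemma sup_le_mnorm f w : Md H2 f -> normc (f w) <= mnorm H2 f.
Proof.
move=> mf; set k := rk_kernel H2 w; have k0 : 0 < hnorm k := kernel_gt0 w.
have := hip_normc (Mop H2 f k) k.
rewrite -rk_reproducing MopP// rk_reproducing normcM hipxx normc_real.
rewrite ger0_norm ?exprn_ge0 ?hnorm_ge0// expr2 mulrA ler_pM2r// => h.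
by rewrite -(ler_pM2r k0) (le_trans h)// le_mnorm.
Qed.

(** The kernel [k] satisfies [k = 1 + <z, w> k]; summed against coefficients,
    this compares the norm of a combination of kernels with those of its images
    under the adjoints of the coordinates. *)
Lemma kernel_decomp w z :
  hip (rk_kernel H2 w) (rk_kernel H2 z) = 1 + \sum_(m < d)
    (sval z 0 m * Num.conj (sval w 0 m)) * hip (rk_kernel H2 w) (rk_kernel H2 z).
Proof.
rewrite -big_distrl /= -/(cdot (sval z) (sval w)) hip_kernel.
by field; rewrite subr_eq0 eq_sym cdot_neq1.
Qed.

Let comb (s : seq (R[i] * oball R d)) : H2 :=
  \sum_(t <- s) t.1 *: rk_kernel H2 t.2.

Let comb_coord (m : 'I_d) (s : seq (R[i] * oball R d)) : H2 :=
  \sum_(t <- s) (t.1 * Num.conj (sval t.2 0 m)) *: rk_kernel H2 t.2.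

Lemma kernel_comb_norm s : hip (comb s) (comb s) =
  (\sum_(t <- s) t.1) * Num.conj (\sum_(t <- s) t.1) +
  \sum_(m < d) hip (comb_coord m s) (comb_coord m s).
Proof.
have -> : hip (comb s) (comb s) = \sum_(t <- s) \sum_(u <- s)
    t.1 * Num.conj u.1 * hip (rk_kernel H2 t.2) (rk_kernel H2 u.2).
  rewrite hip_suml; apply: eq_bigr => t _; rewrite hip_sumr.
  by apply: eq_bigr => u _; rewrite hipZl hipZr mulrA.
under eq_bigr => t _ do under eq_bigr => u _ do rewrite kernel_decomp mulrDr mulr1.
under eq_bigr => t _ do rewrite big_split /=.
rewrite big_split /=; congr (_ + _).
  rewrite big_distrl /=; apply: eq_bigr => t _.
  by rewrite rmorph_sum big_distrr.
under eq_bigr => t _ do under eq_bigr => u _ do rewrite big_distrr /=.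
under eq_bigr => t _ do rewrite exchange_big /=.
rewrite exchange_big /=; apply: eq_bigr => m _.
rewrite hip_suml; apply: eq_bigr => t _; rewrite hip_sumr; apply: eq_bigr => u _.
by rewrite hipZl hipZr rmorphM /= conjCK; ring.
Qed.

Lemma comb_coord_le m s : hnorm (comb_coord m s) <= hnorm (comb s).
Proof.
rewrite -(@ler_pXn2r _ 2)// ?nnegrE ?hnorm_ge0// -lecR -!hipxx kernel_comb_norm.
rewrite (bigD1 m)//= addrCA lerDl addr_ge0 ?mul_conjC_ge0//.
by apply: sumr_ge0 => i _; rewrite hipxx lecR exprn_ge0 ?hnorm_ge0.
Qed.

(** The coordinates are multipliers since [(1 - z_i w_i^* ) k(z, w)] is again
    a positive kernel, [1] plus the sum of [z_m w_m^* k(z, w)] over [m != i].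
    This makes the would-be adjoint [k_w |-> w_i^* k_w] a contraction on the
    span of the kernels, whence [z_i h] lies in the space by the Riesz
    representation of [k_w |-> (w_i h(w))^*] there. *)
Lemma coordfun_Md i : Md H2 (coordfun i).
Proof.
have /choice[A hA] : forall h : H2, exists k : H2, hnorm k <= hnorm h /\
    forall w, rk_ev k w = sval w 0 i * rk_ev h w.
  move=> h.
  have hF s : hip (comb_coord i s) h =
      \sum_(t <- s) t.1 * Num.conj (sval t.2 0 i * rk_ev h t.2).
    rewrite hip_suml; apply: eq_bigr => t _.
    by rewrite hipZl rmorphM /= rk_reproducing -hipC mulrA.
  (* The graph of the functional on the span of the kernels that sends [comb s] to
     the pairing of its would-be image with [h]. *)
  have [||||k kn kP] := @riesz_graph _ _
    (fun x c => exists s, x = comb s /\ c = hip (comb_coord i s) h) (hnorm h).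
  - exact: hnorm_ge0.
  - by exists [::]; rewrite /comb /comb_coord !big_nil hip0l.
  - move=> a _ _ _ _ [s [-> ->]] [s' [-> ->]].
    exists ([seq (a * t.1, t.2) | t <- s] ++ s').
    rewrite /comb !hF !big_cat !big_map /= scaler_sumr big_distrr /=; split.
      by congr (_ + _); apply: eq_bigr => t _; rewrite scalerA.
    by congr (_ + _); apply: eq_bigr => t _; rewrite mulrA.
  - move=> _ _ [s [-> ->]]; rewrite (le_trans (hip_normc _ _))// mulrC.
    by rewrite ler_wpM2l ?hnorm_ge0// comb_coord_le.
  exists k; split=> // w; rewrite rk_reproducing hipC.
  rewrite -(kP _ (hip (comb_coord i [:: (1, w)]) h)); last first.
    by exists [:: (1, w)]; rewrite /comb big_seq1 scale1r.
  by rewrite hF big_seq1 mul1r conjCK.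
apply: (@MdP _ A) => [|h z]; last by case: (hA h).
split=> [a x y|]; last by exists 1 => x; rewrite mul1r; case: (hA x).
apply: rk_ev_inj; apply/funext => w; rewrite rk_ev_linear.
have [_ ->] := hA (a *: x + y); have [_ ->] := hA x; have [_ ->] := hA y.
by rewrite rk_ev_linear; ring.
Qed.

End multiplier_algebra.

(** * Polynomials and weak-* continuous functionals *)

Section polynomials.
Import -(notations) mpoly.
Context {R : realType} {d : nat}.

(** A polynomial in [d] variables is stored as a list of monomials, each with a
    coefficient and a word in the indices of the variables. *)
Definition wmon (w : seq 'I_d) (v : 'I_d -> R[i]) : R[i] := \prod_(i <- w) v i.

Definition wpoly (l : seq (R[i] * seq 'I_d)) (v : 'I_d -> R[i]) : R[i] :=
  \sum_(t <- l) t.1 * wmon t.2 v.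

Lemma wpoly_cons t l v : wpoly (t :: l) v = t.1 * wmon t.2 v + wpoly l v.
Proof. by rewrite /wpoly big_cons. Qed.

Definition wpoly_fun l : oball R d -> R[i] := fun z => wpoly l (sval z 0).

Lemma polyfunP (p : oball R d -> R[i]) : polyfun p <-> exists l, p = wpoly_fun l.
Proof.
split=> [[P ->]|[l ->]].
  exists [seq (mcoeff m P, flatten [seq nseq (m i) i | i <- enum 'I_d]) | m <- msupp P].
  apply/funext => z; rewrite mevalE /wpoly_fun /wpoly [RHS]big_map /=.
  apply: eq_bigr => m _; congr (_ * _); rewrite /wmon big_flatten big_map /=.
  rewrite [RHS]big_enum /=; apply: eq_bigr => i _.
  by rewrite big_nseq iter_mulr_1.
exists (\sum_(t <- l) t.1 *: \prod_(i <- t.2) mpolyX R[i] (mnm1 i)).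
apply/funext => z; rewrite /wpoly_fun /wpoly raddf_sum /=; apply: eq_bigr => t _.
rewrite mevalZ; congr (_ * _); rewrite /wmon rmorph_prod /=.
by apply: eq_bigr => i _; rewrite mevalXU.
Qed.

Definition wlin (a : R[i]) (l l' : seq (R[i] * seq 'I_d)) :=
  [seq (a * t.1, t.2) | t <- l] ++ l'.

Lemma wlinE a l l' v : wpoly (wlin a l l') v = a * wpoly l v + wpoly l' v.
Proof.
rewrite /wpoly big_cat big_map /= big_distrr /=; congr (_ + _).
by apply: eq_bigr => t _; rewrite mulrA.
Qed.

End polynomials.

Section ball_algebra.
Context {R : realType} {d : nat} (H2 : druryArveson R d).
Implicit Types (f g p : oball R d -> R[i]).

Lemma wmon_Md w : Md H2 (fun z => wmon w (sval z 0)).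
Proof.
elim: w => [|i w IH].
  rewrite (_ : (fun z => _) = cst 1); first exact: Md_cst.
  by apply/funext => z; rewrite /wmon big_nil.
rewrite (_ : (fun z => _) = coordfun i \* (fun z => wmon w (sval z 0))).
  by apply: Md_mul => //; exact: coordfun_Md.
by apply/funext => z; rewrite /wmon big_cons.
Qed.

Lemma wpoly_Md l : Md H2 (wpoly_fun l).
Proof.
elim: l => [|t l IH].
  rewrite (_ : wpoly_fun _ = cst 0); first exact: Md_cst.
  by apply/funext => z; rewrite /wpoly_fun /wpoly big_nil.
rewrite (_ : wpoly_fun _ = (fun z => t.1 * wmon t.2 (sval z 0) + wpoly_fun l z)).
  exact: Md_lin (wmon_Md _) IH.
by apply/funext => z; rewrite /wpoly_fun wpoly_cons.
Qed.

Lemma mnorm_lin a f g : Md H2 f -> Md H2 g ->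
  mnorm H2 (fun z => a * f z + g z) <= normc a * mnorm H2 f + mnorm H2 g.
Proof.
move=> mf mg; apply: opnorm_le => [|h].
  by rewrite addr_ge0 ?mulr_ge0 ?normc_ge0 ?opnorm_ge0.
rewrite Mop_lin// (le_trans (ler_hnormD _ _))// mulrDl lerD ?le_mnorm//.
by rewrite hnormZ -mulrA ler_wpM2l ?normc_ge0 ?le_mnorm.
Qed.

Lemma Ad_Md f : Ad H2 f -> Md H2 f.
Proof. by case. Qed.

Lemma Ad_approx f (e : R) : Ad H2 f -> 0 < e ->
  exists l, mnorm H2 (f \- wpoly_fun l) < e.
Proof. by move=> [_ h] /h[p /polyfunP[l ->]]; exists l. Qed.

Lemma wpoly_Ad l : Ad H2 (wpoly_fun l).
Proof.
split=> [|e e0]; first exact: wpoly_Md.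
exists (wpoly_fun l); first by apply/polyfunP; exists l.
apply: le_lt_trans e0; apply: opnorm_le => // h.
rewrite (@MopE _ _ _ _ (fun=> 0)) ?hnorm0 ?mul0r// => k z /=.
by rewrite subrr mul0r rk_reproducing hip0l.
Qed.

Lemma Ad_lin a f g : Ad H2 f -> Ad H2 g -> Ad H2 (fun z => a * f z + g z).
Proof.
move=> af ag; split=> [|e e0]; first exact: Md_lin (Ad_Md af) (Ad_Md ag).
have ha : 0 < normc a + 1 by rewrite ltr_wpDl ?normc_ge0.
have [l hl] := Ad_approx af (divr_gt0 (divr_gt0 e0 (ltr0n _ 2)) ha).
have [l' hl'] := Ad_approx ag (divr_gt0 e0 (ltr0n R 2)).
exists (wpoly_fun (wlin a l l')); first by apply/polyfunP; exists (wlin a l l').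
have mfl := Md_sub (Ad_Md af) (wpoly_Md l).
have mgl := Md_sub (Ad_Md ag) (wpoly_Md l').
have -> : (fun z => a * f z + g z) \- wpoly_fun (wlin a l l') =
    (fun z => a * (f \- wpoly_fun l) z + (g \- wpoly_fun l') z).
  by apply/funext => z /=; rewrite /wpoly_fun wlinE; ring.
apply: le_lt_trans (mnorm_lin a mfl mgl) _.
have : (normc a + 1) * mnorm H2 (f \- wpoly_fun l) < e / 2.
  by rewrite mulrC -ltr_pdivlMr.
have := opnorm_ge0 (Mop H2 (f \- wpoly_fun l)); rewrite -/(mnorm _ _).
by move: hl'; lra.
Qed.

Lemma Ad_sub f g : Ad H2 f -> Ad H2 g -> Ad H2 (f \- g).
Proof.
move=> fA gA; have := Ad_lin (-1) gA fA; congr (Ad H2 _).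
by apply/funext => z /=; rewrite mulN1r addrC.
Qed.

Lemma Ad_cst c : Ad H2 (cst c).
Proof.
rewrite (_ : cst c = wpoly_fun [:: (c, [::])]); first exact: wpoly_Ad.
by apply/funext => z; rewrite /wpoly_fun /wpoly big_seq1 /wmon big_nil mulr1.
Qed.

Lemma coordfunE (i : 'I_d) : @coordfun R d i = wpoly_fun [:: (1, [:: i])].
Proof.
by apply/funext => z; rewrite /wpoly_fun /wpoly big_seq1 /wmon big_seq1 mul1r.
Qed.

End ball_algebra.

(** Induction on the list: if some [g] has [phi i g <> 0], subtracting a multiple
    of [g] brings any [f] into the kernel of [phi i]. *)
Lemma kernel_combination (R : realType) (X I : Type) (phi : I -> (X -> R[i]) -> R[i])
    (psi : (X -> R[i]) -> R[i]) (s : seq I) (S : set (X -> R[i])) :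
  (forall a f g, S f -> S g -> S (fun z => a * f z + g z)) ->
  (forall i a f g, S f -> S g ->
     phi i (fun z => a * f z + g z) = a * phi i f + phi i g) ->
  (forall a f g, S f -> S g -> psi (fun z => a * f z + g z) = a * psi f + psi g) ->
  (forall f, S f -> all (fun i => phi i f == 0) s -> psi f = 0) ->
  exists c : seq (R[i] * I), forall f, S f -> psi f = \sum_(t <- c) t.1 * phi t.2 f.
Proof.
elim: s S => [|i s IH] S Slin philin psilin ker0.
  by exists [::] => f Sf; rewrite big_nil ker0.
have [||||c hc] := IH (S `&` [set f | phi i f = 0]).
- move=> a f g [Sf f0] [Sg g0]; split; first exact: Slin.
  by rewrite /= philin// f0 g0 mulr0 addr0.
- by move=> j a f g [Sf _] [Sg _]; apply: philin.
- by move=> a f g [Sf _] [Sg _]; apply: psilin.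
- by move=> f [Sf f0] hf; apply: ker0 => //=; rewrite f0 eqxx.
have [[w [Sw w0]]|no] := pselect (exists w, S w /\ phi i w != 0); last first.
  exists c => f Sf; apply: hc; split=> //=.
  by apply: contrapT => /eqP f0; apply: no; exists f.
exists (((psi w - \sum_(t <- c) t.1 * phi t.2 w) / phi i w, i) :: c) => f Sf.
have Sg : (S `&` [set f | phi i f = 0]) (fun z => - (phi i f / phi i w) * w z + f z).
  split; first exact: Slin.
  by rewrite /= philin// mulNr mulfVK// addNr.
have := hc _ Sg; rewrite psilin// big_cons /=.
under eq_bigr do rewrite philin// mulrDr mulrCA.
rewrite big_split /= -big_distrr /= => /eqP; rewrite -subr_eq0 => /eqP h.
apply/eqP; rewrite -subr_eq0; apply/eqP; rewrite -[RHS]h; field.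
exact: w0.
Qed.

Lemma cvg_initial (S : choiceType) (T : topologicalType) (f : S -> T)
    (F : set_system S) (s : S) :
  Filter F -> f @ F --> f s -> F --> (s : initial_topology f).
Proof.
move=> FF cf U [_ [[B oB <-] Bs] BU]; apply: filterS BU _.
by apply: cf; exact: open_nbhs_nbhs.
Qed.

Lemma wstar_eval_continuous (R : realType) (H : hilbertSpace R) (K : wstar_index H) :
  continuous ((fun A => wstar_eval A K) : wstar H -> R[i]).
Proof.
pose P := prod_topology (fun _ : wstar_index H => R[i]).
have h2 : continuous (@wstar_eval R H : wstar H -> P) by exact: initial_continuous.
have h3 : continuous ((fun a : P => a K) : P -> R[i]).
  move=> a; have /cvg_sup/(_ K) cv : nbhs (a : P) --> (a : P) by apply: cvg_id.
  by move=> U hU; apply: cv; exact: (@initial_continuous _ _ (fun b : P => b K)).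
move=> A U hU; exact: (h2 A _ (h3 (wstar_eval A) U hU)).
Qed.

Section weak_star_functionals.
Context {R : realType} {d : nat} (H2 : druryArveson R d).
Implicit Types (f g : oball R d -> R[i]).

Definition tr (K : wstar_index H2) f : R[i] :=
  trace (sval K).2 (Mop H2 f \o (sval K).1).

Lemma tr_lin K a f g : Md H2 f -> Md H2 g ->
  tr K (fun z => a * f z + g z) = a * tr K f + tr K g.
Proof.
move=> mf mg; rewrite /tr Mop_lin//; case: K => -[K e] [hK he] /=.
by apply: trace_linear => //; exact: Mop_bounded.
Qed.

Lemma tr_cst0 K : tr K (cst 0) = 0.
Proof.
have := tr_lin K (-1) (Md_cst H2 0) (Md_cst H2 0).
rewrite mulN1r addNr; congr (tr _ _ = _); apply/funext => z /=.
by rewrite mulN1r addNr.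
Qed.

Lemma tr_continuous (K : wstar_index H2) : continuous (tr K : wstarM H2 -> R[i]).
Proof.
have h1 : continuous (Mop H2 : wstarM H2 -> wstar H2) by exact: initial_continuous.
move=> f U hU.
exact: (h1 f _ (@wstar_eval_continuous _ _ K (Mop H2 f) U hU)).
Qed.

Let wbox (F : seq (wstar_index H2) * R) : set (oball R d -> R[i]) :=
  [set f | Md H2 f /\ all (fun K => normc (tr K f) < F.2) F.1].

(** The sets of multipliers on which finitely many traces are small form a
    filter basis, and this filter converges to zero in the weak-* topology. *)
Lemma wstar_nbhs0 (U : set (wstarM H2)) : nbhs (cst 0 : wstarM H2) U ->
  exists s (e : R), 0 < e /\
    forall f, Md H2 f -> all (fun K => normc (tr K f) < e) s -> U f.
Proof.
pose D := [set F : seq (wstar_index H2) * R | 0 < F.2].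
have FF : Filter (filter_from D wbox).
  apply: filter_from_filter; first by exists ([::], 1); exact: ltr01.
  move=> [s e] [s' e'] /= e0 e0'; exists (s ++ s', Num.min e e').
    by rewrite /D /= lt_min e0.
  move=> f [mf /=]; rewrite all_cat => /andP[h h']; split; split=> //=.
    by apply: sub_all h => K; rewrite lt_min => /andP[].
  by apply: sub_all h' => K; rewrite lt_min => /andP[].
have cv : filter_from D wbox --> (cst 0 : wstarM H2).
  apply: cvg_initial; apply: cvg_initial; apply/cvg_sup => K.
  apply: cvg_initial.
  apply/cvgrPdist_lt => e e0.
  have e_real : e = (complex.Re e)%:C by rewrite RRe_real// ger0_real// ltW.
  move: e0; rewrite e_real ltr0c => e0.
  exists ([:: K], complex.Re e) => // f [mf /=]; rewrite andbT => h.
  rewrite normcE ltcR -[wstar_eval _ _]/(tr K (cst 0)) tr_cst0 sub0r normcN.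
  exact: h.
by move=> /cv[[s e] e0 h]; exists s, e; split=> // f mf hf; apply: h.
Qed.

(** By homogeneity a linear functional that is bounded where finitely many
    traces are small vanishes where they vanish, so it is a combination of these
    traces; as such it makes sense on all multipliers. *)
Lemma wstar_extension (phi : (oball R d -> R[i]) -> R[i]) (U : set (wstarM H2)) :
  (forall a f g, Ad H2 f -> Ad H2 g ->
     phi (fun z => a * f z + g z) = a * phi f + phi g) ->
  nbhs (cst 0 : wstarM H2) U ->
  (forall f, Ad H2 f -> U f -> normc (phi f) < 1) ->
  exists L : (oball R d -> R[i]) -> R[i],
    [/\ forall (a : R[i]) f g, Md H2 f -> Md H2 g ->
          L (fun z => a * f z + g z) = a * L f + L g,
        {within (Md H2 : set (wstarM H2)), continuous (L : wstarM H2 -> R[i])}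
      & forall f, Ad H2 f -> L f = phi f].
Proof.
move=> philin /wstar_nbhs0[s [e [e0 hs]]] Ubd.
have phi0 : phi (cst 0) = 0.
  have := philin (-1) _ _ (Ad_cst H2 0) (Ad_cst H2 0).
  rewrite mulN1r addNr; congr (phi _ = _).
  by apply/funext => z /=; rewrite mulN1r addNr.
have [||||c hc] := @kernel_combination R _ _ tr phi s (Ad H2).
- exact: Ad_lin.
- by move=> K a f g /Ad_Md mf /Ad_Md mg; exact: tr_lin.
- exact: philin.
- move=> f af f0; apply: normc0_eq0; apply/eqP; rewrite eq_le normc_ge0 andbT.
  rewrite leNgt; apply/negP => pos.
  pose a : R[i] := ((normc (phi f))^-1)%:C.
  have af' := Ad_lin a af (Ad_cst H2 0).
  have small : all (fun K => normc (tr K (fun z => a * f z + cst 0 z)) < e) s.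
    apply: sub_all f0 => K /eqP K0; rewrite tr_lin; [|exact: Ad_Md|exact: Md_cst].
    by rewrite K0 mulr0 tr_cst0 addr0 normc_real normr0.
  have := Ubd _ af' (hs _ (Ad_Md af') small).
  rewrite philin; [|exact: af|exact: Ad_cst].
  rewrite phi0 addr0 normcM normc_real ger0_norm ?invr_ge0 ?normc_ge0//.
  by rewrite mulVf ?gt_eqF// ltxx.
exists (fun f => \sum_(t <- c) t.1 * tr t.2 f); split.
- move=> a f g mf mg; rewrite big_distrr -big_split /=; apply: eq_bigr => t _.
  by rewrite tr_lin//; ring.
- apply: continuous_subspaceT => f; elim: c {hc} => [|t c IH].
    rewrite (_ : (fun f => _) = cst 0); first exact: cst_continuous.
    by apply/funext => g; rewrite big_nil.
  rewrite (_ : (fun f => _) = (fun f : wstarM H2 => t.1 * tr t.2 f + \sum_(t <- c) t.1 * tr t.2 f)).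
    apply: continuousD IH; apply: continuousM; first exact: cst_continuous.
    exact: tr_continuous.
  by apply/funext => g; rewrite big_cons.
- by move=> f af; rewrite hc.
Qed.

End weak_star_functionals.

(** * The functional calculus *)

Section functional_calculus.
Context {R : realType} {d : nat} (H2 : druryArveson R d) {H : hilbertSpace R}.
Implicit Types (f g : oball R d -> R[i]) (T : 'I_d -> H -> H).

Lemma mxopnorm1 (K : hilbertSpace R) (A : K -> K) :
  mxopnorm (fun _ _ : 'I_1 => A) = opnorm A.
Proof.
rewrite /mxopnorm /opnorm; congr (inf _); apply/seteqP; split=> c /= [c0 hc];
  split=> // x.
  have := hc (fun=> x); rewrite !big_ord1 !sqrtr_sqr.
  by rewrite !ger0_norm ?hnorm_ge0.
by rewrite !big_ord1 !sqrtr_sqr !ger0_norm ?hnorm_ge0.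
Qed.

Definition opword T (w : seq 'I_d) (x : H) : H := foldr (fun i y => T i y) x w.

Definition oppoly T (l : seq (R[i] * seq 'I_d)) (x : H) : H :=
  \sum_(t <- l) t.1 *: opword T t.2 x.

Variables (T : 'I_d -> H -> H) (Phi : (oball R d -> R[i]) -> H -> H).
Hypothesis Phi_calc : is_calculus H2 T Phi.

Lemma calculus_bounded f : Ad H2 f -> bounded_op (Phi f).
Proof. by case: Phi_calc => -[h _] _ _ _ _ /h. Qed.

Lemma calculus_lin a f g x : Ad H2 f -> Ad H2 g ->
  Phi (fun z => a * f z + g z) x = a *: Phi f x + Phi g x.
Proof. by case: Phi_calc => -[_ h] _ _ _ _ af ag; exact: h. Qed.

Lemma calculus_cst0 x : Phi (cst 0) x = 0.
Proof.
have := calculus_lin (-1) x (Ad_cst H2 0) (Ad_cst H2 0).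
rewrite scaleN1r addNr; congr (Phi _ x = _).
by apply/funext => z /=; rewrite mulN1r addNr.
Qed.

(** The case of matrices of size one in complete contractivity. *)
Lemma calculus_norm f x : Ad H2 f -> hnorm (Phi f x) <= mnorm H2 f * hnorm x.
Proof.
move=> af; rewrite (le_trans (le_opnorm x (calculus_bounded af)))//.
rewrite ler_wpM2r ?hnorm_ge0// -mxopnorm1 /mnorm -mxopnorm1.
by case: Phi_calc => _ _ _ h _; exact: (h 1 (fun _ _ => f)).
Qed.

Lemma calculus_wmon w : Phi (fun z => wmon w (sval z 0)) = opword T w.
Proof.
have wmon_Ad u : Ad H2 (fun z => wmon u (sval z 0)).
  rewrite (_ : (fun z => _) = wpoly_fun [:: (1, u)]); first exact: wpoly_Ad.
  by apply/funext => z; rewrite /wpoly_fun /wpoly big_seq1 mul1r.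
case: Phi_calc => _ mulP oneP _ coordP; elim: w => [|i w IH].
  rewrite (_ : (fun z => _) = cst 1) ?oneP//.
  by apply/funext => z; rewrite /wmon big_nil.
rewrite (_ : (fun z => _) = coordfun i \* (fun z => wmon w (sval z 0))); last first.
  by apply/funext => z; rewrite /wmon big_cons.
rewrite mulP ?IH ?coordP//; last by rewrite coordfunE; exact: wpoly_Ad.
Qed.

Lemma calculus_wpoly l : Phi (wpoly_fun l) = oppoly T l.
Proof.
apply/funext => x; elim: l => [|t l IH].
  rewrite (_ : wpoly_fun _ = cst 0) ?calculus_cst0 /oppoly ?big_nil//.
  by apply/funext => z; rewrite /wpoly_fun /wpoly big_nil.
rewrite (_ : wpoly_fun _ = (fun z => t.1 * wmon t.2 (sval z 0) + wpoly_fun l z)).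
  rewrite calculus_lin ?IH ?calculus_wmon /oppoly ?big_cons//.
    rewrite (_ : (fun z => _) = wpoly_fun [:: (1, t.2)]); first exact: wpoly_Ad.
    by apply/funext => z; rewrite /wpoly_fun /wpoly big_seq1 mul1r.
  exact: wpoly_Ad.
by apply/funext => z; rewrite /wpoly_fun wpoly_cons.
Qed.

End functional_calculus.

(** The coefficient [f |-> <f(T) u, v>] is the trace of [f(T)] against a rank
    one operator, hence bounded on a weak-* neighbourhood of zero. *)
Lemma absolutely_continuous_functional (R : realType) (d : nat)
    (H2 : druryArveson R d) (H : hilbertSpace R) (T : 'I_d -> H -> H) :
  separable_hilbert H -> absolutely_continuous H2 T ->
  exists2 Phi, is_calculus H2 T Phi & forall u v, exists L : (oball R d -> R[i]) -> R[i],
    [/\ forall (a : R[i]) f g, Md H2 f -> Md H2 g ->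
          L (fun z => a * f z + g z) = a * L f + L g,
        {within (Md H2 : set (wstarM H2)), continuous (L : wstarM H2 -> R[i])}
      & forall f, Ad H2 f -> L f = hip (Phi f u) v].
Proof.
move=> /separable_onb[e e_onb] [Phi [Psi [Phi_calc PsiPhi Psi_bd Psi_cont]]].
exists Phi => // u v.
pose u' := ((hnorm v ^+ 2)^-1)%:C *: u.
have trE C : bounded_op C ->
    trace e (C \o (rank_one u' v \o rank_one v v)) = hip (C u) v.
  move=> bC; have [_ ->] := trace_rank_one u' v bC e_onb.
  rewrite /u' (opZ _ _ bC.1) hipZl mulrA -rmorphM /=.
  have [v0|v_neq0] := eqVneq (hnorm v) 0; first by rewrite (hnorm_eq0 v0) !hip0r mulr0.
  by rewrite mulfV ?mul1r// expf_neq0.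
have [tcK _] := trace_rank_one u' v (@bounded_id _ H) e_onb.
pose K : wstar_index H := exist _ (_, e) (conj tcK e_onb).
pose U : set (wstarM H2) := [set f | Md H2 f -> normc (hip (Psi f u) v) < 1].
apply: (@wstar_extension _ _ _ _ U).
- move=> a f g af ag; rewrite (calculus_lin Phi_calc)//.
  by rewrite hipDl hipZl.
- have Md0 : Md H2 (cst 0) := Md_cst H2 0.
  have Psi0 : hip (Psi (cst 0) u) v = 0.
    by rewrite PsiPhi ?(calculus_cst0 Phi_calc) ?hip0l//; exact: Ad_cst.
  have one0 : (0 : R[i]) < 1 by [].
  have /cvgrPdist_lt/(_ _ one0) ev := @wstar_eval_continuous _ _ K (Psi (cst 0)).
  move/subspace_continuousP: Psi_cont => /(_ (cst 0) Md0 _ ev) h.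
  have {}h : nbhs (cst 0 : wstarM H2) [set f : wstarM H2 | Md H2 f ->
      `|wstar_eval (Psi (cst 0)) K - wstar_eval (Psi f) K| < 1] := h.
  apply: (@filterS _ (nbhs (cst 0 : wstarM H2)) _ _ _ _ h) => f hf mf.
  have {hf} := hf mf.
  rewrite -[wstar_eval _ K]/(trace e (Psi (cst 0) \o (rank_one u' v \o rank_one v v))).
  rewrite -[wstar_eval (Psi f) K]/(trace e (Psi f \o (rank_one u' v \o rank_one v v))).
  by rewrite !trE ?Psi0 ?sub0r ?normrN; [rewrite normcE -[1]/(1%:C) ltcR|exact: Psi_bd|exact: Psi_bd].
- by move=> f af Uf; have := Uf (Ad_Md af); rewrite PsiPhi.
Qed.

(** * Words and multi-indices *)

Section multinomial_walk.
Context {R : realType} {d : nat}.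
Implicit Types (G : ('I_d -> nat) -> R) (k : 'I_d).

(** The sum of [G] over all words of length [N], where [G] sees only the number
    of occurrences of each letter.  The multinomial coefficients count the words
    with given numbers of occurrences. *)
Fixpoint walk (N : nat) G : R :=
  if N is M.+1 then \sum_(k < d) walk M (fun a => G (fun i => (i == k) + a i)%N)
  else G (fun=> 0%N).

Let inc B k (a : {ffun 'I_d -> 'I_B.+1}) : {ffun 'I_d -> 'I_B.+1} :=
  [ffun i => inord ((i == k) + a i)].

Let dec B k (a : {ffun 'I_d -> 'I_B.+1}) : {ffun 'I_d -> 'I_B.+1} :=
  [ffun i => inord (a i - (i == k))].

(** Weighting by [a k] and summing over [k] multiplies the terms by [N + 1];
    removing one letter [k] then gives the sum for words of length [N]. *)
Lemma multinomial_walk B N G : (N <= B)%N ->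
  \sum_(a : {ffun 'I_d -> 'I_B.+1} | (\sum_i (a i : nat))%N == N)
    (N`!%:R / (\prod_i (a i)`!)%N%:R) * G (fun i => a i : nat) = walk N G.
Proof.
elim: N G => [|N IH] G NB.
  rewrite (big_pred1 [ffun=> ord0]) => [|a].
    rewrite /= fact0 big1 => [|i _]; last by rewrite ffunE.
    by rewrite invr1 mulr1 mul1r; congr G; apply/funext => i; rewrite ffunE.
  rewrite sum_nat_eq0; apply/forall_inP/eqP => [h|-> i _]; last by rewrite ffunE.
  by apply/ffunP => i; rewrite ffunE; apply/val_inj/eqP; exact: h.
transitivity (\sum_(k < d) \sum_(a : {ffun 'I_d -> 'I_B.+1} |
    (\sum_i (a i : nat))%N == N.+1)
    (a k)%:R * (N`!%:R / (\prod_i (a i)`!)%N%:R) * G (fun i => a i : nat)).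
  rewrite exchange_big /=; apply: eq_bigr => a /eqP sa.
  rewrite -big_distrl -big_distrl /= -natr_sum sa factS natrM.
  by rewrite -!mulrA.
rewrite /=; apply: eq_bigr => k _; rewrite -(IH _ (ltnW NB)).
rewrite (bigID (fun a : {ffun 'I_d -> 'I_B.+1} => a k == ord0)) /=.
rewrite big1 ?add0r => [|a /andP[_ /eqP ->]]; last by rewrite !mul0r.
have incE (a : {ffun 'I_d -> 'I_B.+1}) i : (\sum_i (a i : nat))%N = N ->
    inc k a i = ((i == k) + a i)%N :> nat.
  move=> sa; rewrite ffunE inordK// ltnS (leq_trans _ NB)//.
  have : (a i <= N)%N by rewrite -sa (bigD1 i)//= leq_addr.
  by case: (i == k) => /=; [rewrite add1n|rewrite add0n => /leqW].
have decE (a : {ffun 'I_d -> 'I_B.+1}) i : dec k a i = (a i - (i == k))%N :> nat.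
  by rewrite ffunE inordK// (leq_ltn_trans (leq_subr _ _)).
rewrite (reindex_onto (inc k) (dec k)) /=; last first.
  move=> a /andP[/eqP sa ak]; apply/ffunP => i; apply/val_inj => /=.
  rewrite ffunE decE; case: eqP => [->|_]; last by rewrite subn0 add0n inord_val.
  by rewrite subnKC ?inord_val// lt0n.
have inc_sum (a : {ffun 'I_d -> 'I_B.+1}) : (\sum_i (a i : nat))%N = N ->
    (\sum_i (inc k a i : nat))%N = N.+1.
  move=> sa; under eq_bigr => i _ do rewrite incE//.
  by rewrite big_split /= sa -big_mkcond big_pred1_eq.
apply: eq_big => [a|a].
  apply/andP/eqP => [[/andP[/eqP sa ak] /eqP da]|sa].
    have : (\sum_i (inc k a i : nat))%N = (\sum_i ((i == k) + a i))%N.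
      apply: eq_bigr => i _; rewrite -{2}da decE.
      by case: eqP => [->|_]; rewrite ?subn0// subnKC// lt0n.
    by rewrite sa big_split /= -big_mkcond big_pred1_eq => -[].
  rewrite inc_sum// eqxx -val_eqE /= incE// eqxx; split=> //.
  by apply/eqP/ffunP => i; apply/val_inj => /=; rewrite decE incE// addKn.
move=> /andP[/andP[/eqP sa ak] /eqP da].
have sa' : (\sum_i (a i : nat))%N = N.
  have : (\sum_i (inc k a i : nat))%N = (\sum_i ((i == k) + a i))%N.
    apply: eq_bigr => i _; rewrite -{2}da decE.
    by case: eqP => [->|_]; rewrite ?subn0// subnKC// lt0n.
  by rewrite sa big_split /= -big_mkcond big_pred1_eq => -[].
congr (_ * _); last by congr G; apply/funext => i; rewrite incE.
rewrite (bigD1 k)//= [in RHS](bigD1 k)//= incE// eqxx add1n factS.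
rewrite (_ : \prod_(i < d | i != k) (inc k a i)`! = \prod_(i < d | i != k) (a i)`!)%N.
  have P0 : (\prod_(i < d | i != k) (a i)`!)%N%:R != 0 :> R.
    by rewrite pnatr_eq0 -lt0n prodn_gt0// => i; rewrite fact_gt0.
  have k0 : (a k)`!%:R != 0 :> R by rewrite pnatr_eq0 -lt0n fact_gt0.
  have k1 : (a k).+1%:R != 0 :> R by rewrite pnatr_eq0.
  rewrite !natrM; move: P0 k0 k1; move: (_.+1%:R) ((a k)`!%:R) (_%:R) (N`!%:R).
  by move=> x y z t z0 y0 x0; field; rewrite x0 y0 z0.
by apply: eq_bigr => i /negbTE ik; rewrite incE// ik.
Qed.

End multinomial_walk.

(** * The limit of the defect operators *)

Section limit_operator.
Context {R : realType} {d : nat} {H : hilbertSpace R}.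
Variables (T : 'I_d -> H -> H) (T_row : commuting_row_contraction T).
Implicit Types (x y z : H).

Let S k := adjoint (T k).

Lemma T_bounded k : bounded_op (T k).
Proof. by case: T_row. Qed.

Lemma T_comm j k x : T j (T k x) = T k (T j x).
Proof. by case: T_row => _ h _; have /(congr1 (fun f => f x)) := h j k. Qed.

Lemma adjoint_comm j k x : S j (S k x) = S k (S j x).
Proof.
have h a b := adjoint_comp (T_bounded a) (T_bounded b).
rewrite -[LHS]/((S j \o S k) x) -[RHS]/((S k \o S j) x) -!h.
by congr (adjoint _ x); apply/funext => y; exact: T_comm.
Qed.

Lemma iter_T_comm n i k x : iter n (T i) (T k x) = T k (iter n (T i) x).
Proof. by elim: n => //= n ->; exact: T_comm. Qed.

Lemma mpow_step a k : mpow T (fun i => (i == k) + a i)%N = T k \o mpow T a.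
Proof.
have gen (r : seq 'I_d) : uniq r ->
    \big[(fun A B : H -> H => A \o B)/id]_(i <- r) iter ((i == k) + a i) (T i) =
    (if k \in r then T k else id) \o
      \big[(fun A B : H -> H => A \o B)/id]_(i <- r) iter (a i) (T i).
  elim: r => [|i r IH] /=; first by rewrite !big_nil.
  move=> /andP[ir ur]; rewrite !big_cons IH// inE; apply/funext => x /=.
  case: (altP (i =P k)) => [<-|ik]; first by rewrite eqxx /= (negbTE ir).
  by rewrite eq_sym (negbTE ik) /= add0n; case: ifP => //= _; rewrite iter_T_comm.
by rewrite /mpow gen ?index_enum_uniq// mem_index_enum.
Qed.

Lemma bounded_mpow a : bounded_op (mpow T a).
Proof.
rewrite /mpow; elim/big_ind: _ => [|A B|i _]; first exact: bounded_id.
  exact: bounded_comp.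
elim: (a i) => [|n IH]; first exact: bounded_id.
by rewrite (_ : iter _ _ = T i \o iter n (T i))//; exact: bounded_comp (T_bounded i) IH.
Qed.

Fixpoint defect_sum N x : R :=
  if N is M.+1 then \sum_(k < d) defect_sum M (S k x) else hnorm x ^+ 2.

Lemma walk_mpow N x :
  walk N (fun a => hnorm (adjoint (mpow T a) x) ^+ 2) = defect_sum N x.
Proof.
elim: N x => [|N IH] x /=.
  rewrite (_ : mpow T _ = id).
    by rewrite (@adjoint_eq _ _ id x x).
  by rewrite /mpow; elim/big_rec: _ => // i A _ ->.
apply: eq_bigr => k _; rewrite -IH; congr (walk N _); apply/funext => a.
by rewrite mpow_step adjoint_comp//; [exact: T_bounded|exact: bounded_mpow].
Qed.

(** The iterates of [X |-> sum T_k X T_k^*] at the identity. *)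
Fixpoint Qn N x : H := if N is M.+1 then \sum_(k < d) T k (Qn M (S k x)) else x.

Lemma hip_Qn N x y :
  hip (Qn N.+1 x) y = \sum_(k < d) hip (Qn N (S k x)) (S k y).
Proof.
rewrite /= hip_suml; apply: eq_bigr => k _.
by rewrite adjointP//; exact: T_bounded.
Qed.

Lemma S_lin k : linear (S k).
Proof. by apply: adjoint_linear; exact: T_bounded. Qed.

Lemma Qn_psd N : psd_form (fun x y => hip (Qn N x) y).
Proof.
elim: N => [|N [h1 h2 h3]]; first exact: hip_psd.
split=> [a x y z|x y|x]; rewrite !hip_Qn.
- rewrite big_distrr -big_split /=; apply: eq_bigr => k _.
  by rewrite S_lin h1.
- by rewrite rmorph_sum; apply: eq_bigr => k _; rewrite h2.
- by apply: sumr_ge0 => k _; exact: h3.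
Qed.

Lemma hip_Qn_diag N x : hip (Qn N x) x = (defect_sum N x)%:C.
Proof.
elim: N x => [|N IH] x; first by rewrite /= hipxx.
by rewrite hip_Qn /= rmorph_sum; apply: eq_bigr => k _; rewrite IH.
Qed.

Lemma defect_sum_ge0 N x : 0 <= defect_sum N x.
Proof. by rewrite -ler0c -hip_Qn_diag; case: (Qn_psd N). Qed.

Lemma defect_sum_decr N x : defect_sum N.+1 x <= defect_sum N x.
Proof.
elim: N x => [|N IH] x; last by apply: ler_sum => k _; exact: IH.
case: T_row => _ _ /(_ x); rewrite hipBl hip_suml hipxx.
rewrite (_ : \sum_(k < d) _ = \sum_(k < d) (hnorm (S k x) ^+ 2)%:C).
  by rewrite -rmorph_sum -rmorphB /= ler0c subr_ge0.
by apply: eq_bigr => k _; rewrite adjointP ?hipxx//; exact: T_bounded.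
Qed.

Lemma defect_sum_le M N x : (M <= N)%N -> defect_sum N x <= defect_sum M x.
Proof.
move=> /subnK <-; elim: (N - M)%N => // n; apply: le_trans.
exact: defect_sum_decr.
Qed.

(** [Q_M - Q_N] is positive for [M <= N], and a positive operator [D] of norm
    at most one satisfies [|D x|^2 <= <D x, x>]. *)
Lemma Qn_dist M N x : (M <= N)%N ->
  hnorm (Qn M x - Qn N x) ^+ 2 <= defect_sum M x - defect_sum N x.
Proof.
move=> MN; pose D u v := hip (Qn M u) v - hip (Qn N u) v.
have D_psd : psd_form D.
  have [a1 a2 a3] := Qn_psd M; have [b1 b2 b3] := Qn_psd N.
  split=> [a u v w|u v|u]; rewrite /D.
  - by rewrite a1 b1; ring.
  - by rewrite a2 b2 rmorphB.
  - by rewrite !hip_Qn_diag -rmorphB ler0c subr_ge0 defect_sum_le.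
set y := Qn M x - Qn N x.
have DD u : complex.Re (D u u) = defect_sum M u - defect_sum N u.
  by rewrite /D !hip_Qn_diag.
have := form_CauchySchwarz D_psd x y.
rewrite !DD {1}/D -hipBl -/y hipxx normc_real ger0_norm ?exprn_ge0 ?hnorm_ge0//.
set n2 := hnorm y ^+ 2 => cs.
have Dy : defect_sum M y - defect_sum N y <= n2.
  rewrite (le_trans _ (defect_sum_le y (leq0n M)))//.
  by rewrite lerBlDr lerDl defect_sum_ge0.
have Dx : 0 <= defect_sum M x - defect_sum N x by rewrite subr_ge0 defect_sum_le.
have n2_ge0 : 0 <= n2 by rewrite exprn_ge0 ?hnorm_ge0.
have [-> //|n2_neq0] := eqVneq n2 0.
have n2_gt0 : 0 < n2 by rewrite lt_neqAle eq_sym n2_neq0.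
rewrite -(ler_pM2r n2_gt0) -expr2 (le_trans cs)//.
by rewrite ler_wpM2l.
Qed.

Lemma cvg_defect_sum x : cvgn (fun N => defect_sum N x).
Proof.
apply: nonincreasing_is_cvgn.
  by move=> M N MN; exact: defect_sum_le.
by exists 0 => _ [N _ <-]; exact: defect_sum_ge0.
Qed.

Lemma Qn_cvg x : exists l, hcvg (Qn ^~ x) l.
Proof.
apply: hcvg_complete => e e0.
have /cvgrPdist_lt h := @cvg_defect_sum x.
have [N _ hN] := h _ (exprn_gt0 2 e0).
have lim_le n : limn (fun N => defect_sum N x) <= defect_sum n x.
  apply: nonincreasing_cvgn_ge; last exact: cvg_defect_sum.
  by move=> m m' mm'; exact: defect_sum_le.
have close m n : (N <= m <= n)%N -> hnorm (Qn m x - Qn n x) < e.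
  move=> /andP[Nm mn]; rewrite -(@ltr_pXn2r _ 2)// ?nnegrE ?hnorm_ge0 ?(ltW e0)//.
  rewrite (le_lt_trans (Qn_dist _ mn))//.
  have := hN m Nm; rewrite /= distrC ger0_norm ?subr_ge0//.
  by have := lim_le n; lra.
exists N => m n Nm Nn; have [mn|nm] := leqP m n; first by rewrite close// Nm.
by rewrite hnormB close// Nn ltnW.
Qed.

Definition Qlim x : H := xget 0 [set l | hcvg (Qn ^~ x) l].

Lemma QlimP x : hcvg (Qn ^~ x) (Qlim x).
Proof. by have [l hl] := Qn_cvg x; exact: (xgetPex 0 (ex_intro _ l hl)). Qed.

Definition qform x y : R[i] := hip (Qlim x) y.

Lemma cvg_qform x y : (fun N => hip (Qn N x) y) @ \oo --> qform x y.
Proof. by apply: cvgn_normc; apply: hcvg_hip; exact: QlimP. Qed.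

Lemma cvgC_unique (u : nat -> R[i]) (a b : R[i]) :
  u @ \oo --> a -> u @ \oo --> b -> a = b.
Proof. by move=> ua ub; apply: (cvg_unique _ ua ub); exact: norm_hausdorff. Qed.

Lemma qform_diag x : qform x x = (limn (fun N => defect_sum N x))%:C.
Proof.
have h : (fun N => hip (Qn N x) x) @ \oo --> ((limn (fun N => defect_sum N x))%:C : R[i]).
  apply: cvgn_ReIm => /=.
    by under eq_fun do rewrite hip_Qn_diag; exact: cvg_defect_sum.
  by under eq_fun do rewrite hip_Qn_diag; exact: cvg_cst.
exact: (cvgC_unique (@cvg_qform x x) h).
Qed.

Lemma cvgn_conj (u : nat -> R[i]) (a : R[i]) :
  u @ \oo --> a -> (fun n => Num.conj (u n)) @ \oo --> Num.conj a.
Proof.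
move=> /cvgrPdist_lt h; apply/cvgrPdist_lt => e e0; near=> n.
rewrite -rmorphB norm_conjC; near: n; exact: h.
Unshelve. all: by end_near. Qed.

Lemma qform_psd : psd_form qform.
Proof.
split=> [a x y z|x y|x].
- apply: cvgC_unique (@cvg_qform (a *: x + y) z) _.
  under eq_fun => N do rewrite (formP (Qn_psd N)).
  apply: cvgD; last exact: cvg_qform.
  by apply: cvgM; [exact: cvg_cst|exact: cvg_qform].
- apply: cvgC_unique (@cvg_qform y x) _.
  under eq_fun => N do rewrite (formC (Qn_psd N)).
  by apply: cvgn_conj; exact: cvg_qform.
- rewrite qform_diag ler0c; apply: limr_ge; first exact: cvg_defect_sum.
  by apply: nearW => N; exact: defect_sum_ge0.
Qed.

Lemma qform_le x : complex.Re (qform x x) <= hnorm x ^+ 2.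
Proof.
rewrite qform_diag; apply: limr_le; first exact: cvg_defect_sum.
by apply: nearW => N; exact: (@defect_sum_le 0 N x).
Qed.

(** The recursion of [Qn], in the limit: the adjoints form a spherical isometry
    for the limit form. *)
Lemma qform_inv x y : \sum_(k < d) qform (S k x) (S k y) = qform x y.
Proof.
have h := @cvg_qform x y; have := h; rewrite -cvg_shiftS /= => h1.
apply: cvgC_unique h1.
under eq_fun => N do rewrite hip_Qn.
apply: cvg_big => [|k _]; first exact: add_continuous.
exact: cvg_qform.
Qed.

(** The multinomial sums in the definition of purity are the sums
    [<Q_N x, x>], by grouping words with the same letters. *)
Lemma pure_qform : (forall x, qform x x = 0) -> pure T.
Proof.
move=> q0 x; rewrite (_ : (fun N => _) = (fun N => defect_sum N x)).
  have := @cvg_defect_sum x; rewrite (_ : limn _ = 0)//.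
  by have := q0 x; rewrite qform_diag => -[].
apply/funext => N; rewrite -walk_mpow.
exact: (multinomial_walk (fun a => hnorm (adjoint (mpow T a) x) ^+ 2) (leqnn N)).
Qed.

End limit_operator.

(** * A random walk with prescribed moments *)

Section spherical_walk.
Context {R : realType} {d : nat} {H : hilbertSpace R}.
Variables (q : H -> H -> R[i]) (S : 'I_d -> H -> H).
Hypotheses (q_psd : psd_form q) (S_lin : forall k, linear (S k))
  (S_comm : forall j k x, S j (S k x) = S k (S j x))
  (q_inv : forall x y, \sum_(k < d) q (S k x) (S k y) = q x y).
Implicit Types (x y u v : H) (s t z : 'rV[R[i]]_d) (j : ('I_d * 'I_4)%type).

Definition root4 (n : 'I_4) : R[i] := nth 0 [:: 1; 'i%C; -1; - 'i%C] n.

Lemma normc_root4 n : normc (root4 n) = 1.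
Proof.
have i1 : normc ('i%C : R[i]) = 1 by rewrite /= expr0n expr1n add0r sqrtr1.
have one1 : normc (1 : R[i]) = 1 by rewrite normc_real normr1.
have iN1 : normc (- 'i%C : R[i]) = 1 by rewrite normcN.
have oneN1 : normc (- 1 : R[i]) = 1 by rewrite normcN.
by case: n => -[|[|[|[|//]]]] ?; [exact: one1|exact: i1|exact: oneN1|exact: iN1].
Qed.

Lemma conj_i : Num.conj ('i%C : R[i]) = - 'i%C.
Proof. by apply/eqP; rewrite eq_complex /= oppr0 !eqxx. Qed.

(** Summation over the fourth roots of unity extracts one Fourier mode. *)
Lemma sum_root4 (a b c : R[i]) :
  \sum_n root4 n * (a + root4 n * b + Num.conj (root4 n) * c) = 4 * c.
Proof.
have i2 : 'i%C * 'i%C = -1 :> R[i] by rewrite -expr2 sqr_i.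
rewrite !big_ord_recl big_ord0 /root4 /= !rmorphN /= rmorph1 conj_i.
move: i2; move: 'i%C => w i2.
transitivity (2 * b + 2 * c + 2 * (w * w) * (b - c)); first by ring.
by rewrite i2; ring.
Qed.

Lemma sum_root4_conj (a b c : R[i]) :
  \sum_n Num.conj (root4 n) * (a + root4 n * b + Num.conj (root4 n) * c) = 4 * b.
Proof.
have i2 : 'i%C * 'i%C = -1 :> R[i] by rewrite -expr2 sqr_i.
rewrite !big_ord_recl big_ord0 /root4 /= !rmorphN /= rmorph1 conj_i.
move: i2; move: 'i%C => w i2.
transitivity (2 * b + 2 * c + 2 * (w * w) * (c - b)); first by ring.
by rewrite i2; ring.
Qed.

Lemma sum_root4_const (a b c : R[i]) :
  \sum_n (a + root4 n * b + Num.conj (root4 n) * c) = 4 * a.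
Proof.
rewrite !big_ord_recl big_ord0 /root4 /= !rmorphN /= rmorph1 conj_i.
by ring.
Qed.

Let D : R := d.+1%:R.
Let c : R[i] := ((4 * D)^-1)%:C.

(** One step of the walk: a direction [k] and a fourth root of unity [e] are
    chosen, and the vector [y] moves to [y + e S_k y].  The factor [c] makes the
    total mass of the steps one, by [sum_k q(S_k y, S_k y) = q(y, y)]. *)
Definition step (j : 'I_d * 'I_4) (y : H) : H := y + root4 j.2 *: S j.1 y.

(** The mean of a jump, weighted by the form, is the adjoint of [S]: see
    [jump_mean]. *)
Definition jump (j : 'I_d * 'I_4) : 'rV[R[i]]_d :=
  \row_k (if k == j.1 then D%:C * root4 j.2 else 0).

(** The integral of [h] against the law of the position after [N] steps, each
    path being weighted by the value of [q] at its final vector. *)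
Fixpoint EN (N : nat) (h : 'rV[R[i]]_d -> R[i]) (y : H) : R[i] :=
  if N is M.+1 then c * \sum_j EN M (fun s => h (s + jump j)) (step j y)
  else h 0 * q y y.

Lemma S_D k x y : S k (x + y) = S k x + S k y.
Proof. exact: opD. Qed.

Lemma S_Z k a x : S k (a *: x) = a *: S k x.
Proof. exact: opZ. Qed.

Lemma step_word w j y : opword S w (step j y) = step j (opword S w y).
Proof.
elim: w => //= i w ->; rewrite /step S_D S_Z; congr (_ + _ *: _).
exact: S_comm.
Qed.

Lemma step_comm i j y : step i (step j y) = step j (step i y).
Proof.
rewrite /step !S_D !S_Z !scalerDr !scalerA (S_comm i.1 j.1).
by rewrite [root4 j.2 * _]mulrC -!addrA; congr (_ + _); rewrite addrCA.
Qed.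

Lemma q_step (j : 'I_d * 'I_4) u v : q (step j u) (step j v) =
  q u v + q (S j.1 u) (S j.1 v) + root4 j.2 * q (S j.1 u) v +
  Num.conj (root4 j.2) * q u (S j.1 v).
Proof.
rewrite /step !(formDl q_psd) !(formDr q_psd) !(formZl q_psd) !(formZr q_psd).
have : root4 j.2 * Num.conj (root4 j.2) = 1.
  by rewrite sqr_normcE normc_root4 expr1n.
set w := root4 _; set w' := Num.conj w => ww.
rewrite mulrA ww; ring.
Qed.

Lemma c4D : c * (4 * D%:C) = 1.
Proof.
have -> : (4 : R[i]) * D%:C = (4 * D)%:C.
  by rewrite (rmorphM (real_complex R)); congr (_ * _); rewrite (rmorph_nat (real_complex R)).
rewrite /c -rmorphM /= mulVf ?rmorph1//.
by rewrite mulf_neq0// pnatr_eq0.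
Qed.

Lemma DE : D%:C = d%:R + 1 :> R[i].
Proof. by rewrite /D (rmorph_nat (real_complex R)) natr1. Qed.

Lemma big_pairI (F : 'I_d -> 'I_4 -> R[i]) :
  \sum_(j : 'I_d * 'I_4) F j.1 j.2 = \sum_(k < d) \sum_n F k n.
Proof. by rewrite pair_bigA. Qed.

Lemma mass_step y : c * \sum_j q (step j y) (step j y) = q y y.
Proof.
transitivity (c * \sum_(k < d) \sum_n (q y y + q (S k y) (S k y) +
    root4 n * q (S k y) y + Num.conj (root4 n) * q y (S k y))).
  by rewrite -big_pairI; congr (_ * _); apply: eq_bigr => j _; rewrite q_step.
under eq_bigr => k _ do rewrite sum_root4_const mulrDr.
rewrite big_split /= -big_distrr -big_distrr /= q_inv sumr_const card_ord.
transitivity (c * (4 * D%:C) * q y y); last by rewrite c4D mul1r.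
by rewrite DE -mulr_natl; ring.
Qed.

Lemma jump_mean k u v : c * \sum_j jump j 0 k * q (step j u) (step j v) = q u (S k v).
Proof.
transitivity (c * \sum_(i < d) \sum_n (if k == i then D%:C * root4 n else 0) *
    (q u v + q (S i u) (S i v) + root4 n * q (S i u) v +
     Num.conj (root4 n) * q u (S i v))).
  by rewrite -big_pairI; congr (_ * _); apply: eq_bigr => j _; rewrite q_step mxE.
rewrite (bigD1 k)//= [X in _ + X]big1 ?addr0 => [|i ik]; last first.
  by apply: big1 => n _; rewrite eq_sym (negbTE ik) mul0r.
under eq_bigr do rewrite eqxx -mulrA.
transitivity (c * (4 * D%:C) * q u (S k v)); last by rewrite c4D mul1r.
by rewrite -big_distrr /= sum_root4; ring.
Qed.

Lemma jump_mean_conj k u v :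
  c * \sum_j Num.conj (jump j 0 k) * q (step j u) (step j v) = q (S k u) v.
Proof.
transitivity (c * \sum_(i < d) \sum_n (if k == i then D%:C * Num.conj (root4 n) else 0) *
    (q u v + q (S i u) (S i v) + root4 n * q (S i u) v +
     Num.conj (root4 n) * q u (S i v))).
  rewrite -big_pairI; congr (_ * _); apply: eq_bigr => j _; rewrite q_step mxE.
  by case: ifP; rewrite ?rmorph0// rmorphM /= [Num.conj _%:C]conjc_real.
rewrite (bigD1 k)//= [X in _ + X]big1 ?addr0 => [|i ik]; last first.
  by apply: big1 => n _; rewrite eq_sym (negbTE ik) mul0r.
under eq_bigr do rewrite eqxx -mulrA.
transitivity (c * (4 * D%:C) * q (S k u) v); last by rewrite c4D mul1r.
by rewrite -big_distrr /= sum_root4_conj; ring.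
Qed.

Lemma EN_lin N a h g y :
  EN N (fun s => a * h s + g s) y = a * EN N h y + EN N g y.
Proof.
elim: N h g y => [|N IH] h g y /=; first by ring.
under eq_bigr do rewrite IH.
by rewrite big_split /= -big_distrr /=; ring.
Qed.

Lemma EN_mass N a y : EN N (cst a) y = a * q y y.
Proof.
elim: N y => [|N IH] y //=.
by under eq_bigr do rewrite IH; rewrite -big_distrr /= mulrCA mass_step.
Qed.

(** The size-biasing identity for the walk: by exchangeability of the steps, a
    factor that is additive in the position may be charged to the last step. *)
Lemma EN_bias N (l : 'rV[R[i]]_d -> R[i]) h y :
  l 0 = 0 -> (forall s t, l (s + t) = l s + l t) ->
  EN N.+1 (fun s => l s * h s) y =
  N.+1%:R * (c * \sum_j l (jump j) * EN N (fun s => h (s + jump j)) (step j y)).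
Proof.
move=> l0 lD.
(* In the second sum [l] is charged to the step that comes first; in the first
   one it is charged to a later step. *)
have split1 M k u : EN M.+1 (fun s => l s * k s) u =
    c * \sum_j EN M (fun s => l s * k (s + jump j)) (step j u) +
    c * \sum_j l (jump j) * EN M (fun s => k (s + jump j)) (step j u).
  rewrite /= -mulrDr -big_split /=; congr (_ * _); apply: eq_bigr => j _.
  rewrite addrC -EN_lin; congr (EN M _ _); apply/funext => s.
  by rewrite lD; ring.
elim: N h y => [|N IH] h y; rewrite split1.
  rewrite mul1r; under [X in _ * X + _]eq_bigr do rewrite /= l0 !mul0r.
  by rewrite big1 ?mulr0 ?add0r.
rewrite [X in c * X + _](_ : _ = N.+1%:R * \sum_i l (jump i) *
    EN N.+1 (fun s => h (s + jump i)) (step i y)).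
  by rewrite -[in RHS]natr1; ring.
under eq_bigr do rewrite IH.
rewrite -big_distrr /=; congr (_ * _).
transitivity (\sum_j \sum_i c * (l (jump i) *
   EN N (fun s => h (s + jump i + jump j)) (step i (step j y)))).
  by apply: eq_bigr => j _; rewrite big_distrr.
rewrite exchange_big /=; apply: eq_bigr => i _.
rewrite mulrCA !big_distrr /=; apply: eq_bigr => j _.
rewrite step_comm; congr (_ * (_ * EN N _ _)).
by apply/funext => s; rewrite addrAC.
Qed.

(** Positions reachable in [N] steps. *)
Definition box N s : Prop := forall k, normc (s 0 k) <= D * N%:R.

Lemma box_jump N s j : box N s -> box N.+1 (s + jump j).
Proof.
move=> sN k; rewrite !mxE -natr1 mulrDr mulr1 (le_trans (ler_normcD _ _))//.
rewrite lerD//; case: ifP => _; last by rewrite normc_real normr0 ler0n.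
by rewrite normcM normc_root4 mulr1 normc_real ger0_norm ?ler0n.
Qed.

Lemma EN_ge0 N (g : 'rV[R[i]]_d -> R[i]) y :
  (forall s, box N s -> 0 <= g s) -> 0 <= EN N g y.
Proof.
have c0 : 0 <= c by rewrite ler0c invr_ge0 mulr_ge0 ?ler0n.
elim: N g y => [|N IH] g y g0 /=.
  rewrite mulr_ge0 ?(form_ge0 q_psd)// g0// => k.
  by rewrite mxE mulr0 normc_real normr0.
rewrite mulr_ge0// sumr_ge0// => j _; apply: IH => s sN.
by apply: g0; exact: box_jump.
Qed.

Lemma step_average (F : 'I_d * 'I_4 -> R[i]) (K : R) y :
  (forall j, normc (F j) <= K * complex.Re (q (step j y) (step j y))) ->
  normc (c * \sum_j F j) <= K * complex.Re (q y y).
Proof.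
have c0 : 0 <= (4 * D)^-1 by rewrite invr_ge0 mulr_ge0 ?ler0n.
move=> hF.
have -> : complex.Re (q y y) = (4 * D)^-1 * \sum_j complex.Re (q (step j y) (step j y)).
  by rewrite -[in LHS]mass_step -raddf_sum /c; case: (\sum_j _) => a b /=; rewrite mul0r subr0.
rewrite normcM normc_real ger0_norm// mulrCA ler_wpM2l// big_distrr /=.
apply: le_trans (ler_sum _ (fun j _ => hF j)).
elim/big_ind2: _ => [|a b a' b' h1 h2|//]; first by rewrite normc_real normr0.
by rewrite (le_trans (ler_normcD _ _))// lerD.
Qed.

Lemma EN_bound N h (e : R) y : (forall s, box N s -> normc (h s) <= e) ->
  normc (EN N h y) <= e * complex.Re (q y y).
Proof.
elim: N h y => [|N IH] h y hb /=.
  rewrite normcM [q y y](form_re q_psd) normc_real ger0_norm ?(Re_form_ge0 q_psd)//.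
  rewrite ler_wpM2r ?(Re_form_ge0 q_psd)// hb// => k.
  by rewrite mxE mulr0 normc_real normr0.
apply: step_average => j; apply: IH => s sN.
by apply: hb; exact: box_jump.
Qed.

Definition regular (h : 'rV[R[i]]_d -> R[i]) : Prop := exists2 C : R, 0 <= C &
  (forall z, box 1 z -> normc (h z) <= C) /\
  (forall z w (e : R), 0 <= e -> box 1 z -> box 1 w ->
     (forall k, normc (z 0 k - w 0 k) <= e) -> normc (h z - h w) <= C * e).

(** A law of large numbers with a rate.  Uniformity in [y], relative to
    [q y y], is what an induction on words needs, since conditioning on one step
    changes the starting vector. *)
Definition rate (h : 'rV[R[i]]_d -> R[i]) (A : H -> R[i]) : Prop :=
  exists2 C : R, 0 <= C & exists N0, forall N y, (N0 <= N)%N ->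
    normc (EN N (fun s => h (N%:R^-1 *: s)) y - A y) <= C / N%:R * complex.Re (q y y).

Lemma box_scale N s : (0 < N)%N -> box N s -> box 1 (N%:R^-1 *: s).
Proof.
move=> N0 sN k; rewrite mxE normcM mulr1.
have -> : N%:R^-1 = (N%:R^-1)%:C :> R[i].
  by rewrite (fmorphV (real_complex R)) (rmorph_nat (real_complex R)).
rewrite normc_real ger0_norm ?invr_ge0//.
by rewrite mulrC ler_pdivrMr ?ltr0n.
Qed.

Section one_letter.
Variables (k : 'I_d) (l : 'rV[R[i]]_d -> R[i]).
Hypotheses (l0 : l 0 = 0) (lD : forall s t, l (s + t) = l s + l t)
  (lN : forall s, l (- s) = - l s)
  (lZ : forall N s, l (N%:R^-1 *: s) = N%:R^-1 * l s)
  (l_le : forall s, normc (l s) <= normc (s 0 k)).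

(** Here [l] is a coordinate or the conjugate of a coordinate. *)
Lemma regular_letter h : regular h -> regular (fun z => l z * h z).
Proof.
have D0 : 0 <= D by rewrite ler0n.
move=> [C C0 [hb hL]]; exists (D * C + C) => [|]; first by rewrite addr_ge0 ?mulr_ge0.
have lb z : box 1 z -> normc (l z) <= D.
  by move=> /(_ k); rewrite mulr1; apply: le_trans.
split=> [z zb|z w e e0 zb wb zw].
  rewrite normcM (@le_trans _ _ (D * C))//; last by rewrite lerDl.
  by rewrite ler_pM ?normc_ge0 ?lb ?hb.
have -> : l z * h z - l w * h w = l z * (h z - h w) + l (z - w) * h w.
  by rewrite lD lN; ring.
rewrite (le_trans (ler_normcD _ _))// !normcM mulrDl lerD//.
  by rewrite -mulrA ler_pM ?normc_ge0 ?lb ?hL.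
rewrite mulrC ler_pM ?normc_ge0 ?hb// (le_trans (l_le _))//.
by rewrite !mxE.
Qed.

Lemma rate_letter h A : regular h -> rate h A ->
  rate (fun z => l z * h z) (fun y => c * \sum_j l (jump j) * A (step j y)).
Proof.
have D0 : 0 <= D by rewrite ler0n.
move=> [C1 C10 [hb hL]] [C2 C20 [N0 hr]].
exists (D * (2 * D * C1 + 2 * C2)).
  by rewrite mulr_ge0// addr_ge0 ?mulr_ge0 ?ler0n.
exists N0.+2 => -[//|N] y; rewrite ltnS => NN0.
have N_gt0 : (0 < N)%N by apply: leq_trans NN0.
have invN n : n.+1%:R^-1 = (n.+1%:R^-1)%:C :> R[i].
  by rewrite (fmorphV (real_complex R)) (rmorph_nat (real_complex R)).
have -> : EN N.+1 (fun s => l (N.+1%:R^-1 *: s) * h (N.+1%:R^-1 *: s)) y =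
    c * \sum_j l (jump j) * EN N (fun s => h (N.+1%:R^-1 *: (s + jump j))) (step j y).
  have := EN_bias N (fun s => h (N.+1%:R^-1 *: s)) y l0 lD.
  rewrite -[X in X = _](mulVKf (_ : N.+1%:R != 0)) ?pnatr_eq0// => /(mulfI _) <-.
    rewrite -[RHS]addr0 -[X in _ = _ + X](mul0r (q y y)) -(EN_mass N.+1 0 y) -EN_lin.
    by congr (EN _ _ _); apply/funext => s; rewrite lZ addr0 mulrA.
  by rewrite pnatr_eq0.
rewrite -mulrBr -sumrB; apply: step_average => j.
rewrite -mulrBr normcM -!mulrA; apply: ler_pM; rewrite ?normc_ge0//.
  rewrite (le_trans (l_le _))// mxE; case: ifP => _; last by rewrite normc_real normr0.
  by rewrite normcM normc_root4 mulr1 normc_real ger0_norm.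
set v := step j y; set Q := complex.Re (q v v).
have Q0 : 0 <= Q := Re_form_ge0 q_psd v.
have h2 := hr N v (ltnW NN0).
have h1 : normc (EN N (fun s => h (N.+1%:R^-1 *: (s + jump j))) v -
    EN N (fun s => h (N%:R^-1 *: s)) v) <= C1 * (2 * D / N.+1%:R) * Q.
  rewrite -[X in normc X]addrC -mulN1r -EN_lin; apply: EN_bound => s sN.
  rewrite mulN1r addrC; apply: hL.
  - by rewrite mulr_ge0 ?mulr_ge0 ?invr_ge0.
  - by apply: box_scale => //; exact: box_jump.
  - exact: box_scale.
  move=> i; rewrite !mxE.
  set a := s 0 i; set b := (if _ then _ else _).
  have ab : normc a <= D * N%:R by exact: sN.
  have bb : normc b <= D.
    rewrite /b; case: ifP => _; last by rewrite normc_real normr0.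
    by rewrite normcM normc_root4 mulr1 normc_real ger0_norm.
  have -> : N.+1%:R^-1 * (a + b) - N%:R^-1 * a =
      (N.+1%:R^-1)%:C * (b - (N%:R^-1)%:C * a).
    rewrite !(fmorphV (real_complex R)) !(rmorph_nat (real_complex R)).
    rewrite -natr1; field.
    by rewrite natr1 !pnatr_eq0 -lt0n N_gt0.
  rewrite normcM normc_real ger0_norm ?invr_ge0// mulrC ler_wpM2r ?invr_ge0//.
  rewrite (le_trans (ler_normcD _ _))// normcN normcM normc_real ger0_norm ?invr_ge0//.
  have : N%:R^-1 * normc a <= D by rewrite mulrC ler_pdivrMr ?ltr0n.
  by move: bb; lra.
have -> : EN N (fun s => h (N.+1%:R^-1 *: (s + jump j))) v - A v =
   (EN N (fun s => h (N.+1%:R^-1 *: (s + jump j))) v -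
    EN N (fun s => h (N%:R^-1 *: s)) v) +
   (EN N (fun s => h (N%:R^-1 *: s)) v - A v) by rewrite subrKA.
rewrite (le_trans (ler_normcD _ _))// (le_trans (lerD h1 h2))// -mulrDl [leRHS]mulrA ler_wpM2r//.
have le2 : N%:R^-1 <= 2 / N.+1%:R :> R.
  rewrite ler_pdivlMr ?ltr0n// mulrC ler_pdivrMr ?ltr0n//.
  have : 1 <= N%:R :> R by rewrite ler1n.
  by rewrite -natr1; lra.
have : C2 / N%:R <= C2 * (2 / N.+1%:R) by rewrite ler_wpM2l.
by move: (N.+1%:R^-1) (C2 / N%:R) => ? ?; lra.
Qed.

End one_letter.

Definition hmon (p r : seq 'I_d) (z : 'rV[R[i]]_d) : R[i] :=
  wmon p (z 0) * Num.conj (wmon r (z 0)).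

(** One letter at a time: size biasing turns a factor [z_k] of the rescaled
    position into an average over one step, up to an error of order [1/N]. *)
Lemma hmon_regular_rate p r :
  regular (hmon p r) /\ rate (hmon p r) (fun y => q (opword S r y) (opword S p y)).
Proof.
have invN N : Num.conj (N%:R^-1 : R[i]) = N%:R^-1.
  by rewrite fmorphV rmorph_nat.
elim: p => [|k p [IHr IHp]].
  elim: r => [|k r [IHr IHp]].
    have -> : hmon [::] [::] = cst 1.
      by apply/funext => z; rewrite /hmon /wmon !big_nil rmorph1 mulr1.
    split.
      exists 1 => //; split=> [z _|z w e e0 _ _ zw]; first by rewrite normc_real normr1.
      by rewrite subrr normc_real normr0 mul1r.
    by exists 0 => //; exists 0%N => N y _; rewrite EN_mass mul1r subrr normc_real normr0 !mul0r.
  have -> : hmon [::] (k :: r) = (fun z => Num.conj (z 0 k) * hmon [::] r z).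
    by apply/funext => z; rewrite /hmon /wmon !big_nil big_cons rmorphM /=; ring.
  have [h1 h2 h3 h4 h5] : [/\ Num.conj ((0 : 'rV[R[i]]_d) 0 k) = 0,
     forall s t, Num.conj ((s + t) 0 k) = Num.conj (s 0 k) + Num.conj (t 0 k),
     forall s, Num.conj ((- s) 0 k) = - Num.conj (s 0 k),
     forall N s, Num.conj ((N%:R^-1 *: s) 0 k) = N%:R^-1 * Num.conj (s 0 k) &
     forall s, normc (Num.conj (s 0 k)) <= normc (s 0 k)].
    split=> [|s t|s|N s|s].
    - by rewrite mxE rmorph0.
    - by rewrite mxE rmorphD.
    - by rewrite mxE rmorphN.
    - by rewrite mxE rmorphM /= invN.
    - by rewrite normcJ.
  split; first exact: (regular_letter h2 h3 h5).
  have := rate_letter h1 h2 h4 h5 IHr IHp; congr rate; apply/funext => y.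
  under eq_bigr do rewrite !step_word.
  by rewrite jump_mean_conj.
have -> : hmon (k :: p) r = (fun z => z 0 k * hmon p r z).
  by apply/funext => z; rewrite /hmon /wmon big_cons mulrA.
have [h1 h2 h3 h4 h5] : [/\ (0 : 'rV[R[i]]_d) 0 k = 0,
   forall s t, (s + t) 0 k = s 0 k + t 0 k,
   forall s, (- s) 0 k = - (s 0 k),
   forall N s, (N%:R^-1 *: s) 0 k = N%:R^-1 * s 0 k &
   forall s, normc (s 0 k) <= normc (s 0 k)].
  by split=> *; rewrite ?mxE.
split; first exact: (regular_letter h2 h3 h5).
have := rate_letter h1 h2 h4 h5 IHr IHp; congr rate; apply/funext => y.
under eq_bigr do rewrite !step_word.
by rewrite jump_mean.
Qed.

Lemma EN_real N (g : 'rV[R[i]]_d -> R) y : complex.Im (EN N (fun s => (g s)%:C) y) = 0.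
Proof.
elim: N g y => [|N IH] g y /=.
  by rewrite [q y y](form_re q_psd) /= mul0r mulr0 addr0.
have ImM (a : R) (w : R[i]) : complex.Im (a%:C * w) = a * complex.Im w.
  by case: w => w1 w2 /=; rewrite mul0r addr0.
rewrite ImM raddf_sum big1 ?mulr0// => j _.
exact: (IH (fun s => g (s + jump j))).
Qed.

Lemma Re_EN N h y : complex.Re (EN N h y) = complex.Re (EN N (fun s => (complex.Re (h s))%:C) y).
Proof.
rewrite (_ : h = (fun s => 'i%C * (complex.Im (h s))%:C + (complex.Re (h s))%:C)).
  rewrite EN_lin raddfD /=; have := EN_real N (fun s => complex.Im (h s)) y.
  case: (EN N _ y) => a b /= ->; rewrite mul0r mulr0 subrr add0r.
  by congr (complex.Re (EN N _ y)); apply/funext => s /=; simpc.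
by apply/funext => s; rewrite [LHS]complexE addrC.
Qed.

Lemma Im_EN N h y : complex.Im (EN N h y) = complex.Re (EN N (fun s => (complex.Im (h s))%:C) y).
Proof.
rewrite {1}(_ : h = (fun s => 'i%C * (complex.Im (h s))%:C + (complex.Re (h s))%:C)).
  rewrite EN_lin raddfD /= (EN_real N (fun s => complex.Re (h s))) addr0.
  by case: (EN N _ y) => a b /=; rewrite mul0r mul1r add0r.
by apply/funext => s; rewrite [LHS]complexE addrC.
Qed.

End spherical_walk.

(** * A positive functional *)

Lemma cvgn_Im (R : realType) (u : nat -> R[i]) (l : R[i]) : u @ \oo --> l ->
  (fun n => complex.Im (u n)) @ \oo --> complex.Im l.
Proof.
move=> /cvgrPdist_lt h; apply/cvgrPdist_lt => e e0.
have e0' : (0 : R[i]) < e%:C by rewrite ltr0c.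
near=> n; rewrite -raddfB (le_lt_trans (Im_le_normc _))// -ltcR -normcE.
by near: n; exact: h.
Unshelve. all: by end_near. Qed.

(** A segment is compact. *)
Lemma ultra_cvg (R : realType) (U : set_system nat) (u : nat -> R) (B : R) :
  UltraFilter U -> U [set n | `|u n| <= B] -> cvg (u @ U).
Proof.
move=> UU uB.
have UuU : UltraFilter (u @ U).
  split=> [|G GP sub]; first exact: fmap_proper_filter.
  apply/seteqP; split=> [A GA|A]; last exact: sub.
  have [//|nA] := in_ultra_setVsetC (u @^-1` A) UU.
  have GnA : G (~` A) by apply: sub.
  by have [x [Ax nAx]] := @filter_ex _ G GP _ (filterI GA GnA).
have := @segment_compact R (- B) B; rewrite compact_ultra => /(_ _ UuU).
case=> [|p [_ cp]]; last by apply/cvg_ex; exists p.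
apply: (@filterS _ U _ _ (u @^-1` `[- B, B]) _ uB) => n /= nB.
by rewrite in_itv /= -ler_norml.
Qed.

Lemma cvg_divn (R : realType) (C : R) : (fun n : nat => C / n%:R) @ \oo --> (0 : R).
Proof.
rewrite -[X in _ --> X](mulr0 C); apply: cvgM; first exact: cvg_cst.
by rewrite -cvg_shiftS; exact: cvg_harmonic.
Qed.

Definition bounded_on {R : realType} {T : Type} (X : set T) (f : T -> R) : Prop :=
  exists B, forall z, X z -> `|f z| <= B.

(** A positive functional on all the functions that are bounded on the polydisc
    of radius [d + 1], with the moments prescribed by the form: a limit, along an
    ultrafilter, of the laws of the rescaled walk. *)
Lemma walk_functional (R : realType) (d : nat) (H : hilbertSpace R)
    (q : H -> H -> R[i]) (S : 'I_d -> H -> H) (y : H) :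
  psd_form q -> (forall k, linear (S k)) ->
  (forall j k x, S j (S k x) = S k (S j x)) ->
  (forall x z, \sum_(k < d) q (S k x) (S k z) = q x z) ->
  exists L : ('rV[R[i]]_d -> R) -> R,
  [/\ forall a f g, bounded_on (box 1) f -> bounded_on (box 1) g ->
        L (fun z => a * f z + g z) = a * L f + L g,
      forall f, bounded_on (box 1) f -> (forall z, box 1 z -> 0 <= f z) -> 0 <= L f,
      forall p r, L (fun z => complex.Re (hmon p r z)) =
                  complex.Re (q (opword S r y) (opword S p y))
    & forall p r, L (fun z => complex.Im (hmon p r z)) =
                  complex.Im (q (opword S r y) (opword S p y))].
Proof.
move=> q_psd S_lin S_comm q_inv.
have [U [UU subU]] := ultraFilterLemma (_ : ProperFilter \oo).
set Q := complex.Re (q y y).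
have Q0 : 0 <= Q := Re_form_ge0 q_psd y.
pose LN (g : 'rV[R[i]]_d -> R) N :=
  complex.Re (EN q S N (fun s => (g (N%:R^-1 *: s))%:C) y).
have U1 : U [set n | (0 < n)%N] by apply: subU; exists 1%N.
have LN_cvg g : bounded_on (box 1) g -> cvg (LN g @ U).
  move=> [B gB]; apply: (@ultra_cvg _ _ _ (B * Q)).
  apply: filterS U1 => N /= N0; rewrite (le_trans (Re_le_normc _))//.
  apply: (EN_bound q_psd q_inv) => s sN; rewrite normc_real; apply: gB.
  exact: box_scale.
have LN_lim (g : 'rV[R[i]]_d -> R) l : LN g @ \oo --> l -> lim (LN g @ U) = l.
  move=> cv; apply/cvg_lim => //.
  by apply: cvg_trans cv => A; exact: subU.
have rate_cvg p r : (fun N => normc (EN q S N (fun s => hmon p r (N%:R^-1 *: s)) y -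
    q (opword S r y) (opword S p y))) @ \oo --> (0 : R).
  have [_ [C C0 [N0 hr]]] := hmon_regular_rate q_psd S_lin S_comm q_inv p r.
  apply: (@squeeze_cvgr _ _ _ _ (cst 0) (fun N => C / N%:R * Q)).
  - near=> N; rewrite normc_ge0/=; apply: hr.
    by near: N; exists N0.
  - exact: cvg_cst.
  - rewrite -[X in _ --> X](mul0r Q); apply: cvgM; last exact: cvg_cst.
    exact: cvg_divn.
exists (fun g => lim (LN g @ U)); split.
- move=> a f g bf bg; apply/cvg_lim => //.
  rewrite (_ : LN _ = (fun N => a * LN f N + LN g N)).
    apply: cvgD; last exact: LN_cvg.
    by apply: cvgM; [exact: cvg_cst|exact: LN_cvg].
  apply/funext => N; rewrite /LN.
  rewrite (_ : (fun s => _) = (fun s => a%:C * (f (N%:R^-1 *: s))%:C + (g (N%:R^-1 *: s))%:C)).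
    by rewrite EN_lin raddfD /=; congr (_ + _); case: (EN _ _ _ _ _) => b c /=; rewrite mul0r subr0.
  by apply/funext => s; rewrite rmorphD rmorphM.
- move=> f bf f0; apply: limr_ge; first exact: LN_cvg.
  apply: filterS U1 => N /= N0; rewrite /LN.
  suff : 0 <= EN q S N (fun s => (f (N%:R^-1 *: s))%:C) y by rewrite lecE => /andP[].
  by apply: EN_ge0 => // s sN; rewrite ler0c; apply: f0; exact: box_scale.
- move=> p r; apply: LN_lim.
  have := cvgn_Re (cvgn_normc (@rate_cvg p r)).
  by under eq_fun do rewrite (Re_EN S q_psd).
- move=> p r; apply: LN_lim.
  have := cvgn_Im (cvgn_normc (@rate_cvg p r)).
  by under eq_fun do rewrite (Im_EN S q_psd).
Unshelve. all: by end_near. Qed.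

(** * Unrolling a finitely additive mass on the line *)

(** A finitely additive mass on a set can be unrolled on the line: [[l, l + m W[]
    is cut into an interval for [W `&` A] followed by one for [W `\` A], and so
    on along a list of sets.  [cell s l W t] is the atom of the partition
    generated by [s] in which the point of abscissa [t] falls. *)
Section unrolling.
Context {R : realType} {X : Type} {I : eqType}.
Variables (Bx : set X) (L : (X -> R) -> R) (A : I -> set X).
Hypothesis L_lin : forall a f g, bounded_on Bx f -> bounded_on Bx g ->
  L (fun z => a * f z + g z) = a * L f + L g.
Hypothesis L_ge0 : forall f, bounded_on Bx f -> (forall z, Bx z -> 0 <= f z) -> 0 <= L f.
Implicit Types (f g : X -> R) (W : set X) (s : seq I).

Lemma bounded_on_lin a f g : bounded_on Bx f -> bounded_on Bx g ->
  bounded_on Bx (fun z => a * f z + g z).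
Proof.
move=> [B hB] [C hC]; exists (`|a| * B + C) => z zB.
by rewrite (le_trans (ler_normD _ _))// normrM lerD ?ler_wpM2l ?hB ?hC.
Qed.

Lemma bounded_on_cst (c : R) : bounded_on Bx ((fun=> c) : X -> R).
Proof. by exists `|c|. Qed.

Lemma bounded_on_cut f W : bounded_on Bx f -> bounded_on Bx (fun z => f z * \1_W z).
Proof.
move=> [B hB]; exists B => z zB; rewrite indicE.
case: (z \in W); rewrite ?mulr1 ?mulr0 ?hB// normr0.
by rewrite (le_trans _ (hB z zB)).
Qed.

Lemma L_le f g : bounded_on Bx f -> bounded_on Bx g ->
  (forall z, Bx z -> f z <= g z) -> L f <= L g.
Proof.
move=> bf bg fg; rewrite -subr_ge0 addrC -mulN1r -L_lin//; apply: L_ge0.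
  exact: bounded_on_lin.
by move=> z zB; rewrite mulN1r addrC subr_ge0 fg.
Qed.

Lemma L_scale a f : bounded_on Bx f -> L (fun z => a * f z) = a * L f.
Proof.
move=> bf; have b0 : bounded_on Bx ((fun=> 0) : X -> R) by exact: bounded_on_cst.
have L0 : L (fun=> 0) = 0.
  have := L_lin (-1) b0 b0; rewrite (_ : (fun z => _) = (fun=> 0)).
    by move=> h; lra.
  by apply/funext => z; rewrite mulr0 addr0.
rewrite -[RHS]addr0 -[X in _ + X]L0 -L_lin//; congr L; apply/funext => z.
by rewrite addr0.
Qed.

Definition mass W : R := L (\1_W : X -> R).

Lemma bounded_on_indic W : bounded_on Bx (\1_W : X -> R).
Proof.
have := bounded_on_cut W (bounded_on_cst 1); congr (bounded_on _ _).
by apply/funext => z; rewrite mul1r.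
Qed.

Lemma mass_ge0 W : 0 <= mass W.
Proof. by apply: L_ge0 => [|z _]; [exact: bounded_on_indic|rewrite indicE]. Qed.

Lemma cut_split g W V : bounded_on Bx g -> L (fun z => g z * \1_W z) =
  L (fun z => g z * \1_(W `&` V) z) + L (fun z => g z * \1_(W `\` V) z).
Proof.
move=> bg; rewrite -[X in _ = X + _]mul1r -L_lin; try exact: bounded_on_cut.
congr L; apply/funext => z; rewrite !indicE mul1r -mulrDr; congr (_ * _).
rewrite in_setD in_setI.
by case: (z \in W); case: (z \in V) => /=; rewrite ?addr0 ?add0r.
Qed.

Lemma mass_split W V : mass W = mass (W `&` V) + mass (W `\` V).
Proof.
have h U : mass U = L (fun z => (fun=> 1) z * \1_U z).
  by congr L; apply/funext => z; rewrite mul1r.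
by rewrite !h (cut_split _ V) //; exact: bounded_on_cst.
Qed.

Fixpoint cell s (l : R) W (t : R) : set X :=
  if s is i :: s' then
    if t < l + mass (W `&` A i) then cell s' l (W `&` A i) t
    else cell s' (l + mass (W `&` A i)) (W `\` A i) t
  else W.

Lemma cell_sub s l W t : cell s l W t `<=` W.
Proof.
elim: s l W => [|i s IH] l W //=.
by case: ifP => _ x /IH [].
Qed.

Lemma cell_cat s s' l W t : cell (s ++ s') l W t `<=` cell s l W t.
Proof.
elim: s l W => [|i s IH] l W /=; first exact: cell_sub.
by case: ifP => _; exact: IH.
Qed.

Lemma cell_separated s l W t i x y : i \in s ->
  cell s l W t x -> cell s l W t y -> A i x -> A i y.
Proof.
elim: s l W => [//|j s IH] l W; rewrite inE /=; case: eqVneq => [<- _|_ /=]; last first.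
  by move=> i_s; case: ifP => _; exact: IH.
by case: ifP => _ /cell_sub[_ h] /cell_sub[_ h'] // /h.
Qed.

Lemma cell_mass s l W t : l <= t < l + mass W -> 0 < mass (cell s l W t).
Proof.
elim: s l W => [|i s IH] l W /=.
  by move=> /andP[lt tl]; have := le_lt_trans lt tl; rewrite ltrDl.
move=> /andP[lt tl]; case: ifPn => h; apply: IH; first by rewrite lt.
by rewrite leNgt h /= -addrA -mass_split.
Qed.

Lemma measurable_cell s l W (P : set X -> Prop) :
  measurable ([set t | P (cell s l W t)] : set R).
Proof.
elim: s l W => [|i s IH] l W /=.
  have [PW|nPW] := pselect (P W).
    by rewrite (_ : [set _ | _] = setT)//; apply/seteqP; split.
  by rewrite (_ : [set _ | _] = set0)//; apply/seteqP; split.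
set a := l + _.
rewrite (_ : [set _ | _] = (`]-oo, a[ `&` [set t | P (cell s l (W `&` A i) t)]) `|`
  (`[a, +oo[ `&` [set t | P (cell s a (W `\` A i) t)])).
  by apply: measurableU; apply: measurableI.
apply/seteqP; split=> t /=; rewrite !in_itv /= ?andbT.
  by case: ltP => h; [left|right].
by case: ltP => h [[]|[]].
Qed.

Let mu := @lebesgue_measure R.

(** Integrating a function on the line that is close, on each interval, to the
    values of [g] on the matching cell computes [L g] up to that error. *)
Lemma integral_cell s l W g (F : R -> R) (e : R) :
  bounded_on Bx g -> W `<=` Bx -> measurable_fun [set: R] F -> (forall t, 0 <= F t) ->
  (forall t x, l <= t < l + mass W -> cell s l W t x -> `|F t - g x| <= e) ->
  ((L (fun z => g z * \1_W z) - e * mass W)%R%:E <=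
     \int[mu]_(t in `[l, (l + mass W)%R[) (F t)%:E <=
   (L (fun z => g z * \1_W z) + e * mass W)%R%:E)%E.
Proof.
move=> bg; have bc V := bounded_on_cut V bg; have bi V := bounded_on_indic V.
elim: s l W => [|i s IH] l W WB mF F0 close /=.
  (* On an interval whose cell is [W], all values of [F] are within [e] of the
     mean of [g] over [W]. *)
  have mW0 := mass_ge0 W; have [mW|mW] := eqVneq (mass W) 0.
    rewrite mW addr0 set_itvco0 integral_set0 mulr0 subr0 addr0.
    suff -> : L (fun z => g z * \1_W z) = 0 by rewrite lexx.
    have [B hB] := bg.
    have up : L (fun z => g z * \1_W z) <= L (fun z => B * \1_W z).
      apply: L_le => //; first exact: (bounded_on_cut W (bounded_on_cst B)).
      by move=> z zB; rewrite ler_wpM2r ?indicE// (le_trans (ler_norm _))// hB.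
    have lo : L (fun z => (- B) * \1_W z) <= L (fun z => g z * \1_W z).
      apply: L_le => //; first exact: (bounded_on_cut W (bounded_on_cst (- B))).
      by move=> z zB; rewrite ler_wpM2r ?indicE// lerNl (le_trans (ler_norm _))// normrN hB.
    move: up lo; rewrite !L_scale// -/(mass W) mW !mulr0 => up lo.
    by apply/eqP; rewrite eq_le up lo.
  have mW_gt0 : 0 < mass W by rewrite lt_neqAle eq_sym mW.
  pose c := L (fun z => g z * \1_W z) / mass W.
  have Lc : L (fun z => g z * \1_W z) = c * mass W by rewrite /c divfK.
  have bounds t : l <= t < l + mass W -> c - e <= F t <= c + e.
    move=> lt; have hx x : W x -> `|F t - g x| <= e by exact: close.
    have up : L (fun z => g z * \1_W z) <= L (fun z => (F t + e) * \1_W z).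
      apply: L_le => //; first exact: (bounded_on_cut W (bounded_on_cst _)).
      move=> z zB; rewrite indicE; case: (boolP (z \in W)); rewrite ?mulr1 ?mulr0// inE => Wz.
      by have := hx z Wz; rewrite distrC ler_norml => /andP[]; lra.
    have lo : L (fun z => (F t - e) * \1_W z) <= L (fun z => g z * \1_W z).
      apply: L_le => //; first exact: (bounded_on_cut W (bounded_on_cst _)).
      move=> z zB; rewrite indicE; case: (boolP (z \in W)); rewrite ?mulr1 ?mulr0// inE => Wz.
      by have := hx z Wz; rewrite ler_norml => /andP[]; lra.
    move: up lo; rewrite !L_scale// -/(mass W) Lc !ler_pM2r// => up lo.
    by apply/andP; split; lra.
  have lenE : mu `[l, l + mass W[ = (mass W)%:E.
    by rewrite /mu lebesgue_measure_itv /= lte_fin ltrDl mW_gt0 -EFinD addrAC subrr add0r.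
  have cstE (k : R) : (\int[mu]_(t in `[l, (l + mass W)%R[) k%:E = (k * mass W)%R%:E)%E.
    transitivity (k%:E * mu `[l, (l + mass W)%R[)%E; last by rewrite lenE.
    exact: (@integral_cst _ _ _ mu `[l, (l + mass W)%R[ _ k%:E).
  have mFi : measurable_fun (`[l, l + mass W[ : set R) (EFin \o F).
    by apply/measurable_EFinP; exact: measurable_funTS.
  rewrite Lc -mulrBl -mulrDl; apply/andP; split.
    rewrite (@le_trans _ _ (\int[mu]_(t in `[l, (l + mass W)%R[) (Num.max 0 (c - e))%R%:E)%E)//.
      by rewrite cstE lee_fin ler_wpM2r// le_max lexx orbT.
    apply: ge0_le_integral => //.
    - by move=> t _; rewrite lee_fin le_max lexx.
    - move=> t; rewrite /= in_itv /= => /bounds/andP[h _].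
      by rewrite lee_fin ge_max F0.
  rewrite -cstE; apply: ge0_le_integral => // t; rewrite /= in_itv /= => /bounds/andP[_ h];
    rewrite lee_fin//; exact: le_trans h.
set a := l + mass (W `&` A i).
have laW : l + mass W = a + mass (W `\` A i) by rewrite /a -addrA -mass_split.
have la : l <= a by rewrite lerDl mass_ge0.
have aW : a <= a + mass (W `\` A i) by rewrite lerDl mass_ge0.
have -> : `[l, l + mass W[%classic = `[l, a[ `|` `[a, a + mass (W `\` A i)[ :> set R.
  by rewrite laW -itv_bndbnd_setU// bnd_simp.
rewrite ge0_integral_setU//=; last first.
- apply/disj_setPS => t /= [] /=; rewrite !in_itv /= => /andP[_ ta] /andP[at_ _].
  by have := lt_le_trans ta at_; rewrite ltxx.
- by move=> t _; rewrite lee_fin.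
- by apply/measurable_EFinP; exact: measurable_funTS.
have WA : W `&` A i `<=` Bx by move=> x [/WB].
have WnA : W `\` A i `<=` Bx by move=> x [/WB].
have /andP[lo1 up1] : ((L (fun z => g z * \1_(W `&` A i) z) - e * mass (W `&` A i))%R%:E <=
     \int[mu]_(t in `[l, a[) (F t)%:E <=
   (L (fun z => g z * \1_(W `&` A i) z) + e * mass (W `&` A i))%R%:E)%E.
  apply: IH => // t x /andP[lt ta] tx; apply: close; first by rewrite lt laW (lt_le_trans ta).
  by rewrite /= ta.
have /andP[lo2 up2] : ((L (fun z => g z * \1_(W `\` A i) z) - e * mass (W `\` A i))%R%:E <=
     \int[mu]_(t in `[a, (a + mass (W `\` A i))%R[) (F t)%:E <=
   (L (fun z => g z * \1_(W `\` A i) z) + e * mass (W `\` A i))%R%:E)%E.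
  apply: IH => // t x /andP[at_ ta] tx; apply: close; first by rewrite (le_trans la at_) laW.
  by rewrite /= ltNge at_.
rewrite (cut_split _ (A i) bg) (mass_split W (A i)).
apply/andP; split.
  rewrite (le_trans _ (leeD lo1 lo2))// -EFinD lee_fin; lra.
by rewrite (le_trans (leeD up1 up2))// -EFinD lee_fin; lra.
Qed.

End unrolling.

(** * The image of Lebesgue measure *)

Section law.
Context {R : realType} d (T : measurableType d).
Variables (theta : R -> T) (M : R).
Hypothesis m_theta : measurable_fun [set: R] theta.

Let mu := @lebesgue_measure R.
Let J : set R := `[0, M[%classic.

(** The image under [theta] of Lebesgue measure on [[0, M[]. *)
Definition law (E : set T) : \bar R := mu (J `&` theta @^-1` E).

Let mJ0 : measurable J.
Proof. exact: measurable_itv. Qed.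

Let mJ E : measurable E -> measurable (J `&` theta @^-1` E).
Proof.
move=> mE; apply: measurableI; first exact: mJ0.
by have := m_theta measurableT mE; rewrite setTI.
Qed.

Let law0 : law set0 = 0%E.
Proof. by rewrite /law preimage_set0 setI0; exact: measure0. Qed.

Let law_ge0 E : (0 <= law E)%E.
Proof. exact: measure_ge0. Qed.

Let law_sigma_additive : semi_sigma_additive law.
Proof.
move=> F mF tF mUF; rewrite /law preimage_bigcup setI_bigcupr.
apply: measure_semi_sigma_additive.
- by move=> n; exact: mJ.
- apply/trivIsetP => i j _ _ ij; rewrite setIACA setIid -preimage_setI.
  by move/trivIsetP : tF => /(_ _ _ _ _ ij) ->//; rewrite preimage_set0 setI0.
- by rewrite -setI_bigcupr -preimage_bigcup; exact: mJ.
Qed.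

HB.instance Definition _ := isMeasure.Build _ _ _ law law0 law_ge0 law_sigma_additive.

Let law_fin : fin_num_fun law.
Proof.
move=> E mE; rewrite ge0_fin_numE// (@le_lt_trans _ _ (mu J))//.
  by rewrite /law le_measure ?inE//; exact: mJ.
by rewrite /mu lebesgue_measure_itv /=; case: ifP => _; rewrite ?ltry// -EFinD ltry.
Qed.

HB.instance Definition _ := Measure_isFinite.Build _ _ _ law law_fin.

Lemma law_exists : exists nu : {finite_measure set T -> \bar R},
  (forall E, nu E = mu (J `&` theta @^-1` E)) /\
  forall g : T -> \bar R, measurable_fun setT g -> (forall z, (0 <= g z)%E) ->
    (\int[nu]_z g z = \int[mu]_(t in J) g (theta t))%E.
Proof.
exists law; split=> // g mg g0.
pose lam := mrestr mu mJ0.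
transitivity (\int[pushforward lam theta]_z g z)%E.
  by apply: eq_measure_integral => E mE _; rewrite -[LHS]/(mu (J `&` theta @^-1` E)) setIC.
rewrite ge0_integral_pushforward// preimage_setT -(setvU J) ge0_integral_setU//=; last 3 first.
- exact: (measurableC mJ0).
- rewrite setvU; exact: measurableT_comp.
- by apply/disj_setPS => t [].
rewrite [X in (X + _)%E](_ : _ = 0)%E ?add0e; last first.
  rewrite (eq_measure_integral mzero) ?integral_measure_zero// => E mE EJ.
  transitivity (mu (E `&` J)); first by [].
  rewrite (_ : E `&` J = set0); first exact: measure0.
  by apply/seteqP; split => t // [/EJ].
apply: eq_measure_integral => E mE EJ.
exact: (congr1 mu (setIidl EJ)).
Qed.

End law.

(** * Points of cells *)

(** Half-spaces given by the real or imaginary part of one coordinate cut the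
    polydisc into cells of small diameter. *)
Section points_of_cells.
Context {R : realType} {d : nat}.
Local Notation X := 'rV[R[i]]_d.
Local Notation Bx := (@box R d 1).
Variable L : (X -> R) -> R.
Hypothesis L_lin : forall a f g, bounded_on Bx f -> bounded_on Bx g ->
  L (fun z => a * f z + g z) = a * L f + L g.

Definition repart (b : bool) (c : R[i]) : R := if b then complex.Re c else complex.Im c.

Definition halfspace (i : 'I_d * bool * R) : set X :=
  [set z | repart i.1.2 (z 0 i.1.1) < i.2].

(** The thresholds have mesh [1/(n+1)] and cover [[- (d+1), d+1]], the range of
    the parts of the coordinates on the polydisc. *)
Definition level n : seq ('I_d * bool * R) :=
  [seq (kb, - d.+1%:R + j%:R / n.+1%:R) |
     kb <- enum {: 'I_d * bool}, j <- iota 0 (d.+1 * n.+1 + d.+1 * n.+1).+2].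

Fixpoint levels n := if n is m.+1 then levels m ++ level n else level 0.

Definition atom n (t : R) : set X := cell L halfspace (levels n) 0 Bx t.

Lemma atom_anti m n t : (m <= n)%N -> atom n t `<=` atom m t.
Proof.
move=> mn; rewrite -(subnKC mn); elim: (n - m)%N => [|p IH]; rewrite ?addn0//.
by rewrite addnS; apply: subset_trans IH; exact: cell_cat.
Qed.

Lemma normr_repart b c : `|repart b c| <= normc c.
Proof. by case: b; rewrite /= ?Re_le_normc ?Im_le_normc. Qed.

(** Some threshold separates two values that differ by more than the mesh. *)
Lemma atom_repart n t x y k b : atom n t x -> atom n t y ->
  repart b (y 0 k) - repart b (x 0 k) <= n.+1%:R^-1.
Proof.
move=> xK yK; set a := repart b (x 0 k).
have xB : Bx x := cell_sub xK.
have n0 : 0 < n.+1%:R :> R by rewrite ltr0n.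
have /andP[aD Da] : - d.+1%:R <= a <= d.+1%:R.
  rewrite -ler_norml (le_trans (normr_repart _ _))//.
  by have := xB k; rewrite mulr1.
pose u := (a + d.+1%:R) * n.+1%:R; pose j := (Num.truncn u).+1.
have u0 : 0 <= u by rewrite mulr_ge0 ?ler0n// -[X in _ <= _ + X]opprK subr_ge0.
have /andP[ju uj] := truncn_itv u0.
have jl : (j < (d.+1 * n.+1 + d.+1 * n.+1).+2)%N.
  rewrite ltnS /j ltnS -(ler_nat R) (le_trans ju)// /u natrD !natrM -mulrDl ler_wpM2r ?ler0n//.
  by rewrite lerD2r.
have js : (k, b, - d.+1%:R + j%:R / n.+1%:R) \in levels n.
  have js : (k, b, - d.+1%:R + j%:R / n.+1%:R) \in level n.
    by apply/allpairsP; exists ((k, b), j); rewrite mem_enum mem_iota.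
  by case: n @u @j xK yK n0 {u0 ju uj jl} js => [//|n] u j *; rewrite mem_cat; apply/orP; right.
have xA : halfspace (k, b, - d.+1%:R + j%:R / n.+1%:R) x.
  rewrite /halfspace /= -/a addrC -ltrBlDr opprK ltr_pdivlMr//.
have := cell_separated js xK yK xA; rewrite /halfspace /= => yj.
have vN : (Num.truncn u)%:R / n.+1%:R <= a + d.+1%:R by rewrite ler_pdivrMr.
have jE : j%:R / n.+1%:R = (Num.truncn u)%:R / n.+1%:R + n.+1%:R^-1 :> R.
  by rewrite /j; move: (n.+1%:R^-1) => c; rewrite -natr1 mulrDl mul1r.
move: yj vN; rewrite jE; set v := _%:R / _; set c : R := _^-1; move: v c => v c; lra.
Qed.

Let M := mass L Bx.

Lemma atom_neq0 n t : 0 <= t < M -> atom n t !=set0.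
Proof.
move=> tM; have /set0P : atom n t != set0; last by [].
apply/negP => /eqP K0; have := @cell_mass _ _ _ Bx L halfspace L_lin (levels n) 0 Bx t.
rewrite add0r => /(_ tM); rewrite -/(atom n t) K0
  (_ : mass L set0 = 0) ?ltxx//.
have := mass_split L_lin set0 set0.
by rewrite set0I set0D; lra.
Qed.

(** The intervals of half-length [1/(n+1)] about the values on the nested cells
    meet pairwise; the supremum of their lower ends lies in all of them. *)
Lemma atom_point_repart t k b : 0 <= t < M ->
  exists a, forall n x, atom n t x -> `|a - repart b (x 0 k)| <= n.+1%:R^-1.
Proof.
move=> tM; pose x n := xget 0 (atom n t).
have xK n : atom n t (x n) by apply: xgetPex; exact: atom_neq0.
pose r n (y : X) := repart b (y 0 k) - n.+1%:R^-1.
have up m n (y z : X) : atom m t y -> atom n t z -> r m y <= repart b (z 0 k) + n.+1%:R^-1.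
  move=> yK zK; pose p := maxn m n.
  have h1 := atom_repart k b (atom_anti (leq_maxl m n) (xK p)) yK.
  have h2 := atom_repart k b zK (atom_anti (leq_maxr m n) (xK p)).
  rewrite /r; move: (m.+1%:R^-1 : R) (n.+1%:R^-1 : R) h1 h2 => a c; lra.
pose E : set R := [set a | exists n y, atom n t y /\ a = r n y].
have E0 : E (r 0 (x 0)) by exists 0, (x 0).
have Eub n z : atom n t z -> ubound E (repart b (z 0 k) + n.+1%:R^-1).
  by move=> zK _ [m [y [yK ->]]]; exact: up.
exists (sup E) => n z zK; rewrite ler_distl; apply/andP; split.
  by apply: ub_le_sup; [exists (repart b (z 0 k) + n.+1%:R^-1); exact: Eub|exists n, z].
by apply: ge_sup; [exists (r 0 (x 0))|exact: Eub].
Qed.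

Definition near_point n (z x : X) := forall k, normc (z 0 k - x 0 k) <= 2 / n.+1%:R.

Lemma atom_point t : 0 <= t < M ->
  exists z : X, forall n x, atom n t x -> near_point n z x.
Proof.
move=> tM.
have /choice[re reP] k := atom_point_repart k true tM.
have /choice[im imP] k := atom_point_repart k false tM.
exists (\row_k Complex (re k) (im k)) => n x xK k; rewrite mxE.
rewrite (le_trans (normc_le_ReIm _))// mulr2n mulrDl mul1r lerD//.
  by have := reP k n x xK; rewrite /repart; case: (x 0 k).
by have := imP k n x xK; rewrite /repart; case: (x 0 k).
Qed.

(** The point to which the cells containing a given abscissa shrink. *)
Definition theta (t : R) : X :=
  if 0 <= t < M then xget 0 [set z | forall n x, atom n t x -> near_point n z x] else 0.

Lemma thetaP t n x : 0 <= t < M -> atom n t x -> near_point n (theta t) x.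
Proof.
move=> tM; rewrite /theta tM => xK.
have /xgetPex : [set z | forall n x, atom n t x -> near_point n z x] !=set0.
  exact: atom_point.
exact.
Qed.

Lemma le_harmonic (a b c : R) : (forall n : nat, a <= b + c / n.+1%:R) -> a <= b.
Proof.
move=> h; have : (fun n : nat => b + c / n.+1%:R) @ \oo --> b.
  rewrite -[X in _ --> X]addr0; apply: cvgD; first exact: cvg_cst.
  rewrite -[X in _ --> X](mulr0 c); apply: cvgM; first exact: cvg_cst.
  exact: cvg_harmonic.
by move=> hc; apply: (cvgr_to_ge hc); apply: nearW.
Qed.

Lemma theta_box t : Bx (theta t).
Proof.
move=> k; rewrite mulr1; case: (boolP (0 <= t < M)) => tM; last first.
  by rewrite /theta (negbTE tM) mxE -lecR -normcE normr0 ler0c.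
apply: (@le_harmonic _ _ 2) => n; have [x xK] := atom_neq0 n tM.
have xB : Bx x := cell_sub xK.
rewrite -[X in normc X](subrK (x 0 k)) (le_trans (ler_normcD _ _))// addrC lerD//.
  by have := xB k; rewrite mulr1.
exact: thetaP.
Qed.

Lemma open_polydisc (U : set X) (z : X) : open U -> U z ->
  exists2 r : R, 0 < r & forall w : X, (forall k, normc (w 0 k - z 0 k) < r) -> U w.
Proof.
move=> oU Uz; have /nbhs_ballP[e /= e0 eU] : nbhs z U by exact: open_nbhs_nbhs.
move: e0; case: e eU => r i eU; rewrite ltcE /= => /andP[/eqP i0 r0].
exists r => // w wz; apply: eU; split=> [|j k]; first by rewrite ltcE /= i0 eqxx.
rewrite ord1 /ball /= distrC normcE ltcE /=.
by rewrite i0 eqxx wz.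
Qed.

(** The preimage of an open set is the countable union, over the levels, of the
    set of abscissas whose cell has its neighbourhood inside the open set. *)
Lemma measurable_theta : measurable_fun [set: R] (theta : R -> borelC R d).
Proof.
apply: (@measurability _ _ _ (borelC R d) _ _ (@open X)); first by [].
move=> _ [U oU <-]; rewrite setTI.
pose P n (K : set X) := forall z x, K x -> near_point n z x -> U z.
rewrite (_ : theta @^-1` U =
  (`[0, M[ `&` \bigcup_n [set t | P n (atom n t)]) `|`
  (~` `[0, M[ `&` [set t | U 0])).
  apply: measurableU; apply: measurableI => //.
  - by apply: bigcup_measurable => n _; exact: measurable_cell.
  - by apply: measurableC.
  - have [U0|nU0] := pselect (U 0).
      by rewrite (_ : [set _ | _] = setT)//; apply/seteqP; split.
    by rewrite (_ : [set _ | _] = set0)//; apply/seteqP; split.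
apply/seteqP; split=> t /=; rewrite in_itv /=.
  move=> Ut; case: (boolP (0 <= t < M)) => tM; last first.
    by right; split=> //; move: Ut; rewrite /theta (negbTE tM).
  left; split=> //; have [r r0 rU] := open_polydisc oU Ut.
  have [n _ nr] := near_infty_natSinv_lt (PosNum (divr_gt0 r0 (ltr0n R 4 : 0 < 4%:R))).
  have {nr} := nr n (leqnn n); rewrite /= ltr_pdivlMr// => nr.
  exists n => // z x xK zx; apply: rU => k.
  rewrite -(subrKA (x 0 k)) (le_lt_trans (ler_normcD _ _))//.
  rewrite -(normcN (x 0 k - _)) opprB (le_lt_trans (lerD (zx k) (thetaP tM xK k)))//.
  by apply: le_lt_trans nr; rewrite -mulrDl mulrC ler_wpM2l// -natrD.
case=> [[tM [n _ Pn]]|[/negP tM]]; last by rewrite /theta (negbTE tM).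
have [x xK] := atom_neq0 n tM; apply: (Pn _ x) => //.
exact: thetaP.
Qed.

End points_of_cells.

(** * From functionals to measures *)

Section borel_functions.
Context {R : realType} {d : nat}.
Local Notation X := 'rV[R[i]]_d.

Lemma continuous_borel (g : X -> R) : continuous g ->
  measurable_fun [set: borelC R d] (g : borelC R d -> R).
Proof.
move=> /continuousP cg; apply: (measurability _ (RGenOpens.measurableE R)).
move=> _ [_ [a [b ->]] <-]; rewrite setTI.
by apply: sub_sigma_algebra; apply: cg; exact: interval_open.
Qed.

Lemma open_borel (U : set X) : open U -> measurable (U : set (borelC R d)).
Proof. by move=> oU; exact: sub_sigma_algebra. Qed.

Lemma closed_borel (K : set X) : closed K -> measurable (K : set (borelC R d)).
Proof.
move=> cK; rewrite -[K]setCK; apply: measurableC.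
by apply: open_borel; exact: closed_openC.
Qed.

Lemma lipschitz1_continuous (f : R[i] -> R) :
  (forall x y, `|f x - f y| <= normc (x - y)) -> continuous f.
Proof.
move=> fL c; have FF := nbhs_filter c; apply/cvgrPdist_lt => e e0.
have e0' : (0 : R[i]) < e%:C by rewrite ltr0c.
apply/nbhs_ballP; exists e%:C => // x; rewrite /ball /= normcE ltcR.
exact: le_lt_trans.
Qed.

Lemma normc_continuous : continuous (fun c : R[i] => normc c).
Proof.
apply: lipschitz1_continuous => x y.
have h1 := ler_normcD (x - y) y; have h2 := ler_normcD (y - x) x.
by move: h1 h2; rewrite !subrK -(normcN (y - x)) opprB ler_norml => h1 h2; apply/andP; split; lra.
Qed.

Lemma Re_continuous : continuous (fun c : R[i] => complex.Re c).
Proof. by apply: lipschitz1_continuous => x y; rewrite -raddfB Re_le_normc. Qed.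

Lemma Im_continuous : continuous (fun c : R[i] => complex.Im c).
Proof. by apply: lipschitz1_continuous => x y; rewrite -raddfB Im_le_normc. Qed.

(** Complex-valued Borel functions, through their real and imaginary parts. *)
Definition borel_fun (f : X -> R[i]) :=
  measurable_fun [set: borelC R d] ((fun z => complex.Re (f z)) : borelC R d -> R) /\
  measurable_fun [set: borelC R d] ((fun z => complex.Im (f z)) : borelC R d -> R).

Lemma borel_fun_continuous f : continuous f -> borel_fun f.
Proof.
move=> cf; split; apply: continuous_borel => z.
  by apply: (@continuous_comp _ _ _ f (fun c : R[i] => complex.Re c)); [exact: cf|exact: Re_continuous].
by apply: (@continuous_comp _ _ _ f (fun c : R[i] => complex.Im c)); [exact: cf|exact: Im_continuous].
Qed.

Lemma wmon_continuous w : continuous (fun z : X => wmon w (z 0)).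
Proof.
elim: w => [|k w IH].
  rewrite (_ : (fun _ => _) = cst 1); first exact: cst_continuous.
  by apply/funext => z; rewrite /wmon big_nil.
rewrite (_ : (fun _ => _) = fun z : X => z 0 k * wmon w (z 0)).
  move=> z; have FF := nbhs_filter z.
  by apply: cvgM; [exact: coord_continuous|exact: IH].
by apply/funext => z; rewrite /wmon big_cons.
Qed.

Lemma wpoly_continuous l : continuous (fun z : X => wpoly l (z 0)).
Proof.
elim: l => [|t l IH].
  rewrite (_ : (fun _ => _) = cst 0); first exact: cst_continuous.
  by apply/funext => z; rewrite /wpoly big_nil.
rewrite (_ : (fun _ => _) = fun z : X => t.1 * wmon t.2 (z 0) + wpoly l (z 0)).
  move=> z; have FF := nbhs_filter z; apply: cvgD; last exact: IH.
  by apply: cvgM; [exact: cvg_cst|exact: wmon_continuous].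
by apply/funext => z; rewrite wpoly_cons.
Qed.

Lemma borel_fun_mul f g : borel_fun f -> borel_fun g -> borel_fun (fun z => f z * g z).
Proof.
move=> [rf mf] [rg mg]; split.
  rewrite (_ : (fun z => _) = fun z => complex.Re (f z) * complex.Re (g z) -
    complex.Im (f z) * complex.Im (g z)).
    by apply: measurable_funB; exact: measurable_funM.
  by apply/funext => z; case: (f z) (g z) => a b [].
rewrite (_ : (fun z => _) = fun z => complex.Re (f z) * complex.Im (g z) +
    complex.Im (f z) * complex.Re (g z)).
  by apply: measurable_funD; exact: measurable_funM.
by apply/funext => z; case: (f z) (g z) => a b [].
Qed.

Lemma borel_fun_conj f : borel_fun f -> borel_fun (fun z => Num.conj (f z)).
Proof.
move=> [rf mf]; split.
  rewrite (_ : (fun z => _) = fun z => complex.Re (f z))//.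
  by apply/funext => z; case: (f z).
rewrite (_ : (fun z => _) = fun z => - complex.Im (f z)); first exact: measurable_funN.
by apply/funext => z; case: (f z).
Qed.

Lemma borel_fun_hmon p r : borel_fun (hmon p r).
Proof.
apply: borel_fun_mul; first exact/borel_fun_continuous/wmon_continuous.
by apply: borel_fun_conj; exact/borel_fun_continuous/wmon_continuous.
Qed.

Lemma box_closed : closed (@box R d 1).
Proof.
rewrite (_ : box 1 = \bigcap_k [set z : X | normc (z 0 k) <= d.+1%:R * 1%:R]).
  apply: closed_bigI => k _.
  apply: (@closed_comp _ _ (fun z : X => normc (z 0 k)) [set x | x <= _]) => [z _|].
    apply: (@continuous_comp _ _ _ (fun z : X => z 0 k) (fun c : R[i] => normc c)).
      exact: coord_continuous.
    exact: normc_continuous.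
  exact: closed_le.
by apply/seteqP; split=> [z h k _|z h k]; [exact: h|exact: (h k I)].
Qed.

Lemma measurable_box : measurable (@box R d 1 : set (borelC R d)).
Proof. by apply: closed_borel; exact: box_closed. Qed.

End borel_functions.

(** A positive functional on bounded functions is, on Lipschitz functions,
    integration against a measure: unroll it on a segment and send each abscissa
    to the point to which the cells containing it shrink. *)
Lemma functional_measure (R : realType) (d : nat) (L : ('rV[R[i]]_d -> R) -> R) :
  (forall a f g, bounded_on (box 1) f -> bounded_on (box 1) g ->
     L (fun z => a * f z + g z) = a * L f + L g) ->
  (forall f, bounded_on (box 1) f -> (forall z, box 1 z -> 0 <= f z) -> 0 <= L f) ->
  exists mu : {finite_measure set (borelC R d) -> \bar R},
    mu (~` @box R d 1) = 0%E /\
    forall g : 'rV[R[i]]_d -> R,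
      measurable_fun setT (g : borelC R d -> R) -> bounded_on (box 1) g ->
      (exists C, forall z w e, 0 <= e -> box 1 z -> box 1 w ->
         (forall k, normc (z 0 k - w 0 k) <= e) -> `|g z - g w| <= C * e) ->
      \int[mu]_(z in @box R d 1) g z = L g.
Proof.
move=> L_lin L_ge0; pose Bx := @box R d 1; pose M := mass L Bx.
have M0 : 0 <= M := mass_ge0 L_ge0 Bx.
have [mu [muE mu_int]] := law_exists M (measurable_theta L_lin).
exists mu; have muB : mu (~` Bx) = 0%E.
  rewrite muE (_ : _ `&` _ = set0) ?measure0//.
  by apply/seteqP; split=> t // [_]; case; exact: theta_box.
split=> // g mg [B gB] [C gC].
(* A translate of [g], cut off at zero, is a nonnegative function that differs
   from [g] by a constant on the polydisc, which carries the measure. *)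
pose g1 z := Num.max 0 (g z + B).
have g1B z : Bx z -> g1 z = B * \1_Bx z + g z.
  move=> zB; rewrite indicE mem_set// mulr1 [RHS]addrC; apply/max_idPr.
  by have := gB z zB; rewrite ler_norml => /andP[]; lra.
have mg1 : measurable_fun setT (g1 : borelC R d -> R).
  by apply: measurable_maxr => //; exact: measurable_funD.
have bi : bounded_on Bx (\1_Bx : _ -> R) by exact: bounded_on_indic.
have bg : bounded_on Bx g by exists B.
have bBg := bounded_on_lin B bi bg.
have L_eq f h : bounded_on Bx f -> bounded_on Bx h -> (forall z, Bx z -> f z = h z) -> L f = L h.
  by move=> bf bh fh; apply/eqP; rewrite eq_le !(L_le L_lin L_ge0)// => z /fh ->.
have bg1 : bounded_on Bx g1.
  by have [K hK] := bBg; exists K => z zB; rewrite g1B// hK.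
have Lg1 : L (fun z => g1 z * \1_Bx z) = B * M + L g.
  rewrite -L_lin//; apply: L_eq => // [|z zB]; first exact: bounded_on_cut.
  by rewrite g1B// indicE mem_set// !mulr1.
have mF : measurable_fun [set: R] (fun t => g1 (theta L t)).
  exact: (measurableT_comp mg1 (measurable_theta L_lin)).
have F0 t : 0 <= g1 (theta L t) by rewrite le_max lexx.
have bounds n : ((B * M + L g - C * (2 / n.+1%:R) * M)%R%:E <=
     \int[mu]_z (g1 z)%:E <= (B * M + L g + C * (2 / n.+1%:R) * M)%R%:E)%E.
  rewrite mu_int; [|exact/measurable_EFinP|by move=> z; rewrite lee_fin le_max lexx].
  have := @integral_cell _ _ _ Bx L (@halfspace R d) L_lin L_ge0 (levels n) 0 Bx g1
    (fun t => g1 (theta L t)) (C * (2 / n.+1%:R)) bg1 (fun z => id) mF F0.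
  rewrite add0r Lg1; apply => t x tM xK.
  have xB : Bx x := cell_sub xK.
  rewrite !g1B//; last exact: theta_box.
  rewrite !indicE !mem_set//; last exact: theta_box.
  rewrite opprD addrACA subrr add0r; apply: gC => //.
  - exact: theta_box.
  - exact: (thetaP L_lin).
have cE n : C * 2 * M / n.+1%:R = C * (2 / n.+1%:R) * M.
  by rewrite [LHS]mulrAC !mulrA.
have g1_fin : (\int[mu]_z (g1 z)%:E = (B * M + L g)%:E)%E.
  have /andP[] := bounds 0; case: (\int[mu]_z _)%E bounds => // r bounds _ _.
  congr (_%:E); apply/eqP; rewrite eq_le; apply/andP; split.
    apply: (@le_harmonic _ _ _ (C * 2 * M)) => n; have /andP[_] := bounds n.
    by rewrite cE lee_fin.
  apply: (@le_harmonic _ _ _ (C * 2 * M)) => n; have /andP[+ _] := bounds n.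
  by rewrite cE lee_fin lerBlDr.
have mB : measurable (Bx : set (borelC R d)) by exact: measurable_box.
have muM : fine (mu Bx) = M.
  rewrite muE (_ : _ `&` _ = `[0, M[%classic).
    rewrite lebesgue_measure_itv /= lte_fin; case: ltP => [_|M0'].
      by rewrite -EFinD subr0.
    by apply/eqP; rewrite eq_le M0 M0'.
  by apply/seteqP; split=> [t []//|t tM]; split=> //; exact: theta_box.
have int_g : mu.-integrable Bx (EFin \o g).
  apply: measurable_bounded_integrable => //.
  - by rewrite -ge0_fin_numE//; exact: fin_num_measure.
  - exact: measurable_funTS.
  - exists B; split; rewrite ?num_real// => K BK z zB.
    exact: le_trans (gB z zB) (ltW BK).
have int_g1 : \int[mu]_(z in Bx) g1 z = B * M + L g.
  rewrite /Rintegral -[RHS]/(fine (B * M + L g)%:E) -g1_fin; congr fine.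
  rewrite (@ge0_negligible_integral _ _ _ mu setT (~` Bx))//.
  - by rewrite setTD setCK.
  - exact: measurableC.
  - exact/measurable_EFinP.
  - by move=> z _; rewrite lee_fin le_max lexx.
have : \int[mu]_(z in Bx) g1 z = \int[mu]_(z in Bx) (B + g z).
  by apply: eq_Rintegral => z; rewrite inE => zB; rewrite g1B// indicE mem_set// mulr1.
rewrite int_g1 RintegralD//.
  by rewrite Rintegral_cst// muM => /addrI ->.
exact: finite_measure_integrable_cst.
Qed.

(** * Complex integrals and the sphere *)

Section complex_integral.
Context {R : realType} {d : nat} (mu : {finite_measure set (borelC R d) -> \bar R}).
Variable D : set 'rV[R[i]]_d.
Hypothesis mD : measurable (D : set (borelC R d)).
Implicit Types f g : 'rV[R[i]]_d -> R[i].

Definition cintegral f : R[i] :=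
  Complex (\int[mu]_(z in D) complex.Re (f z)) (\int[mu]_(z in D) complex.Im (f z)).

Definition cintegrable f :=
  mu.-integrable D (EFin \o ((fun z => complex.Re (f z)) : borelC R d -> R)) /\
  mu.-integrable D (EFin \o ((fun z => complex.Im (f z)) : borelC R d -> R)).

Lemma integrable_lin (a b : R) (u v : borelC R d -> R) :
  mu.-integrable D (EFin \o u) -> mu.-integrable D (EFin \o v) ->
  mu.-integrable D (EFin \o (fun z => a * u z + b * v z)) /\
  \int[mu]_(z in D) (a * u z + b * v z) =
    a * (\int[mu]_(z in D) u z) + b * (\int[mu]_(z in D) v z).
Proof.
move=> iu iv.
have iau : mu.-integrable D (EFin \o (fun z => a * u z)) by exact: (integrableZl mD a iu).
have ibv : mu.-integrable D (EFin \o (fun z => b * v z)) by exact: (integrableZl mD b iv).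
split; first exact: (integrableD mD iau ibv).
by rewrite RintegralD// !RintegralZl.
Qed.

Lemma cintegral_lin a f g : cintegrable f -> cintegrable g ->
  cintegrable (fun z => a * f z + g z) /\
  cintegral (fun z => a * f z + g z) = a * cintegral f + cintegral g.
Proof.
case: a => a b [rf mf] [rg mg].
have [i1 e1] := integrable_lin a (- b) rf mf.
have [i2 e2] := integrable_lin 1 1 i1 rg.
have [i3 e3] := integrable_lin a b mf rf.
have [i4 e4] := integrable_lin 1 1 i3 mg.
have RE z : complex.Re (Complex a b * f z + g z) =
  1 * (a * complex.Re (f z) + - b * complex.Im (f z)) + 1 * complex.Re (g z).
  by case: (f z) (g z) => ? ? [? ?] /=; rewrite !mul1r mulNr.
have IE z : complex.Im (Complex a b * f z + g z) =
  1 * (a * complex.Im (f z) + b * complex.Re (f z)) + 1 * complex.Im (g z).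
  by case: (f z) (g z) => ? ? [? ?] /=; rewrite !mul1r.
split.
  by split; [move: i2|move: i4]; congr (integrable _ _ _); apply/funext => z /=; rewrite ?RE ?IE.
rewrite /cintegral; under eq_Rintegral do rewrite RE.
under [X in Complex _ X]eq_Rintegral do rewrite IE.
by rewrite e2 e1 e4 e3; apply/eqP; rewrite eq_complex /= !mul1r mulNr !eqxx.
Qed.

Lemma cintegrable0 : cintegrable (fun=> 0).
Proof. by split; exact: finite_measure_integrable_cst. Qed.

Lemma cintegral0 : cintegral (fun=> 0) = 0.
Proof.
by apply/eqP; rewrite eq_complex /= !Rintegral_cst// !mul0r eqxx.
Qed.

Lemma cintegral_sum I (s : seq I) (a : I -> R[i]) (F : I -> 'rV[R[i]]_d -> R[i]) :
  (forall i, cintegrable (F i)) ->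
  cintegrable (fun z => \sum_(i <- s) a i * F i z) /\
  cintegral (fun z => \sum_(i <- s) a i * F i z) = \sum_(i <- s) a i * cintegral (F i).
Proof.
move=> iF; elim: s => [|i s [IH1 IH2]].
  under eq_fun do rewrite big_nil; rewrite big_nil.
  by split; [exact: cintegrable0|exact: cintegral0].
under eq_fun do rewrite big_cons; rewrite big_cons -IH2.
exact: cintegral_lin.
Qed.

Lemma cintegrable_bounded f (B : R) :
  measurable_fun (D : set (borelC R d)) ((fun z => complex.Re (f z)) : borelC R d -> R) ->
  measurable_fun (D : set (borelC R d)) ((fun z => complex.Im (f z)) : borelC R d -> R) ->
  (forall z, D z -> normc (f z) <= B) -> cintegrable f.
Proof.
move=> rf mf fB.
have h (u : borelC R d -> R) : measurable_fun (D : set (borelC R d)) u ->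
    (forall z, D z -> `|u z| <= B) -> mu.-integrable D (EFin \o u).
  move=> mu_ uB; apply: measurable_bounded_integrable => //.
  - by rewrite -ge0_fin_numE//; exact: fin_num_measure.
  - exists B; split; rewrite ?num_real// => K BK z zD.
    exact: le_trans (uB z zD) (ltW BK).
by split; apply: h => // z /fB; apply: le_trans; [exact: Re_le_normc|exact: Im_le_normc].
Qed.

(** The factor 2 comes from bounding the real and imaginary parts separately. *)
Lemma normc_cintegral f (e : R) : cintegrable f -> (forall z, D z -> normc (f z) <= e) ->
  normc (cintegral f) <= e * (2 * fine (mu D)).
Proof.
move=> [rf mf] fe.
have h (u : borelC R d -> R) : mu.-integrable D (EFin \o u) ->
    (forall z, D z -> `|u z| <= e) -> `|\int[mu]_(z in D) u z| <= e * fine (mu D).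
  move=> iu ue; rewrite (le_trans (le_normr_Rintegral _ _))//.
  rewrite -Rintegral_cst//; apply: le_Rintegral => //; last exact: finite_measure_integrable_cst.
  exact: (integrable_norm iu).
rewrite (le_trans (normc_le_ReIm _))//= mulrCA mulr2n mulrDl mul1r lerD// h// => z /fe;
  apply: le_trans; [exact: Re_le_normc|exact: Im_le_normc].
Qed.

End complex_integral.

Section sphere_topology.
Context {R : realType} {d : nat}.
Implicit Types z : 'rV[R[i]]_d.

Definition sqr_norm z : R := \sum_k normc (z 0 k) ^+ 2.

Lemma cdot_sqr z : cdot z z = (sqr_norm z)%:C.
Proof. by rewrite rmorph_sum /=; apply: eq_bigr => k _; rewrite sqr_normcE. Qed.

Lemma sphereE : @sphere R d = [set z | sqr_norm z = 1].
Proof.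
apply/seteqP; split=> z; rewrite /sphere /= cdot_sqr; last by move=> ->.
by move/complexI.
Qed.

Lemma sqr_norm_continuous : continuous sqr_norm.
Proof.
rewrite /sqr_norm; apply: continuous_big => [|k _ z]; first exact: add_continuous.
have h : normc (w 0 k) @[w --> z] --> normc (z 0 k).
  apply: (@continuous_comp _ _ _ (fun w : 'rV_d => w 0 k) (fun c : R[i] => normc c)).
    exact: coord_continuous.
  exact: normc_continuous.
have FF := nbhs_filter z; exact: (cvgM h h).
Qed.

Lemma sphere_closed : closed (@sphere R d).
Proof.
rewrite sphereE.
apply: (@preimage_closed _ _ sqr_norm [set 1]) => [z _|].
  exact: sqr_norm_continuous.
exact: closed_eq.
Qed.

Lemma measurable_sphere : measurable (@sphere R d : set (borelC R d)).
Proof. by apply: closed_borel; exact: sphere_closed. Qed.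

Lemma cball_coord z k : cball z -> normc (z 0 k) <= 1.
Proof.
rewrite /cball /= cdot_sqr -[1%R]/((1 : R)%:C) lecR => zz.
rewrite -[leRHS]sqrtr1 -[leLHS]ger0_norm ?normc_ge0// -sqrtr_sqr ler_wsqrtr//.
by apply: le_trans zz; rewrite /sqr_norm (bigD1 k)//= lerDl sumr_ge0// => i _; rewrite sqr_ge0.
Qed.

Lemma sphere_sub_cball : @sphere R d `<=` @cball R d.
Proof. by move=> z; rewrite /sphere /cball /= => ->. Qed.

End sphere_topology.

(** * The spherical measure *)

(** A commuting spherical isometry for a semi-inner product is represented by a
    measure on the sphere, the scalar spectral measure of its normal extension. *)
Section spherical_measure.
Context {R : realType} {d : nat} {H : hilbertSpace R}.
Variables (q : H -> H -> R[i]) (S : 'I_d -> H -> H) (y : H).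
Hypotheses (q_psd : psd_form q) (S_lin : forall k, linear (S k)).
Hypothesis S_comm : forall j k x, S j (S k x) = S k (S j x).
Hypothesis q_inv : forall x z, \sum_(k < d) q (S k x) (S k z) = q x z.
Local Notation X := 'rV[R[i]]_d.
Local Notation Bx := (@box R d 1).
Local Notation sph := (@sphere R d).

Let moment p r : R[i] := q (opword S r y) (opword S p y).

Lemma hmon_cintegrable (mu : {finite_measure set (borelC R d) -> \bar R}) (D : set X) p r :
  measurable (D : set (borelC R d)) -> D `<=` Bx -> cintegrable mu D (hmon p r).
Proof.
move=> mD DB; have [C _ [hB _]] := (hmon_regular_rate q_psd S_lin S_comm q_inv p r).1.
have [mRe mIm] := @borel_fun_hmon R d p r.
apply: (cintegrable_bounded mu mD (B := C)); try exact: measurable_funTS.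
by move=> z /DB; exact: hB.
Qed.

Lemma box_measure : exists mu : {finite_measure set (borelC R d) -> \bar R},
  mu (~` Bx) = 0%E /\ forall p r, cintegral mu Bx (hmon p r) = moment p r.
Proof.
have [L [L_lin L_ge0 LRe LIm]] := walk_functional y q_psd S_lin S_comm q_inv.
have [mu [mu0 muL]] := functional_measure L_lin L_ge0.
exists mu; split=> // p r.
have [C C0 [hB hL]] := (hmon_regular_rate q_psd S_lin S_comm q_inv p r).1.
have [mRe mIm] := @borel_fun_hmon R d p r.
apply/eqP; rewrite eq_complex /= !muL ?LRe ?LIm ?eqxx//.
- by exists C => z /hB; apply: le_trans; exact: Im_le_normc.
- exists C => z w e e0 zB wB zw; rewrite -raddfB (le_trans (Im_le_normc _))//.
  exact: hL.
- by exists C => z /hB; apply: le_trans; exact: Re_le_normc.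
- exists C => z w e e0 zB wB zw; rewrite -raddfB (le_trans (Re_le_normc _))//.
  exact: hL.
Qed.

Lemma cdotE (z : X) : cdot z z = \sum_k hmon [:: k] [:: k] z.
Proof. by apply: eq_bigr => k _; rewrite /hmon /wmon !big_seq1. Qed.

Definition defect (z : X) : R[i] := (1 - cdot z z) ^+ 2.

(** The expansion of the defect into monomials, as pairs of a coefficient and
    the words of a monomial. *)
Let terms : seq (R[i] * (seq 'I_d * seq 'I_d)) :=
  (1, ([::], [::])) ::
  [seq (- 2, ([:: k], [:: k])) | k <- index_enum 'I_d] ++
  [seq (1, ([:: j; k], [:: j; k])) | j <- index_enum 'I_d, k <- index_enum 'I_d].

Lemma defect_terms (z : X) : defect z = \sum_(t <- terms) t.1 * hmon t.2.1 t.2.2 z.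
Proof.
rewrite /terms big_cons big_cat big_map big_allpairs_dep /=.
rewrite {1}/hmon /wmon !big_nil rmorph1 !mul1r -big_distrr /= -cdotE.
have -> : \sum_j \sum_k 1 * hmon [:: j; k] [:: j; k] z = cdot z z * cdot z z.
  rewrite {1}/cdot big_distrl; apply: eq_bigr => j _; rewrite /cdot big_distrr.
  apply: eq_bigr => k _; rewrite mul1r /hmon /wmon !big_cons !big_nil !mulr1 rmorphM /=; ring.
by rewrite /defect; ring.
Qed.

(** By invariance the three groups of terms contribute [q y y], [- 2 q y y] and
    [q y y]. *)
Lemma defect_moment : \sum_(t <- terms) t.1 * moment t.2.1 t.2.2 = 0.
Proof.
rewrite /terms big_cons big_cat big_map big_allpairs_dep /=.
rewrite -big_distrr /= /moment /= q_inv.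
have -> : \sum_j \sum_k 1 * q (S j (S k y)) (S j (S k y)) = q y y.
  rewrite exchange_big /= -q_inv; apply: eq_bigr => k _; rewrite -[RHS]q_inv.
  by apply: eq_bigr => j _; rewrite mul1r.
ring.
Qed.

(** The defect is nonnegative with integral zero, hence vanishes almost
    everywhere; its zero set is the sphere. *)
Theorem spherical_measure : exists mu : {finite_measure set (borelC R d) -> \bar R},
  mu (~` sph) = 0%E /\ forall p r, cintegral mu sph (hmon p r) = moment p r.
Proof.
have [mu [mu0 muE]] := box_measure.
have mB : measurable (Bx : set (borelC R d)) by exact: measurable_box.
have mS := measurable_sphere.
have i_hmon p r : cintegrable mu Bx (hmon p r) by exact: hmon_cintegrable.
have [[iRe _] defect0] := cintegral_sum mB terms (fun t => t.1) (fun t => i_hmon t.2.1 t.2.2).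
have {}defect0 : cintegral mu Bx defect = 0.
  rewrite (_ : defect = fun z => \sum_(t <- terms) t.1 * hmon t.2.1 t.2.2 z).
    by rewrite defect0 -[RHS]defect_moment; apply: eq_bigr => t _; rewrite muE.
  by apply/funext => z; exact: defect_terms.
have {}iRe : mu.-integrable Bx (EFin \o (fun z => complex.Re (defect z))).
  by move: iRe; congr integrable; apply/funext => z /=; rewrite defect_terms.
have defect_ge0 z : 0 <= complex.Re (defect z).
  by rewrite /defect cdot_sqr -[1%R]/((1 : R)%:C) -rmorphB -rmorphXn /= sqr_ge0.
have muBS : mu (Bx `&` ~` sph) = 0%E.
  have : (\int[mu]_(z in Bx) `|(complex.Re (defect z))%:E| = 0)%E.
    under eq_integral do rewrite gee0_abs ?lee_fin//.
    have /(congr1 (@complex.Re R)) /= := defect0; rewrite /Rintegral => h.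
    by rewrite -[LHS]fineK ?h//; exact: integrable_fin_num.
  move/(ae_eq_integral_abs _ mB (measurable_int _ iRe)) => [N [mN N0 sub]].
  apply/eqP; rewrite -measure_le0 -N0 le_measure ?inE//.
    by apply: measurableI => //; exact: measurableC.
  move=> z [zB zS]; apply: sub => /= /(_ zB) [] h; apply: zS.
  move: h; rewrite /defect /sphere /= cdot_sqr -[1%R]/((1 : R)%:C) -rmorphB -rmorphXn /= => /eqP.
  by rewrite sqrf_eq0 subr_eq0 => /eqP <-.
have muS : mu (~` sph) = 0%E.
  apply/eqP; rewrite -measure_le0 (@le_trans _ _ (mu (~` Bx) + mu (Bx `&` ~` sph))%E)//.
    apply: (le_trans _ (measureU2 _ _ _)); last 2 first.
    - exact: measurableC.
    - by apply: measurableI => //; exact: measurableC.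
    apply: le_measure; rewrite ?inE.
    - exact: measurableC.
    - by apply: measurableU; [|apply: measurableI => //]; exact: measurableC.
    by move=> z zS; have [zB|zB] := pselect (Bx z); [right|left].
  by rewrite mu0 muBS adde0.
exists mu; split=> // p r; rewrite -muE.
have BS : Bx `\` ~` sph = sph.
  rewrite setDE setCK; apply: setIidr => z zS k; rewrite mulr1.
  by rewrite (le_trans (cball_coord k (sphere_sub_cball zS))) ?ler1n.
have [i1 i2] := i_hmon p r.
apply/eqP; rewrite eq_complex /= /Rintegral.
rewrite (negligible_integral _ mB i1 muS) ?(negligible_integral _ mB i2 muS) ?BS ?eqxx//.
all: exact: measurableC.
Qed.

End spherical_measure.

(** * Regularity of Borel measures *)

(** Finite Borel measures on C^d are regular: the sets that can be squeezed
    between a closed set and an open set form a sigma-algebra containing the open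
    sets. *)
Section regularity.
Context {R : realType} {d : nat} (mu : {finite_measure set (borelC R d) -> \bar R}).
Local Notation X := 'rV[R[i]]_d.

Definition squeezed (E : set X) : Prop := forall e : R, 0 < e ->
  exists F U : set X, [/\ closed F, open U, F `<=` E, E `<=` U & (mu (U `\` F) < e%:E)%E].

Lemma eventually_small (G : nat -> set X) (e : R) :
  (forall n, measurable (G n : set (borelC R d))) -> nonincreasing_seq G ->
  (mu (\bigcap_n G n) < e%:E)%E -> exists n, (mu (G n) < e%:E)%E.
Proof.
move=> mG dG small.
have G0 : (mu (G 0%N) < +oo)%E by rewrite -ge0_fin_numE//; exact: fin_num_measure.
have h := nonincreasing_cvg_mu G0 mG (bigcapT_measurable mG) dG.
have : nbhs (mu (\bigcap_n G n)) [set x | (x < e%:E)%E].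
  by apply: open_nbhs_nbhs; split=> //; exact: open_ereal_lt_ereal.
by move/h => [N _ hN]; exists N; apply: hN => /=.
Qed.

(** From inside, by the complements of the [1/(n+1)]-neighbourhoods of the
    complement. *)
Lemma squeezed_open U : open U -> squeezed U.
Proof.
move=> oU e e0.
pose V n : set X := \bigcup_(y in ~` U) (ball y (n.+1%:R^-1 : R)%:C)^°.
have oV n : open (V n) by apply: bigcup_open => y _; exact: open_interior.
have inv0 n : (0 : R[i]) < (n.+1%:R^-1 : R)%:C by rewrite ltr0c invr_gt0 ltr0n.
have cF n : closed (~` V n) by exact: open_closedC.
have V_anti m n : (m <= n)%N -> V n `<=` V m.
  move=> mn; apply: subset_bigcup => y _; apply: interiorS; apply: le_ball.
  by rewrite lecR lef_pV2 ?posrE ?ltr0n// ler_nat ltnS.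
have mG n : measurable (U `\` ~` V n : set (borelC R d)).
  by apply: measurableD; [exact: open_borel|exact: closed_borel].
have [||n nP] := @eventually_small (fun n => U `\` ~` V n) e mG.
- by move=> m n mn; apply/subsetPset; apply: setDS; apply: subsetC; exact: V_anti.
- rewrite (_ : \bigcap_n _ = set0) ?measure0 ?lte_fin//.
  apply/seteqP; split=> // x h; have [Ux _] := h 0%N I.
  have [r r0 rU] := open_polydisc oU Ux.
  have [n _ nr] := near_infty_natSinv_lt (PosNum r0).
  have [_ /contrapT[y nUy /interior_subset[_ yx]]] := h n I.
  apply: nUy; apply: rU => k.
  have := yx 0 k; rewrite /ball /= normcE ltcR => h1; apply: lt_trans h1 _.
  exact: (nr n (leqnn n)).
exists (~` V n), U; split=> //.
move=> x nVx; apply: contrapT => nUx; apply: nVx; exists x => //.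
by rewrite /interior; apply: nbhsx_ballx.
Qed.

Lemma squeezed_compl E : squeezed E -> squeezed (setT `\` E).
Proof.
move=> hE e /hE[F [U [cF oU FE EU h]]]; exists (~` U), (~` F); rewrite setTD; split.
- exact: open_closedC.
- exact: closed_openC.
- exact: subsetC.
- exact: subsetC.
- by rewrite setDE setCK setIC -setDE.
Qed.

(** Errors [e / 2^(n+2)] on the pieces; finitely many of the closed sets suffice
    because the measure is continuous along decreasing sequences. *)
Lemma squeezed_bigcup (E : nat -> set X) :
  (forall n, squeezed (E n)) -> squeezed (\bigcup_n E n).
Proof.
move=> hE e e0; have e2 : 0 < e / 2 by rewrite divr_gt0.
have /choice[F /choice[U FU]] n : exists F : set X, exists U : set X,
    [/\ closed F, open U, F `<=` E n, E n `<=` U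
      & (mu (U `\` F) < (e / 2 / (2 ^ n.+1)%:R)%:E)%E].
  by apply: hE; rewrite divr_gt0// ltr0n expn_gt0.
have cF n : closed (F n) by case: (FU n).
have oU n : open (U n) by case: (FU n).
have oUU : open (\bigcup_n U n) by exact: bigcup_open.
have cFF N : closed (\bigcup_(n in `I_N) F n).
  by apply: closed_bigcup => //; exact: finite_II.
pose G N := (\bigcup_n U n) `\` \bigcup_(n in `I_N) F n.
have mG n : measurable (G n : set (borelC R d)).
  by apply: measurableD; [exact: open_borel|exact: closed_borel].
have [||N NP] := @eventually_small G e mG.
- move=> m n mn; apply/subsetPset => x [Ux nF]; split=> // -[k km Fk]; apply: nF.
  by exists k => //; exact: leq_trans mn.
- apply: (@le_lt_trans _ _ (e / 2)%:E); last by rewrite lte_fin ltr_pdivrMr// ltr_pMr// ltr1n.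
  apply: le_trans (epsilon_trick0 xpredT (ltW e2)).
  apply: (@le_trans _ _ (\sum_(0 <= n <oo) mu (U n `\` F n))%E).
    apply: measure_sigma_subadditive.
    - by move=> n; apply: measurableD; [exact: open_borel|exact: closed_borel].
    - exact: bigcapT_measurable.
    move=> x h; have [[n _ Un] _] := h 0%N I; exists n => //; split=> // Fn.
    by have [_] := h n.+1 I; apply; exists n => //=.
  by apply: lee_nneseries => // n _; apply: ltW; case: (FU n).
exists (\bigcup_(n in `I_N) F n), (\bigcup_n U n); split=> //.
- by move=> x [n nN Fn]; exists n => //; case: (FU n) => _ _ h _ _; exact: h.
- by move=> x [n nN En]; exists n => //; case: (FU n) => _ _ _ h _; exact: h.
Qed.

Lemma borel_squeezed (E : set X) : measurable (E : set (borelC R d)) -> squeezed E.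
Proof.
apply: (smallest_sub (C := sigma_algebra setT)); last exact: squeezed_open.
split; first by apply: squeezed_open; exact: open0.
- exact: squeezed_compl.
- exact: squeezed_bigcup.
Qed.

End regularity.

(** * Measures as complex measures *)

Section positive_cmeasure.
Context {R : realType} {d : nat} (mu : {finite_measure set (borelC R d) -> \bar R}).
Local Notation X := 'rV[R[i]]_d.

Let zero_measure : {finite_measure set (borelC R d) -> \bar R} := mzero.

Definition positive_cmeasure : cmeasure R d :=
  CMeasure mu zero_measure zero_measure zero_measure.

(** For a positive measure, sigma-additivity makes every partition give the same
    sum. *)
Lemma tvar_positive (E : set (borelC R d)) : measurable E -> tvar positive_cmeasure E = mu E.
Proof.
move=> mE.
have partE (F : nat -> set (borelC R d)) :
    [/\ forall n, measurable (F n), trivIset setT F & \bigcup_n F n = E] ->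
    (\sum_(0 <= n <oo) (normc (cmeas positive_cmeasure (F n)))%:E = mu E)%E.
  move=> [mF tF UF]; transitivity (\sum_(0 <= n <oo) mu (F n))%E; last first.
    by rewrite -UF measure_bigcup//; apply: eq_eseriesl => n; rewrite in_setT.
  apply: eq_eseriesr => n _.
  rewrite /cmeas /= !subr0 expr0n addr0 sqrtr_sqr ger0_norm ?fine_ge0//.
  by rewrite fineK//; exact: fin_num_measure.
rewrite /tvar; set A := [set _ | _ in _]; rewrite (_ : A = [set mu E]) ?ereal_sup1//.
apply/seteqP; split=> [_ [F hF <-]|_ ->]; first exact: partE.
exists (bigcup2 E set0); last apply: partE.
all: split; [by case=> [|[|n]]//= |apply/trivIsetP|by rewrite bigcup2E setU0].
all: by move=> [|[|i]] [|[|j]] _ _ //= _; rewrite ?setI0 ?set0I.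
Qed.

Lemma polydisc_compact (r : R) : compact [set z : X | forall k,
  `|complex.Re (z 0 k)| <= r /\ `|complex.Im (z 0 k)| <= r].
Proof.
apply: (@rV_compact R[i] d (fun _ => [set c | `|complex.Re c| <= r /\ `|complex.Im c| <= r])) => _.
have -> : [set c : R[i] | `|complex.Re c| <= r /\ `|complex.Im c| <= r] =
    (fun p : R * R => Complex p.1 p.2) @` (`[- r, r] `*` `[- r, r]).
  apply/seteqP; split=> [[a b] /= [ha hb]|_ [[a b] /= [+ +] <-] /=].
    by exists (a, b) => //; split; rewrite /= in_itv /= -ler_norml.
  by rewrite !in_itv /= -!ler_norml.
apply: continuous_compact; last by apply: compact_setX; exact: segment_compact.
apply: continuous_subspaceT => p; have FF := nbhs_filter p.
apply/cvgrPdist_lt => e; case: e => e i; rewrite ltcE /= => /andP[/eqP i0 e0].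
have e2 : 0 < e / 2 by rewrite divr_gt0.
have h1 : \forall t \near p, `|p.1 - t.1| < e / 2.
  have : (fun t : R * R => t.1) @ p --> p.1 by exact: cvg_fst.
  by move/cvgrPdist_lt; exact.
have h2 : \forall t \near p, `|p.2 - t.2| < e / 2.
  have : (fun t : R * R => t.2) @ p --> p.2 by exact: cvg_snd.
  by move/cvgrPdist_lt; exact.
near=> t; rewrite normcE ltcE /= i0 eqxx /=.
rewrite [X in _ < X]splitr.
apply: le_lt_trans (normc_le_ReIm (Complex (p.1 - t.1) (p.2 - t.2))) _ => /=.
by rewrite ltrD//; near: t.
Unshelve. all: by end_near. Qed.

Lemma sphere_compact : compact (@sphere R d).
Proof.
apply: (subclosed_compact sphere_closed (@polydisc_compact 1)) => z zS k.
have h := cball_coord k (sphere_sub_cball zS).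
by split; apply: le_trans h; [exact: Re_le_normc|exact: Im_le_normc].
Qed.

Lemma compact_inner (F : set X) : closed F -> compact (F `&` @sphere R d).
Proof.
move=> cF; apply: (subclosed_compact _ sphere_compact) => //.
  by apply: closedI => //; exact: sphere_closed.
Qed.

Hypothesis mu_sphere : mu (~` @sphere R d) = 0%E.

Lemma inner_regular (E : set X) (e : R) : measurable (E : set (borelC R d)) -> 0 < e ->
  exists K U : set X, [/\ compact K, open U, K `<=` E, E `<=` U & (mu (U `\` K) < e%:E)%E].
Proof.
move=> mE e0; have [F [U [cF oU FE EU h]]] := borel_squeezed mu mE e0.
exists (F `&` @sphere R d), U; split=> //; [exact: compact_inner|by move=> x [/FE]|].
have mUF : measurable (U `\` F : set (borelC R d)).
  by apply: measurableD; [exact: open_borel|exact: closed_borel].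
have mS : measurable (~` @sphere R d : set (borelC R d)).
  by apply: measurableC; exact: measurable_sphere.
apply: le_lt_trans h; rewrite -[leRHS]adde0 -mu_sphere.
apply: le_trans (measureU2 _ mUF mS).
apply: le_measure; rewrite ?inE.
- apply: measurableD; first exact: open_borel.
  by apply: measurableI; [exact: closed_borel|exact: measurable_sphere].
- exact: measurableU.
by rewrite setDIr; apply: setUS => x [_ ].
Qed.

Lemma positive_regular : regular_on_sphere positive_cmeasure.
Proof.
split.
  by rewrite tvar_positive//; apply: measurableC; exact: measurable_sphere.
move=> E e mE e0; have [K [U [cK oU KE EU h]]] := inner_regular mE e0.
exists K, U; split=> //; rewrite tvar_positive//.
apply: measurableD; first exact: open_borel.
apply: closed_borel; apply: compact_closed => //; exact: norm_hausdorff.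
Qed.

End positive_cmeasure.

(** * Boundary values *)

(** Elements of the algebra are uniform limits of polynomials on the open ball,
    hence have limits at every point of the closed ball. *)
Section boundary_values.
Context {R : realType} {d : nat} (H2 : druryArveson R d).
Local Notation X := 'rV[R[i]]_d.

Definition inball : set X := [set w | cdot w w < 1].

(** The extension by zero whose limits define [bdext]. *)
Definition ext (f : oball R d -> R[i]) (w : X) : R[i] :=
  if insub w is Some w' then f w' else 0.

Lemma inballP w : inball w -> exists w' : oball R d, sval w' = w.
Proof. by move=> wB; exists (exist _ w wB). Qed.

Lemma ext_ball f (w : oball R d) : ext f (sval w) = f w.
Proof. by rewrite /ext (valK w). Qed.

(** The point [z] is approached along its radius, by [(1 - t) z]. *)
Lemma within_ball_proper (z : X) : cball z -> ProperFilter (within inball (nbhs z)).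
Proof.
move=> zB; have FF := nbhs_filter z.
split; last exact: within_filter.
move/nbhs_ballP => [e /= e0 he].
have [r r0 rU] : exists2 r : R, 0 < r & forall w : X,
    (forall k, normc (w 0 k - z 0 k) < r) -> ~ inball w.
  have [r r0 h] := @open_polydisc R d _ z (open_interior (ball z e)) (nbhsx_ballx z _ e0).
  exists r => // w wz; apply: he; exact: interior_subset (h w wz).
pose t : R := Num.min 1 (r / 2).
have t0 : 0 < t by rewrite lt_min ltr01 divr_gt0.
have t1 : t <= 1 by rewrite ge_min lexx.
have tr : t < r by rewrite (le_lt_trans (_ : _ <= r / 2)) ?ge_min ?lexx ?orbT// ltr_pdivrMr// ltr_pMr// ltr1n.
apply: (rU ((1 - t)%:C *: z)) => [k|].
  rewrite !mxE rmorphB /= mulrBl mul1r addrAC subrr add0r normcN normcM normc_real gtr0_norm//.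
  apply: le_lt_trans tr; rewrite -[leRHS]mulr1 ler_wpM2l ?(ltW t0)//.
  exact: cball_coord.
suff : sqr_norm ((1 - t)%:C *: z) < 1 by rewrite /inball /= cdot_sqr -ltcR.
have -> : sqr_norm ((1 - t)%:C *: z) = (1 - t) ^+ 2 * sqr_norm z.
  rewrite /sqr_norm big_distrr; apply: eq_bigr => k _.
  by rewrite mxE normcM normc_real exprMn real_normK ?num_real.
have z1 : sqr_norm z <= 1 by move: zB; rewrite /cball /= cdot_sqr -[1%R]/((1 : R)%:C) lecR.
have z0 : 0 <= sqr_norm z by apply: sumr_ge0 => k _; exact: sqr_ge0.
have h : (1 - t) ^+ 2 < 1 by rewrite expr_lt1//; lra.
apply: le_lt_trans h; rewrite -[leRHS]mulr1 ler_wpM2l ?sqr_ge0//.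
Qed.

Lemma ext_near f l (z : X) (e : R) : Ad H2 f -> 0 < e ->
  \forall w \near within inball (nbhs z),
    normc (ext f w - wpoly l (z 0)) < mnorm H2 (f \- wpoly_fun l) + e.
Proof.
move=> fA e0; have FF := nbhs_filter z.
have : (fun w : X => wpoly l (w 0)) @ z --> wpoly l (z 0) by exact: wpoly_continuous.
have e0' : (0 : R[i]) < e%:C by rewrite ltr0c.
move/cvgrPdist_lt => /(_ _ e0'); apply: filterS => w + wB.
rewrite normcE ltcR => h; have [w' wE] := inballP wB.
rewrite -(subrKA (wpoly l (w 0))) (le_lt_trans (ler_normcD _ _))// ler_ltD//; last first.
  by rewrite -normcN opprB.
rewrite -wE ext_ball.
by apply: (sup_le_mnorm (f := f \- wpoly_fun l)); apply: Md_sub; [exact: Ad_Md|exact: wpoly_Md].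
Qed.

(** Near [z] the values of [f] are within [e] of the value at [z] of a polynomial
    close to [f], so their real and imaginary parts are Cauchy. *)
Lemma ext_cvg f (z : X) : Ad H2 f -> cball z ->
  ext f @ within inball (nbhs z) --> bdext f z.
Proof.
move=> fA zB; have FP := within_ball_proper zB.
have part (u : R[i] -> R) : (forall x y, `|u x - u y| <= normc (x - y)) ->
    cvg ((fun w => u (ext f w)) @ within inball (nbhs z)).
  move=> uL; apply/cauchy_cvgP; apply: cauchy_exP => e e0.
  have e2 : 0 < e / 2 by rewrite divr_gt0.
  have [l fl] := Ad_approx fA e2; exists (u (wpoly l (z 0))).
  apply: filterS (ext_near l z fA e2) => w h.
  rewrite /ball /= distrC (le_lt_trans (uL _ _))// (lt_le_trans h)//.
  by rewrite [leRHS]splitr lerD2r ltW.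
have /cvg_ex[a ha] := part (@complex.Re R)
  (fun x y => ltac:(rewrite -raddfB; exact: Re_le_normc)).
have /cvg_ex[b hb] := part (@complex.Im R)
  (fun x y => ltac:(rewrite -raddfB; exact: Im_le_normc)).
suff h : ext f @ within inball (nbhs z) --> Complex a b.
  by rewrite /bdext (cvg_lim _ h)//; exact: norm_hausdorff.
apply/cvgrPdist_lt => e; case: e => e i; rewrite ltcE /= => /andP[/eqP i0 e0].
have e2 : 0 < e / 2 by rewrite divr_gt0.
have h1 : \forall w \near within inball (nbhs z), `|a - complex.Re (ext f w)| < e / 2.
  by move/cvgrPdist_lt : ha; exact.
have h2 : \forall w \near within inball (nbhs z), `|b - complex.Im (ext f w)| < e / 2.
  by move/cvgrPdist_lt : hb; exact.
apply: filterS2 h1 h2 => w h1 h2; rewrite normcE ltcE /= i0 eqxx /= [X in _ < X]splitr.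
apply: le_lt_trans (normc_le_ReIm _) _.
by rewrite !raddfB /= ltrD.
Qed.

Lemma bdext_close f l (z : X) : Ad H2 f -> cball z ->
  normc (bdext f z - wpoly l (z 0)) <= mnorm H2 (f \- wpoly_fun l).
Proof.
move=> fA zB; have FP := within_ball_proper zB.
apply/ler_addgt0Pr => e e0; have e2 : 0 < e / 2 by rewrite divr_gt0.
have h1 := ext_near l z fA e2.
have e2' : (0 : R[i]) < (e / 2)%:C by rewrite ltr0c.
have /cvgrPdist_lt/(_ _ e2') h2 := ext_cvg fA zB.
have [w [w1]] := filter_ex (filterI h1 h2); rewrite normcE ltcR => w2.
rewrite -(subrKA (ext f w)) (le_trans (ler_normcD _ _))// addrC [e]splitr addrA.
by rewrite lerD// ltW.
Qed.

Lemma bdext_approx f : Ad H2 f -> exists l : nat -> seq (R[i] * seq 'I_d), forall n,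
  mnorm H2 (f \- wpoly_fun (l n)) < n.+1%:R^-1.
Proof.
move=> fA.
have /choice[l hl] n : exists l, mnorm H2 (f \- wpoly_fun l) < n.+1%:R^-1.
  by apply: Ad_approx => //; rewrite invr_gt0 ltr0n.
by exists l.
Qed.

(** Boundary values are uniform limits of polynomials on the sphere. *)
Lemma bdext_part_measurable (u : R[i] -> R) f :
  (forall x y, `|u x - u y| <= normc (x - y)) -> Ad H2 f ->
  measurable_fun (@sphere R d : set (borelC R d)) ((fun z => u (bdext f z)) : borelC R d -> R).
Proof.
move=> uL fA; have [l hl] := bdext_approx fA.
apply: (@measurable_fun_cvg _ _ _ _ (fun n => (fun z : X => u (wpoly (l n) (z 0))) : borelC R d -> R)).
  move=> n; apply: measurable_funTS; apply: continuous_borel => z.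
  apply: (@continuous_comp _ _ _ (fun z : X => wpoly (l n) (z 0)) u).
    exact: wpoly_continuous.
  exact: lipschitz1_continuous.
move=> z zS; apply/cvgrPdist_lt => e e0.
have [n _ hn] := near_infty_natSinv_lt (PosNum e0).
exists n => // m nm; apply: le_lt_trans (uL _ _) _.
apply: le_lt_trans (bdext_close _ fA (sphere_sub_cball zS)) _.
by apply: lt_trans (hl m) _; exact: hn.
Qed.

Lemma bdext_cintegrable (mu : {finite_measure set (borelC R d) -> \bar R}) f : Ad H2 f ->
  cintegrable mu (@sphere R d) (bdext f).
Proof.
move=> fA; have mS := @measurable_sphere R d.
apply: (@cintegrable_bounded _ _ mu _ mS _ (mnorm H2 (f \- wpoly_fun [::]))).
- by apply: (bdext_part_measurable _ fA) => x y; rewrite -raddfB Re_le_normc.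
- by apply: (bdext_part_measurable _ fA) => x y; rewrite -raddfB Im_le_normc.
move=> z zS; have := bdext_close [::] fA (sphere_sub_cball zS).
by rewrite {1}/wpoly big_nil subr0.
Qed.

(** A functional on the algebra that is integration on polynomials and is bounded
    for the multiplier norm is integration. *)
Lemma functional_cint (mu : {finite_measure set (borelC R d) -> \bar R})
    (phi : (oball R d -> R[i]) -> R[i]) (C : R) : 0 <= C ->
  (forall l, cintegrable mu (@sphere R d) (fun z => wpoly l (z 0))) ->
  (forall f l, Ad H2 f -> normc (phi f - cintegral mu (@sphere R d) (fun z => wpoly l (z 0))) <=
     C * mnorm H2 (f \- wpoly_fun l)) ->
  forall f, Ad H2 f -> phi f = cint (positive_cmeasure mu) (bdext f).
Proof.
move=> C0 il h f fA; set S := @sphere R d.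
have mS : measurable (S : set (borelC R d)) := @measurable_sphere R d.
have -> : cint (positive_cmeasure mu) (bdext f) = cintegral mu S (bdext f).
  have z0 (g : X -> R[i]) : pint (mzero : {finite_measure set (borelC R d) -> \bar R}) g = 0.
    by rewrite /pint /Rintegral !integral_measure_zero.
  by rewrite /cint /= !z0 !subr0 mulr0 addr0.
apply/eqP; rewrite -subr_eq0; apply/eqP/normc0_eq0/eqP.
rewrite eq_le normc_ge0 andbT.
apply: (@le_harmonic _ _ _ (C + 2 * fine (mu S))) => n; rewrite add0r.
have [l /ltW fl] : exists l, mnorm H2 (f \- wpoly_fun l) < n.+1%:R^-1.
  by apply: Ad_approx => //; rewrite invr_gt0 ltr0n.
set p := fun z : X => wpoly l (z 0).
have [iD ID] := cintegral_lin mS (-1) (bdext_cintegrable mu fA) (il l).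
rewrite -(subrKA (cintegral mu S p)) (le_trans (ler_normcD _ _))// mulrDl lerD//.
  by rewrite (le_trans (h f l fA))// ler_wpM2l.
rewrite -[_ - _]addrC -mulN1r -ID mulrC; apply: normc_cintegral => // z zS.
rewrite mulN1r addrC -normcN opprB.
exact: le_trans (bdext_close l fA (sphere_sub_cball zS)) fl.
Qed.

End boundary_values.

(** * The measure is Henkin and vanishes off the zero set *)

Section conclusion.
Context {R : realType} {d : nat} (H2 : druryArveson R d) {H : hilbertSpace R}.
Variables (T : 'I_d -> H -> H) (T_row : commuting_row_contraction T).
Local Notation X := 'rV[R[i]]_d.
Local Notation sph := (@sphere R d).
Let S k := adjoint (T k).
Let q := qform T.

Variables (y : H) (mu : {finite_measure set (borelC R d) -> \bar R}).
Hypothesis mu_sphere : mu (~` sph) = 0%E.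
Hypothesis mu_hmon : forall p r,
  cintegral mu sph (hmon p r) = q (opword S r y) (opword S p y).

Let mS : measurable (sph : set (borelC R d)) := @measurable_sphere R d.

Lemma sphere_hmon p r : cintegrable mu sph (hmon p r).
Proof.
apply: (hmon_cintegrable (qform_psd T_row) (S_lin T_row) (adjoint_comm T_row) (qform_inv T_row)) => //.
by move=> z zS k; rewrite mulr1 (le_trans (cball_coord k (sphere_sub_cball zS))) ?ler1n.
Qed.

Lemma opword_commute k w x : opword S w (S k x) = S k (opword S w x).
Proof. by elim: w => //= j w ->; exact: adjoint_comm. Qed.

(** The adjoint reverses the order of the letters, which commute. *)
Lemma opword_adjoint w u v : hip (opword T w u) v = hip u (opword S w v).
Proof.
elim: w v => //= k w IH v.
by rewrite adjointP ?IH ?opword_commute//; exact: T_bounded.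
Qed.

Lemma integral_wpoly l : cintegrable mu sph (fun z => wpoly l (z 0)) /\
  cintegral mu sph (fun z => wpoly l (z 0)) = hip (oppoly T l (Qlim T y)) y.
Proof.
have E (z : X) : wpoly l (z 0) = \sum_(t <- l) t.1 * hmon t.2 [::] z.
  by apply: eq_bigr => t _; rewrite /hmon [in RHS]/wmon big_nil rmorph1 mulr1.
have [h1 h2] := cintegral_sum mS l (fun t => t.1) (fun t => sphere_hmon t.2 [::]).
under eq_fun do rewrite E; split=> //; rewrite h2 /oppoly hip_suml.
by apply: eq_bigr => t _; rewrite mu_hmon hipZl opword_adjoint.
Qed.

(** The adjoint of [p(T)], applied to [y]. *)
Definition adjoint_poly l : H := \sum_(t <- l) Num.conj t.1 *: opword S t.2 y.

Lemma hip_oppoly l x : hip (oppoly T l x) y = hip x (adjoint_poly l).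
Proof.
rewrite hip_suml hip_sumr; apply: eq_bigr => t _.
by rewrite hipZl hipZr conjCK opword_adjoint.
Qed.

(** The integral is [q v v] for [v = p(T)^* y], at most [|v|^2]; and
    [|v|^2 = <p(T) v, y>] is at most [e |v| |y|]. *)
Lemma integral_sqr_wpoly l (e : R) : 0 <= e ->
  (forall x, hnorm (oppoly T l x) <= e * hnorm x) ->
  mu.-integrable sph (EFin \o ((fun z => normc (wpoly l (z 0)) ^+ 2) : borelC R d -> R)) /\
  \int[mu]_(z in sph) normc (wpoly l (z 0)) ^+ 2 <= (e * hnorm y) ^+ 2.
Proof.
move=> e0 le; set v := adjoint_poly l.
pose s := [seq (t, u) | t <- l, u <- l].
have E (z : X) : (normc (wpoly l (z 0)) ^+ 2)%:C =
    \sum_(i <- s) (i.1.1 * Num.conj i.2.1) * hmon i.1.2 i.2.2 z.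
  rewrite -sqr_normcE /wpoly rmorph_sum big_distrlr /= big_allpairs_dep /=.
  apply: eq_bigr => t _; apply: eq_bigr => u _.
  by rewrite rmorphM /hmon mulrACA.
have [[iRe _] h] := cintegral_sum mS s (fun i => i.1.1 * Num.conj i.2.1)
  (fun i => sphere_hmon i.1.2 i.2.2).
have ReE (z : X) : complex.Re (\sum_(i <- s) (i.1.1 * Num.conj i.2.1) * hmon i.1.2 i.2.2 z) =
    normc (wpoly l (z 0)) ^+ 2 by rewrite -E.
have {}h : \int[mu]_(z in sph) normc (wpoly l (z 0)) ^+ 2 = complex.Re (q v v).
  have /(congr1 (@complex.Re R)) := h; rewrite /cintegral /=.
  under eq_Rintegral do rewrite ReE.
  move=> ->; congr complex.Re.
  rewrite [RHS](form_suml (qform_psd T_row)) big_allpairs_dep /= exchange_big /=.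
  apply: eq_bigr => u _; rewrite (formZl (qform_psd T_row)) (form_sumr (qform_psd T_row)).
  rewrite big_distrr; apply: eq_bigr => t _ /=.
  rewrite (formZr (qform_psd T_row)) conjCK -[Complex _ _]/(cintegral mu sph (hmon t.2 u.2)).
  by rewrite mu_hmon mulrCA mulrA.
split; first by move: iRe; congr integrable; apply/funext => z /=; rewrite ReE.
rewrite h (le_trans (qform_le T_row v))// ler_pXn2r ?nnegrE ?hnorm_ge0//; last first.
  by rewrite mulr_ge0 ?hnorm_ge0.
have [v0|v0] := eqVneq (hnorm v) 0; first by rewrite v0 mulr_ge0 ?hnorm_ge0.
have v_gt0 : 0 < hnorm v by rewrite lt_neqAle eq_sym v0 hnorm_ge0.
rewrite -(ler_pM2r v_gt0) -expr2 -Re_hipxx -hip_oppoly.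
rewrite (le_trans (ler_norm _))// (le_trans (Re_le_normc _))// (le_trans (hip_normc _ _))//.
by rewrite mulrAC ler_wpM2r ?hnorm_ge0.
Qed.

(** The moments turn the coefficients of the calculus into integrals, so that
    absolute continuity makes the measure Henkin. *)
Lemma moment_henkin : separable_hilbert H -> absolutely_continuous H2 T ->
  henkin H2 (positive_cmeasure mu).
Proof.
move=> sH acT; have [Phi Phi_calc PhiL] := absolutely_continuous_functional sH acT.
have [L [L_lin L_cont LPhi]] := PhiL (Qlim T y) y.
exists L; split=> // f fA; rewrite LPhi//.
apply: (@functional_cint _ _ H2 mu (fun g => hip (Phi g (Qlim T y)) y)
  (hnorm (Qlim T y) * hnorm y)) => //.
- by rewrite mulr_ge0 ?hnorm_ge0.
- by move=> l; case: (integral_wpoly l).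
move=> g l gA; have [_ ->] := integral_wpoly l.
rewrite -(calculus_wpoly Phi_calc) -hipBl.
have -> : Phi g (Qlim T y) - Phi (wpoly_fun l) (Qlim T y) = Phi (g \- wpoly_fun l) (Qlim T y).
  rewrite addrC -scaleN1r -(calculus_lin Phi_calc) //; last exact: wpoly_Ad.
  by congr (Phi _ _); apply/funext => z /=; rewrite mulN1r addrC.
rewrite (le_trans (hip_normc _ _))// mulrAC ler_wpM2r ?hnorm_ge0// mulrC.
exact: (calculus_norm Phi_calc _ (Ad_sub gA (wpoly_Ad H2 l))).
Qed.

Variable J : set (oball R d -> R[i]).
Hypotheses (J_Ad : J `<=` Ad H2) (T_J : constrained H2 J T).

(** As [f(T) = 0], the operator [p(T)] is [(p - f)(T)]. *)
Lemma constrained_approx f l x : J f ->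
  hnorm (oppoly T l x) <= mnorm H2 (f \- wpoly_fun l) * hnorm x.
Proof.
move=> Jf; have [Phi Phi_calc Phi0] := T_J; have fA := J_Ad Jf.
have subA := Ad_sub fA (wpoly_Ad H2 l).
rewrite -(calculus_wpoly Phi_calc) (le_trans _ (calculus_norm Phi_calc x subA))//.
have -> : f \- wpoly_fun l = (fun z => -1 * wpoly_fun l z + f z).
  by apply/funext => z /=; rewrite mulN1r addrC.
rewrite (calculus_lin Phi_calc)//; last exact: wpoly_Ad.
by rewrite (Phi0 f Jf) addr0 scaleN1r hnormN.
Qed.

(** Some [f] in the ideal does not vanish at [z].  Near [z] the polynomials close
    to [f] are bounded below, while their square integrals tend to zero. *)
Lemma locally_null z : sph z -> ~ zero_set J z ->
  exists U : set X, [/\ open U, U z & mu (U `&` sph) = 0%E].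
Proof.
have chain (c x1 x2 x3 : R) : 2 * c < x1 -> x1 <= c + x2 -> x2 <= c / 2 + x3 -> c / 2 <= x3.
  by move=> h1 h2 h3; lra.
move=> zS nz; have zB := sphere_sub_cball zS.
have [f [Jf fz]] : exists f, J f /\ bdext f z <> 0.
  apply: contrapT => h; apply: nz; split=> // f Jf.
  by apply: contrapT => fz; apply: h; exists f.
have fA := J_Ad Jf.
have [c c0 c4] : exists2 c : R, 0 < c & normc (bdext f z) = 4 * c.
  exists (normc (bdext f z) / 4); last by rewrite mulrC divfK.
  rewrite divr_gt0// lt_neqAle normc_ge0 andbT eq_sym; apply/eqP => /normc0_eq0.
  exact: fz.
(* The open set is cut out by a polynomial [p] close to [f], which is continuous
   off the sphere as well: [|p| > 2c] there, so [|f| > c], and a polynomial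
   within [c/2] of [f] exceeds [c/2]. *)
have [l lf] := Ad_approx fA c0.
pose U : set X := [set w | 2 * c < normc (wpoly l (w 0))].
have cU : continuous (fun w : X => normc (wpoly l (w 0))).
  move=> w; apply: (@continuous_comp _ _ _ (fun w : X => wpoly l (w 0)) (fun c : R[i] => normc c)).
    exact: wpoly_continuous.
  exact: normc_continuous.
have oU : open U.
  by move/continuousP : cU => /(_ [set x | 2 * c < x]); apply; exact: open_gt.
have tri (a b : R[i]) : normc a <= normc (a - b) + normc b.
  by rewrite -{1}(subrK b a) ler_normcD.
have Uz : U z.
  have h1 := bdext_close l fA zB; have h2 := tri (bdext f z) (wpoly l (z 0)).
  by rewrite /U /=; move: h1 h2 lf; rewrite c4; lra.
have mU : measurable (U `&` sph : set (borelC R d)).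
  by apply: measurableI => //; exact: open_borel.
exists U; split=> //.
suff h (n : nat) : (c / 2) ^+ 2 * fine (mu (U `&` sph)) <= 0 + hnorm y ^+ 2 * c / n.+1%:R.
  have := le_harmonic h; rewrite pmulr_rle0 ?exprn_gt0 ?divr_gt0// => h0.
  rewrite -[LHS]fineK; last exact: fin_num_measure.
  by congr (_%:E); apply/eqP; rewrite eq_le h0 fine_ge0.
pose e : R := Num.min (c / 2) (Num.min 1 (c / n.+1%:R)).
have e0 : 0 < e by rewrite !lt_min !divr_gt0 ?ltr01.
have [l' /ltW lf'] := Ad_approx fA e0.
have [i' I'] := integral_sqr_wpoly (ltW e0) (fun x => le_trans (constrained_approx l' x Jf)
  (ler_wpM2r (hnorm_ge0 x) lf')).
rewrite add0r; apply: le_trans (_ : (e * hnorm y) ^+ 2 <= _); last first.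
  rewrite exprMn mulrC -mulrA ler_wpM2l ?sqr_ge0//.
  have e1 : e <= 1 by rewrite !ge_min lexx !orbT.
  have en : e <= c / n.+1%:R by rewrite !ge_min lexx !orbT.
  by rewrite expr2 -[leRHS]mul1r ler_pM// ltW.
apply: le_trans I'.
have i1 : mu.-integrable (U `&` sph) (EFin \o (fun z => normc (wpoly l' (z 0)) ^+ 2)).
  by apply: integrableS i' => //; exact: subIsetr.
apply: (@le_trans _ _ (\int[mu]_(z in U `&` sph) normc (wpoly l' (z 0)) ^+ 2)).
  rewrite -Rintegral_cst//; apply: le_Rintegral => // [|w [Uw wS]].
    exact: finite_measure_integrable_cst.
  have wB := sphere_sub_cball wS.
  have h1 := bdext_close l fA wB; have h2 := bdext_close l' fA wB.
  have h3 := tri (wpoly l (w 0)) (bdext f w); have h4 := tri (bdext f w) (wpoly l' (w 0)).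
  have e2 : e <= c / 2 by rewrite ge_min lexx.
  rewrite ler_pXn2r ?nnegrE ?normc_ge0 ?divr_ge0 ?(ltW c0)//.
  move: Uw; rewrite /U /=; move: h3; rewrite -(normcN (wpoly l (w 0) - _)) opprB => h3 Uw.
  have A := le_trans h3 (lerD (ltW (le_lt_trans h1 lf)) (lexx _)).
  have B := le_trans h4 (lerD (le_trans h2 (le_trans lf' e2)) (lexx _)).
  exact: chain Uw A B.
rewrite /Rintegral fine_le//.
- exact: integrable_fin_num.
- exact: integrable_fin_num.
apply: ge0_subset_integral => //.
- exact: measurable_int i'.
- by move=> w _; rewrite lee_fin sqr_ge0.
Qed.

(** Inner regularity reduces to a compact set, which finitely many of the null
    neighbourhoods cover. *)
Lemma null_off_zero_set : closed (zero_set J `&` sph) -> mu (sph `\` (zero_set J `&` sph)) = 0%E.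
Proof.
move=> cK; set E := _ `\` _.
have mE : measurable (E : set (borelC R d)).
  by apply: measurableD => //; exact: closed_borel.
apply/eqP; rewrite eq_le measure_ge0 andbT; apply/lee_addgt0Pr => e e0; rewrite add0e.
have [K [U [cptK oU KE EU small]]] := inner_regular mu_sphere mE e0.
have /choice[V VP] z : exists V : set X, E z -> [/\ open V, V z & mu (V `&` sph) = 0%E].
  have [[zS nz]|nE] := pselect (E z); last by exists setT.
  have [|V hV] := locally_null zS _; last by exists V.
  by move=> zz; apply: nz.
have := cptK; rewrite compact_cover => /(_ _ K V) [||D DK KV].
- by move=> z /KE /VP[].
- by move=> z Kz; exists z => //; case: (VP z (KE z Kz)).
have mK : measurable (K : set (borelC R d)).
  by apply: closed_borel; apply: compact_closed => //; exact: norm_hausdorff.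
have K0 : mu K = 0%E.
  have sub : K `<=` \big[setU/set0]_(i <- finmap.enum_fset D) (V i `&` sph).
    move=> z Kz; have [i /= iD Vi] := KV z Kz; rewrite -bigcup_seq; exists i => //.
    by split=> //; case: (KE z Kz).
  have neg : mu.-negligible (\big[setU/set0]_(i <- finmap.enum_fset D) (V i `&` sph) : set (borelC R d)).
    rewrite big_seq; elim/big_ind: _ => [|A B|i iD]; [exact: negligible_set0|exact: negligibleU|].
    have /VP[oV _ V0] := KE i (set_mem (DK i iD)).
    by exists (V i `&` sph); split=> //; apply: measurableI => //; exact: open_borel.
  have [B [mB B0 KB]] := neg.
  apply/eqP; rewrite -measure_le0 -B0 le_measure ?inE//.
  exact: subset_trans sub KB.
have mUK : measurable (U `\` K : set (borelC R d)) by apply: measurableD => //; exact: open_borel.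
apply: (@le_trans _ _ (mu K + mu (U `\` K))%E); last by rewrite K0 add0e ltW.
apply: le_trans (measureU2 _ mK mUK); apply: le_measure; rewrite ?inE//.
  exact: measurableU.
by move=> z Ez; have [Kz|nK] := pselect (K z); [left|right; split=> //; exact: EU].
Qed.

End conclusion.

(** * Purity *)

Theorem theorem5p4 (R : realType) (d : nat) (d_ge1 : (1 <= d)%N)
    (H2 : druryArveson R d) (J : set (oball R d -> R[i]))
    (J_ideal : closed_ideal H2 J)
    (J_null : totally_null H2 (zero_set J `&` @sphere R d))
    (H : hilbertSpace R) (H_sep : separable_hilbert H) (T : 'I_d -> H -> H)
    (T_row : commuting_row_contraction T)
    (T_ac : absolutely_continuous H2 T)
    (T_J : constrained H2 J T) :
  pure T.
Proof.
apply: (pure_qform T_row) => y.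
have [mu [mu_sphere mu_hmon]] := spherical_measure y (qform_psd T_row)
  (S_lin T_row) (adjoint_comm T_row) (qform_inv T_row).
have [K_closed _ K_null] := J_null; have [J_Ad _ _ _ _] := J_ideal.
have mS := @measurable_sphere R d.
have mK : measurable (zero_set J `&` @sphere R d : set (borelC R d)) by exact: closed_borel.
have muK : mu (zero_set J `&` @sphere R d) = 0%E.
  rewrite -tvar_positive//; apply: K_null; first exact: positive_regular.
  exact: (moment_henkin T_row mu_hmon).
have muSK := null_off_zero_set T_row mu_sphere mu_hmon J_Ad T_J K_closed.
have muS : mu (@sphere R d) = 0%E.
  apply/eqP; rewrite -measure_le0.
  apply: (@le_trans _ _ (mu (zero_set J `&` @sphere R d) +
    mu (@sphere R d `\` (zero_set J `&` @sphere R d)))%E); last by rewrite muK muSK adde0.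
  apply: le_trans (measureU2 mu mK (measurableD mS mK)).
  by rewrite setDUK//; exact: subIsetr.
rewrite -[LHS](mu_hmon [::] [::]); apply: normc0_eq0; apply/eqP.
rewrite eq_le normc_ge0 andbT -[leRHS](mulr0 1) -[X in _ * X](mulr0 2) -[X in _ * (_ * X)]/(fine 0%E) -muS.
apply: normc_cintegral => //; first exact: (sphere_hmon T_row).
by move=> z _; rewrite /hmon /wmon !big_nil rmorph1 mulr1 normc_real normr1.
Qed.
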